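(* Let $G$ be a finite group and let $\mathcal{U}$ be a $G$-universe. There exists a zig-zag of weak equivalences of $G$-operads connecting the infinite little discs operad $\mathcal{D}(\mathcal{U})$ and the linear isometries operad $\mathcal{L}(\mathcal{U})$ if and only if $\mathcal{U} \cong \mathbb{R}[G/N]^\infty$ (as $G$-representations) for some normal subgroup $N \unlhd G$.
   Context: A $G$-universe $\mathcal{U}$ is a countably infinite-dimensional real orthogonal $G$-representation which contains a non-zero subrepresentation on which $G$ acts trivially, and such that for every finite-dimensional subrepresentation $V \subset \mathcal{U}$ and every $n$, $V^{\oplus n}$ embeds in $\mathcal{U}$ as a subrepresentation. For $N \unlhd G$, $\mathbb{R}[G/N]^\infty$ is the direct sum of countably infinitely many copies of the permutation representation $\mathbb{R}[G/N]$, viewed as a $G$-representation. A $G$-operad $\mathcal{O}$ consists of a $G\times\Sigma_n$-space $\mathcal{O}(n)$ for each $n\ge 0$, a $G$-fixed identity $1\in\mathcal{O}(1)$, and $G$-equivariant composition maps $\mathcal{O}(k)\times\mathcal{O}(n_1)\times\cdots\times\mathcal{O}(n_k)\to\mathcal{O}(n_1+\cdots+n_k)$, satisfying the usual unitality, associativity and permutation equivariance conditions. A map of $G$-operads consists of continuous $G\times\Sigma_n$-equivariant maps $\mathcal{O}(n)\to\mathcal{P}(n)$ compatible with identity and composition. It is a weak equivalence if $\mathcal{O}(n)^\Gamma\to\mathcal{P}(n)^\Gamma$ is a (weak homotopy) equivalence for all $n$ and all subgroups $\Gamma\le G\times\Sigma_n$. For a finite-dimensional orthogonal $G$-representation $V$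 with (open) unit disc $D(V)$ centred at the origin, a little $V$-disc is a (not necessarily equivariant) affine map $D(V)\to D(V)$ of the form $v\mapsto rv+b$ with $r>0$ real. $\mathcal{D}(V)(n)$ is the space of $n$-tuples of little $V$-discs with pairwise disjoint images, with $G$ acting by conjugation and $\Sigma_n$ by permutation, and operad structure by composition of maps. An inclusion $V\subset W$ induces a map $\mathcal{D}(V)\to\mathcal{D}(W)$ by thickening discs ($v\mapsto rv+b$ goes to $w\mapsto rw+b$). The infinite little discs operad $\mathcal{D}(\mathcal{U})$ is the colimit of $\mathcal{D}(V)$ over the poset of finite-dimensional subrepresentations $V\subseteq\mathcal{U}$. The linear isometries operad $\mathcal{L}(\mathcal{U})$ has $\mathcal{L}(\mathcal{U})(n)$ the space of (not necessarily equivariant) linear isometries $\mathcal{U}^{\oplus n}\to\mathcal{U}$, with $G$ acting by conjugation, $\Sigma_n$ by permuting summands, and operad structure by composition and direct sum. *)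

(* Defs.v *)
From HB Require Import structures.
From Stdlib Require Import Relation_Operators.
From mathcomp Require Import all_boot all_order all_algebra all_fingroup.
From mathcomp Require Import boolp classical_sets functions reals topology.
From mathcomp Require Import normedtype ring lra.

Set Implicit Arguments.
Unset Strict Implicit.
Unset Printing Implicit Defensive.
Import Order.TTheory GRing.Theory Num.Theory.
Import numFieldNormedType.Exports.

Local Open Scope classical_set_scope.
Local Open Scope ring_scope.

Record rep (R : realType) (gT : finGroupType) := Rep {
  rep_sort :> lmodType R;
  rho : gT -> rep_sort -> rep_sort;
  rho_linear : forall g, linear (rho g);
  rho1 : forall v, rho 1%g v = v;
  rhoM : forall g h v, rho (g * h)%g v = rho g (rho h v) }.

Arguments rho {R gT r} g v.

Record orthrep (R : realType) (gT : finGroupType) := OrthRep {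
  orthrep_rep :> rep R gT;
  ip : orthrep_rep -> orthrep_rep -> R;
  ip_sym : forall v w, ip v w = ip w v;
  ip_linear : forall w, scalar (ip^~ w);
  ip_gt0 : forall v, v != 0 -> 0 < ip v v;
  ip_rho : forall g v w, ip (rho g v) (rho g w) = ip v w }.

Arguments ip {R gT o} v w.

Definition onorm (R : realType) (gT : finGroupType) (U : orthrep R gT) (v : U)
  : R := Num.sqrt (ip v v).

Definition rep_iso (R : realType) (gT : finGroupType) (U W : rep R gT) : Prop :=
  exists f : U -> W, [/\ linear f, bijective f &
    forall g v, f (rho g v) = rho g (f v)].

Section Subspaces.
Context (R : realType).

Definition fdim_subspace (E : lmodType R) (V : set E) : Prop :=
  exists n (b : 'I_n -> E),
    V = [set \sum_i a i *: b i | a in [set: 'I_n -> R]].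

Definition subrep (gT : finGroupType) (U : rep R gT) (V : set U) : Prop :=
  [/\ V 0, forall a v w, V v -> V w -> V (a *: v + w)
    & forall g v, V v -> V (rho g v)].

Definition is_countable_basis (E : lmodType R) (b : nat -> E) : Prop :=
  (forall n (a : 'I_n -> R),
     \sum_(i < n) a i *: b i = 0 -> forall i, a i = 0) /\
  (forall v, exists n (a : 'I_n -> R), v = \sum_(i < n) a i *: b i).

End Subspaces.

Section DirectSums.
Context (R : realType) (gT : finGroupType).

Section Finite.
Variables (U : rep R gT) (n : nat).

Definition dsum_rho (g : gT) (x : {ffun 'I_n -> U}) : {ffun 'I_n -> U} :=
  [ffun i => rho g (x i)].

Lemma dsum_rho_linear g : linear (dsum_rho g).
Proof. by move=> a x y; apply/ffunP => i; rewrite !ffunE rho_linear. Qed.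

Lemma dsum_rho1 x : dsum_rho 1%g x = x.
Proof. by apply/ffunP => i; rewrite ffunE rho1. Qed.

Lemma dsum_rhoM g h x : dsum_rho (g * h)%g x = dsum_rho g (dsum_rho h x).
Proof. by apply/ffunP => i; rewrite !ffunE rhoM. Qed.

Definition dsum_rep : rep R gT := Rep dsum_rho_linear dsum_rho1 dsum_rhoM.

End Finite.

Section Orthogonal.
Variables (U : orthrep R gT) (n : nat).

Definition dsum_ip (x y : dsum_rep U n) : R := \sum_i ip (x i) (y i).

Lemma dsum_ip_sym x y : dsum_ip x y = dsum_ip y x.
Proof. by apply: eq_bigr => i _; rewrite ip_sym. Qed.

Lemma dsum_ip_linear y : scalar (dsum_ip^~ y).
Proof.
move=> a x z; rewrite /dsum_ip mulr_sumr -big_split /=.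
by apply: eq_bigr => i _; rewrite !ffunE ip_linear.
Qed.

Lemma ip_ge0 (v : U) : 0 <= ip v v.
Proof.
have [->|v0] := eqVneq v 0; last exact/ltW/ip_gt0.
have := ip_linear 0 (-1) 0 (0 : U); rewrite scaler0 addr0 mulN1r addNr.
by move=> ->.
Qed.

Lemma dsum_ip_gt0 x : x != 0 -> 0 < dsum_ip x x.
Proof.
move=> x0; rewrite lt_neqAle sumr_ge0 ?andbT; last by move=> i _; exact: ip_ge0.
rewrite eq_sym; apply: contraNneq x0 => /eqP.
rewrite psumr_eq0 => [/allP s0|i _]; last exact: ip_ge0.
apply/eqP/ffunP => i; rewrite ffunE; apply/eqP.
have := s0 i (mem_index_enum i); apply: contraLR => /ip_gt0.
by rewrite lt0r => /andP[].
Qed.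

Lemma dsum_ip_rho g x y : dsum_ip (rho g x) (rho g y) = dsum_ip x y.
Proof. by apply: eq_bigr => i _; rewrite !ffunE ip_rho. Qed.

Definition dsum : orthrep R gT :=
  @OrthRep R gT (dsum_rep U n) dsum_ip
    dsum_ip_sym dsum_ip_linear dsum_ip_gt0 dsum_ip_rho.

End Orthogonal.

Section Infinite.
Variable U : rep R gT.

Definition finsupp : {pred nat -> U} :=
  fun x => `[< exists m, forall k, (m <= k)%N -> x k = 0 >].

Lemma finsuppP x :
  reflect (exists m, forall k, (m <= k)%N -> x k = 0) (x \in finsupp).
Proof. exact: asboolP. Qed.

Lemma finsupp_submod : submod_closed finsupp.
Proof.
split=> [|a x y /finsuppP[m hm] /finsuppP[p hp]]; apply/finsuppP.
  by exists 0%N.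
exists (maxn m p) => k; rewrite geq_max => /andP[mk pk].
have -> : (a *: x + y) k = a *: (x k : U) + y k by [].
by rewrite hm// hp// addr0 scaler0.
Qed.

HB.instance Definition _ :=
  GRing.isSubmodClosed.Build R (nat -> U) finsupp finsupp_submod.

Record infsum := InfSum { infsum_fun :> nat -> U; _ : infsum_fun \in finsupp }.

HB.instance Definition _ := [isSub for infsum_fun].
HB.instance Definition _ := [Choice of infsum by <:].
HB.instance Definition _ := [SubChoice_isSubLmodule of infsum by <:].

Lemma infsum_rho_subproof g (x : infsum) : (fun k => rho g (x k)) \in finsupp.
Proof.
have /finsuppP[m hm] := valP x; apply/finsuppP; exists m => k /hm xk0.
rewrite [x k]xk0 -[X in rho g X](scaler0 _ (-1)) -[_ *: _]addr0.
by rewrite rho_linear scaleN1r addNr.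
Qed.

Definition infsum_rho g (x : infsum) : infsum :=
  InfSum (infsum_rho_subproof g x).

Lemma infsum_rho_linear g : linear (infsum_rho g).
Proof.
move=> a x y; apply/val_inj/funext => k.
have E (z w : infsum) : (a *: z + w) k = a *: (z k : U) + w k.
  by rewrite -[LHS]/(val (a *: z + w) k) linearP.
rewrite -[LHS]/(rho g ((a *: x + y : infsum) k)).
rewrite -[RHS]/((a *: infsum_rho g x + infsum_rho g y : infsum) k).
by rewrite !E rho_linear.
Qed.

Lemma infsum_rho1 x : infsum_rho 1%g x = x.
Proof. by apply/val_inj/funext => k; exact: rho1. Qed.

Lemma infsum_rhoM g h x :
  infsum_rho (g * h)%g x = infsum_rho g (infsum_rho h x).
Proof. by apply/val_inj/funext => k; exact: rhoM. Qed.

Definition infsum_rep : rep R gT :=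
  Rep infsum_rho_linear infsum_rho1 infsum_rhoM.

End Infinite.

Section Permutation.
Variables (N : {group gT}) (nN : (N <| [set: gT]%G)%g).

(* A function f stands for \sum_x f(x) [x], so that g [x] = [g x]. *)
Definition perm_rho (g : gT) (f : {ffun coset_of N -> R}) :
  {ffun coset_of N -> R} := [ffun x => f ((coset N g)^-1 * x)%g].

Lemma perm_rho_linear g : linear (perm_rho g).
Proof. by move=> a f h; apply/ffunP => x; rewrite !ffunE. Qed.

Lemma perm_rho1 f : perm_rho 1%g f = f.
Proof. by apply/ffunP => x; rewrite ffunE morph1 invg1 mul1g. Qed.

Lemma perm_rhoM g h f : perm_rho (g * h)%g f = perm_rho g (perm_rho h f).
Proof.
apply/ffunP => x; rewrite !ffunE morphM ?invMg ?mulgA//;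
by apply: (fintype.subsetP (normal_norm nN)); rewrite inE.
Qed.

Definition perm_rep : rep R gT := Rep perm_rho_linear perm_rho1 perm_rhoM.

End Permutation.

End DirectSums.

Arguments perm_rep R {gT N} nN.

Record universe (R : realType) (gT : finGroupType) := Universe {
  univ_rep :> orthrep R gT;
  univ_dim : exists b : nat -> univ_rep, is_countable_basis b;
  univ_trivial : exists V : set univ_rep,
    [/\ subrep V, exists2 v, V v & v != 0 & forall g v, V v -> rho g v = v];
  univ_dsum : forall (V : set univ_rep) (n : nat),
    subrep V -> fdim_subspace V ->
    let Vn := [set x : dsum univ_rep n | forall i, V (x i)] in
    exists f : dsum univ_rep n -> univ_rep,
      [/\ forall a x y, Vn x -> Vn y -> f (a *: x + y) = a *: f x + f y,
          forall x y, Vn x -> Vn y -> f x = f y -> x = y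
        & forall g x, Vn x -> f (rho g x) = rho g (f x)] }.

Section CompactlyGenerated.

Definition compactly_generated (X : topologicalType) : Prop :=
  forall A : set X,
    (forall (K : topologicalType) (u : K -> X), compact [set: K] ->
       hausdorff_space K -> continuous u -> open (u @^-1` A)) -> open A.

Definition weak_hausdorff (X : topologicalType) : Prop :=
  forall (K : topologicalType) (u : K -> X), compact [set: K] ->
    hausdorff_space K -> continuous u -> closed (range u).

(* Continuity for the compactly generated topology refining that of X. *)
Definition kcontinuous (X Y : topologicalType) (f : X -> Y) : Prop :=
  forall (K : topologicalType) (u : K -> X), compact [set: K] ->
    hausdorff_space K -> continuous u -> continuous (f \o u).

Definition kify (X : topologicalType) : Type := X.

Section Kify.
Variable X : topologicalType.

Definition kopen (A : set (kify X)) : Prop :=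
  forall (K : topologicalType) (u : K -> X), compact [set: K] ->
    hausdorff_space K -> continuous u -> open (u @^-1` A).

Lemma kopenT : kopen setT.
Proof. by move=> K u _ _ _; rewrite preimage_setT; exact: openT. Qed.

Lemma kopenI : setI_closed kopen.
Proof.
by move=> A B oA oB K u cK hK cu; rewrite preimage_setI; apply: openI;
  [exact: oA|exact: oB].
Qed.

Lemma kopen_bigU (I : Type) (f : I -> set (kify X)) :
  (forall i, kopen (f i)) -> kopen (\bigcup_i f i).
Proof.
move=> of_ K u cK hK cu; rewrite preimage_bigcup.
by apply: bigcup_open => i _; exact: of_.
Qed.

HB.instance Definition _ := Choice.copy (kify X) X.
HB.instance Definition _ :=
  isOpenTopological.Build (kify X) kopenT kopenI kopen_bigU.

End Kify.

End CompactlyGenerated.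

Section FinTop.
Context (R : realType) (gT : finGroupType) (E : orthrep R gT).

(* The colimit topology over the finite-dimensional subspaces. *)
Definition fintop : Type := E.

Definition fin_open (A : set fintop) : Prop :=
  forall V : set E, fdim_subspace V -> forall x : E, V x -> A x ->
  exists2 e : R, 0 < e & forall y : E, V y -> onorm (y - x) < e -> A y.

Lemma fin_openT : fin_open setT.
Proof. by move=> V _ x _ _; exists 1. Qed.

Lemma fin_openI : setI_closed fin_open.
Proof.
move=> A B oA oB V fV x Vx [Ax Bx].
have [e e0 he] := oA V fV x Vx Ax; have [d d0 hd] := oB V fV x Vx Bx.
exists (Num.min e d) => [|y Vy]; first by rewrite lt_min e0.
by rewrite lt_min => /andP[ye yd]; split; [exact: he|exact: hd].
Qed.

Lemma fin_open_bigU (I : Type) (f : I -> set fintop) :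
  (forall i, fin_open (f i)) -> fin_open (\bigcup_i f i).
Proof.
move=> of_ V fV x Vx [i _ fix_]; have [e e0 he] := of_ i V fV x Vx fix_.
by exists e => // y Vy ye; exists i => //; exact: he.
Qed.

HB.instance Definition _ := Choice.copy fintop E.
HB.instance Definition _ :=
  isOpenTopological.Build fintop fin_openT fin_openI fin_open_bigU.

End FinTop.

(* The constituents of a G-operad, without the axioms (is_operad below).
   'S_n carries the product (s * t)%g = t \o s, so that the usual right action
   of Sigma_n on O(n) is a left action here: op_act (g, s) c is g (c s). *)
Record operad_data (gT : finGroupType) := OperadData {
  op_space :> nat -> topologicalType;
  op_act : forall n, gT * 'S_n -> op_space n -> op_space n;
  op_one : op_space 1;
  op_comp : forall k (n : 'I_k -> nat),
    op_space k -> (forall i, op_space (n i)) -> op_space (\sum_i n i)%N }.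

Arguments op_act {gT} o {n}.
Arguments op_comp {gT} o {k n}.

Section OperadIndices.

(* tagnat identifies 'I_(\sum_i n i) with the pairs (i, j), j < n i, in the
   lexicographic order; Rank j below stands for the pair (i, j). *)

Lemma sum_ones k : (\sum_(i < k) 1 = k)%N.
Proof. by rewrite sum1_card card_ord. Qed.

Lemma sum_sum k (n : 'I_k -> nat) (m : forall i, 'I_(n i) -> nat) :
  (\sum_(x < \sum_i n i) m (tagnat.sig1 x) (tagnat.sig2 x) =
   \sum_i \sum_(j < n i) m i j)%N.
Proof.
rewrite sig_big_dep /= (reindex (@tagnat.rank k n)) /=; last first.
  exact: tagnat.rank_bij_on.
apply: eq_bigr => p _; rewrite /tagnat.sig1 /tagnat.sig2.
by case: (tagnat.sig (tagnat.rank p)) / (esym (tagnat.rankK p)).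
Qed.

Lemma sum_perm k (s : 'S_k) (n : 'I_k -> nat) :
  (\sum_i n (s i) = \sum_i n i)%N.
Proof. by rewrite [RHS](reindex_perm s). Qed.

(* The block sum of the t i. *)
Definition dsum_perm_fun k (n : 'I_k -> nat) (t : forall i, 'S_(n i))
  (x : 'I_(\sum_i n i)) : 'I_(\sum_i n i) :=
  tagnat.Rank (tagnat.sig1 x) (t (tagnat.sig1 x) (tagnat.sig2 x)).

Lemma dsum_perm_inj k (n : 'I_k -> nat) (t : forall i, 'S_(n i)) :
  injective (dsum_perm_fun t).
Proof.
apply: (can_inj (g := dsum_perm_fun (fun i => (t i)^-1)%g)) => x.
rewrite /dsum_perm_fun -[RHS]tagnat.sigK /tagnat.Rank; congr tagnat.rank.
rewrite /tagnat.sig1 /tagnat.sig2 tagnat.rankK /= permK.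
by case: (tagnat.sig x).
Qed.

Definition dsum_perm k (n : 'I_k -> nat) (t : forall i, 'S_(n i)) :
  'S_(\sum_i n i) := perm (@dsum_perm_inj k n t).

(* The permutation of blocks sending position j of the i-th block, of length
   n (s i), to position j of the block s i. *)
Definition block_perm_fun k (s : 'S_k) (n : 'I_k -> nat)
  (x : 'I_(\sum_i n i)) : 'I_(\sum_i n i) :=
  let y := cast_ord (esym (sum_perm s n)) x in
  tagnat.Rank (s (tagnat.sig1 y)) (tagnat.sig2 y).

Lemma block_perm_inj k (s : 'S_k) (n : 'I_k -> nat) :
  injective (block_perm_fun s (n := n)).
Proof.
pose f (p : {i & 'I_(n (s i))}) : {i & 'I_(n i)} :=
  existT (fun i => 'I_(n i)) (s (tag p)) (tagged p).
have fI : injective f.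
  move=> [i j] [i' j'] E.
  have /perm_inj e : s i = s i' by exact: (congr1 (@projT1 _ _) E).
  case: _ / e in j' E *; move/eqP: E.
  by rewrite /f eq_Tagged /= => /eqP ->.
move=> x y /tagnat.rank_inj E.
by have /fI/tagnat.sig_inj/cast_ord_inj : f (tagnat.sig _) = f (tagnat.sig _)
  := E.
Qed.

Definition block_perm k (s : 'S_k) (n : 'I_k -> nat) : 'S_(\sum_i n i) :=
  perm (@block_perm_inj k s n).

End OperadIndices.

(* Spaces are compactly generated weak Hausdorff and products are taken in that
   category, hence kcontinuous: for the topology of the plain product, the
   composition of linear isometries of an infinite-dimensional universe is not
   continuous. *)
Record is_operad (gT : finGroupType) (O : operad_data gT) : Prop := IsOperad {
  op_cg : forall n, compactly_generated (O n) /\ weak_hausdorff (O n);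
  op_act1 : forall n (c : O n), op_act O 1%g c = c;
  op_actM : forall n (x y : gT * 'S_n) (c : O n),
    op_act O (x * y)%g c = op_act O x (op_act O y c);
  op_act_cont : forall n (x : gT * 'S_n), continuous (op_act O x);
  op_comp_cont : forall k (n : 'I_k -> nat),
    kcontinuous (fun p : O k * prod_topology (fun i => O (n i)) =>
      op_comp O p.1 p.2);
  op_one_fixed : forall g, op_act O (g, 1%g) (op_one O) = op_one O;
  op_comp_equiv : forall g k (n : 'I_k -> nat) (c : O k) (d : forall i, O (n i)),
    op_act O (g, 1%g) (op_comp O c d) =
    op_comp O (op_act O (g, 1%g) c) (fun i => op_act O (g, 1%g) (d i));
  op_comp1l : forall n (c : O n),
    ecast m (O m) (big_ord1 _ (fun=> n)) (op_comp O (op_one O) (fun=> c)) = c;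
  op_comp1r : forall k (c : O k),
    ecast m (O m) (sum_ones k) (op_comp O c (fun=> op_one O)) = c;
  op_compA : forall k (n : 'I_k -> nat) (m : forall i, 'I_(n i) -> nat)
      (c : O k) (d : forall i, O (n i)) (e : forall i j, O (m i j)),
    ecast p (O p) (sum_sum m)
      (op_comp O (op_comp O c d) (fun x => e (tagnat.sig1 x) (tagnat.sig2 x))) =
    op_comp O c (fun i => op_comp O (d i) (e i));
  op_comp_block : forall k (n : 'I_k -> nat) (s : 'S_k)
      (c : O k) (d : forall i, O (n i)),
    ecast p (O p) (sum_perm s n)
      (op_comp O (op_act O (1%g, s) c) (fun i => d (s i))) =
    op_act O (1%g, block_perm s n) (op_comp O c d);
  op_comp_dsum : forall k (n : 'I_k -> nat) (t : forall i, 'S_(n i))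
      (c : O k) (d : forall i, O (n i)),
    op_comp O c (fun i => op_act O (1%g, t i) (d i)) =
    op_act O (1%g, dsum_perm t) (op_comp O c d) }.

Section HomotopyGroups.
Context (R : realType).

Definition unit_cube k : set 'rV[R]_k := [set u | forall i, 0 <= u ord0 i <= 1].

Definition cube_boundary k : set 'rV[R]_k :=
  [set u | unit_cube u /\ exists i, u ord0 i = 0 \/ u ord0 i = 1].

Variable X : topologicalType.
Implicit Types (A : set X) (x y : X).

Definition joined A x y : Prop :=
  exists p : R -> X, [/\ {within [set t | 0 <= t <= 1], continuous p},
    forall t, 0 <= t <= 1 -> A (p t), p 0 = x & p 1 = y].

(* Representatives of the elements of pi_k(A, x), A a subspace of X. *)
Definition based_cube A x k (a : 'rV[R]_k -> X) : Prop :=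
  [/\ {within @unit_cube k, continuous a},
      forall u, unit_cube u -> A (a u)
    & forall u, cube_boundary u -> a u = x].

Definition based_homotopic A x k (a b : 'rV[R]_k -> X) : Prop :=
  exists H : R * 'rV[R]_k -> X,
    [/\ {within [set q | 0 <= q.1 <= 1 /\ unit_cube q.2], continuous H},
        forall t u, 0 <= t <= 1 -> unit_cube u -> A (H (t, u)),
        forall u, unit_cube u -> H (0, u) = a u,
        forall u, unit_cube u -> H (1, u) = b u
      & forall t u, 0 <= t <= 1 -> cube_boundary u -> H (t, u) = x].

End HomotopyGroups.

Arguments joined R {X} A x y.
Arguments based_cube R {X} A x k a.
Arguments based_homotopic R {X} A x k a b.

(* f restricts to a map from the subspace A to the subspace B. *)
Record weak_homotopy_equiv (R : realType) (X Y : topologicalType)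
    (A : set X) (B : set Y) (f : X -> Y) : Prop := WeakHomotopyEquiv {
  whe_pi0_inj : forall x x', A x -> A x' ->
    joined R B (f x) (f x') -> joined R A x x';
  whe_pi0_surj : forall y, B y -> exists2 x, A x & joined R B (f x) y;
  whe_pi_inj : forall k x, (0 < k)%N -> A x -> forall a a',
    based_cube R A x k a -> based_cube R A x k a' ->
    based_homotopic R B (f x) k (f \o a) (f \o a') ->
    based_homotopic R A x k a a';
  whe_pi_surj : forall k x, (0 < k)%N -> A x -> forall b,
    based_cube R B (f x) k b ->
    exists2 a, based_cube R A x k a & based_homotopic R B (f x) k (f \o a) b }.

Section WeakEquivalences.
Context (R : realType) (gT : finGroupType).
Implicit Types O P : operad_data gT.

Definition op_fixed O n (Gam : {group gT * 'S_n}) : set (O n) :=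
  [set c | forall x, x \in Gam -> op_act O x c = c].
Arguments op_fixed O {n} Gam.

Record is_operad_map O P (f : forall n, O n -> P n) : Prop := IsOperadMap {
  opm_cont : forall n, continuous (f n);
  opm_act : forall n x (c : O n), f n (op_act O x c) = op_act P x (f n c);
  opm_one : f 1 (op_one O) = op_one P;
  opm_comp : forall k (n : 'I_k -> nat) (c : O k) (d : forall i, O (n i)),
    f _ (op_comp O c d) = op_comp P (f k c) (fun i => f (n i) (d i)) }.

Definition weakly_equiv_to O P : Prop :=
  [/\ is_operad O, is_operad P & exists2 f : forall n, O n -> P n,
    is_operad_map f & forall n (Gam : {group gT * 'S_n}),
      weak_homotopy_equiv R (op_fixed O Gam) (op_fixed P Gam) (f n)].

Definition operad_zigzag : operad_data gT -> operad_data gT -> Prop :=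
  clos_refl_sym_trans _ weakly_equiv_to.

End WeakEquivalences.

Section LinearIsometries.
Context (R : realType) (gT : finGroupType) (U : orthrep R gT).

Record linisom n := LinIsom {
  linisom_fun :> dsum U n -> U;
  linisom_linear : linear linisom_fun;
  linisom_isom : forall x, onorm (linisom_fun x) = onorm x }.

HB.instance Definition _ n := gen_eqMixin (linisom n).
HB.instance Definition _ n := gen_choiceMixin (linisom n).

Lemma linisomP n (f f' : linisom n) : (forall x, f x = f' x) -> f = f'.
Proof.
case: f f' => f lf nf [f' lf' nf'] /= /funext E; case: _ / E in lf' nf' *.
by congr LinIsom; exact: Prop_irrelevance.
Qed.

(* The function space of compactly generated spaces, U and its direct sums being
   topologized as the colimits of their finite-dimensional subspaces. *)
Definition linisom_space n : topologicalType :=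
  kify (initial_topology (fun f : linisom n =>
    linisom_fun f : {compact-open, fintop (dsum U n) -> fintop U})).

Section Action.
Variables (n : nat) (x : gT * 'S_n) (f : linisom n).

Definition linisom_act_fun (v : dsum U n) : U :=
  rho x.1 (f [ffun i => rho x.1^-1%g (v ((x.2)^-1%g i))]).

Lemma linisom_act_linear : linear linisom_act_fun.
Proof.
move=> a v w; rewrite /linisom_act_fun -rho_linear -linisom_linear.
by congr (rho _ (f _)); apply/ffunP => i; rewrite !ffunE rho_linear.
Qed.

Lemma linisom_act_isom v : onorm (linisom_act_fun v) = onorm v.
Proof.
rewrite /linisom_act_fun /onorm ip_rho -/(onorm _) linisom_isom /onorm.
congr Num.sqrt; rewrite /= /dsum_ip [RHS](reindex_perm (x.2)^-1%g).
by apply: eq_bigr => i _; rewrite ffunE ip_rho.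
Qed.

Definition linisom_act : linisom n := LinIsom linisom_act_linear linisom_act_isom.

End Action.

Lemma linisom_one_linear : linear (fun x : dsum U 1 => x ord0).
Proof. by move=> a x y; rewrite !ffunE. Qed.

Lemma linisom_one_isom (x : dsum U 1) : onorm (x ord0) = onorm x.
Proof. by rewrite /onorm /= /dsum_ip big_ord1. Qed.

Definition linisom_one : linisom 1 :=
  LinIsom linisom_one_linear linisom_one_isom.

Section Composition.
Variables (k : nat) (n : 'I_k -> nat).
Variables (f : linisom k) (h : forall i, linisom (n i)).

Definition linisom_comp_fun (x : dsum U (\sum_i n i)) : U :=
  f [ffun i => h i [ffun j => x (tagnat.Rank i j)]].

Lemma linisom_comp_linear : linear linisom_comp_fun.
Proof.
move=> a x y; rewrite /linisom_comp_fun -linisom_linear; congr (f _).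
apply/ffunP => i; rewrite !ffunE -linisom_linear; congr (h i _).
by apply/ffunP => j; rewrite !ffunE.
Qed.

Lemma ip_linisom m (l : linisom m) x : ip (l x) (l x) = ip x x.
Proof.
by rewrite -[LHS]sqr_sqrtr ?ip_ge0// -[RHS]sqr_sqrtr ?ip_ge0// -!/(onorm _)
  linisom_isom.
Qed.

Lemma linisom_comp_isom x : onorm (linisom_comp_fun x) = onorm x.
Proof.
rewrite /onorm ip_linisom; congr Num.sqrt.
transitivity (\sum_i \sum_(j < n i)
    ip (x (tagnat.Rank i j)) (x (tagnat.Rank i j))).
  apply: eq_bigr => i _; rewrite ffunE ip_linisom.
  by apply: eq_bigr => j _; rewrite ffunE.
rewrite sig_big_dep /= /dsum_ip [RHS](reindex (@tagnat.rank k n)) /=; last first.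
  exact: tagnat.rank_bij_on.
by apply: eq_bigr => -[i j] _.
Qed.

Definition linisom_comp : linisom (\sum_i n i) :=
  LinIsom linisom_comp_linear linisom_comp_isom.

End Composition.

Definition linear_isometries_operad : operad_data gT :=
  @OperadData gT linisom_space linisom_act linisom_one linisom_comp.

End LinearIsometries.

Section Norm.
Context (R : realType) (gT : finGroupType) (U : orthrep R gT).
Implicit Types (v w x : U) (a : R).

Lemma ipDl v w x : ip (v + w) x = ip v x + ip w x.
Proof. by have := ip_linear x 1 v w; rewrite scale1r mul1r. Qed.

Lemma ipZl a v x : ip (a *: v) x = a * ip v x.
Proof.
have i0 : ip (0 : U) x = 0.
  by have := ipDl 0 0 x; rewrite addr0 => /eqP; rewrite -subr_eq0 opprD addNKr
    oppr_eq0 => /eqP.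
by have := ip_linear x a v 0; rewrite addr0 i0 addr0.
Qed.

Lemma onorm_ge0 v : 0 <= onorm v. Proof. exact: sqrtr_ge0. Qed.

Lemma onorm_sqr v : onorm v ^+ 2 = ip v v.
Proof. by rewrite sqr_sqrtr// ip_ge0. Qed.

Lemma onormZ a v : onorm (a *: v) = `|a| * onorm v.
Proof.
by rewrite /onorm ipZl ip_sym ipZl mulrA sqrtrM ?sqr_ge0// -expr2 sqrtr_sqr.
Qed.

Lemma onorm_gt0 v : v != 0 -> 0 < onorm v.
Proof. by move=> /ip_gt0; rewrite sqrtr_gt0. Qed.

Lemma onorm0 : onorm (0 : U) = 0.
Proof. by rewrite -(scale0r (0 : U)) onormZ normr0 mul0r. Qed.

Lemma onorm_rho g v : onorm (rho g v) = onorm v.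
Proof. by rewrite /onorm ip_rho. Qed.

Lemma ip_le_onorm v w : ip v w <= onorm v * onorm w.
Proof.
have [->|w0] := eqVneq w 0.
  by rewrite -(scale0r (0 : U)) ip_sym ipZl mul0r mulr_ge0 ?onorm_ge0.
have n0 := onorm_gt0 w0.
have := ip_ge0 (onorm w *: v + (- onorm v) *: w).
rewrite ipDl !ipZl ![ip _ (_ + _)]ip_sym !ipDl !ipZl -!onorm_sqr (ip_sym w v).
have [v0|v0] := eqVneq v 0.
  rewrite v0 -(scale0r (0 : U)) ipZl mul0r => _.
  by rewrite mulr_ge0// onorm_ge0.
have m0 := onorm_gt0 v0; set p := ip v w; set a := onorm v in m0 *.
set b := onorm w in n0 *; move=> h.
have : 0 <= (a * b - p) * (2 * a * b).
  apply: le_trans h _; rewrite le_eqVlt; apply/orP; left; apply/eqP; ring.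
by rewrite pmulr_lge0 ?subr_ge0// !mulr_gt0.
Qed.

Lemma ler_onormD v w : onorm (v + w) <= onorm v + onorm w.
Proof.
rewrite -(@ler_pXn2r _ 2) ?nnegrE ?addr_ge0 ?onorm_ge0// sqrrD !onorm_sqr.
rewrite ipDl ![ip _ (_ + _)]ip_sym !ipDl (ip_sym w v).
have := ip_le_onorm v w; lra.
Qed.

End Norm.

Section LittleDiscs.
Context (R : realType) (gT : finGroupType).

Section Discs.
Variable U : orthrep R gT.

(* The pair (r, b) stands for the affine map v |-> r v + b. *)
Definition disc_map (d : R * U) (v : U) : U := d.1 *: v + d.2.

Definition unit_disc (V : set U) : set U := [set v | V v /\ onorm v < 1].

Definition little_disc (V : set U) (d : R * U) : Prop :=
  [/\ 0 < d.1, V d.2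
    & forall v, unit_disc V v -> unit_disc V (disc_map d v)].

(* The underlying set of D(V)(n). *)
Definition little_discs (V : set U) n (c : 'I_n -> R * U) : Prop :=
  (forall i, little_disc V (c i)) /\
  (forall i j, i != j -> forall v w, unit_disc V v -> unit_disc V w ->
     disc_map (c i) v <> disc_map (c j) w).

(* V = 0 is left out: the radius of a little disc in D(0) is not determined by
   the map D(0) -> D(0), and the nonzero V are cofinal. *)
Definition disc_stage (V : set U) : Prop :=
  [/\ subrep V, fdim_subspace V & exists2 v, V v & v != 0].

Lemma subrepZ (V : set U) a v : subrep V -> V v -> V (a *: v).
Proof. by move=> [V0 Vl _] Vv; rewrite -[_ *: _]addr0; exact: Vl. Qed.

Lemma subrepD (V : set U) v w : subrep V -> V v -> V w -> V (v + w).
Proof. by move=> [V0 Vl _] Vv Vw; rewrite -[v]scale1r; exact: Vl. Qed.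

Lemma disc_mapP (V : set U) d v : subrep V -> little_disc V d ->
  V v -> V (disc_map d v).
Proof. by move=> sV [_ Vd _] Vv; apply: subrepD => //; exact: subrepZ. Qed.

Lemma little_disc_bound (V : set U) d : disc_stage V -> little_disc V d ->
  d.1 + onorm d.2 <= 1.
Proof.
case: d => r b [sV _ [v0 Vv0 v0n]] [/= r0 Vb dV]; rewrite leNgt; apply/negP => h.
have [u [Vu nu bu]] : exists u, [/\ V u, onorm u = 1 & b = onorm b *: u].
  have nz (v : U) : v != 0 -> onorm ((onorm v)^-1 *: v) = 1.
    move=> /onorm_gt0 v_gt0; rewrite onormZ ger0_norm ?invr_ge0 ?onorm_ge0//.
    by rewrite mulVf// gt_eqF.
  have [->|bn] := eqVneq b 0.
    exists ((onorm v0)^-1 *: v0); split; [exact: subrepZ|exact: nz|].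
    by rewrite onorm0 scale0r.
  exists ((onorm b)^-1 *: b); split; [exact: subrepZ|exact: nz|].
  by rewrite scalerA mulfV ?scale1r// gt_eqF// onorm_gt0.
have V0 : V 0 by case: sV.
have b1 : onorm b < 1.
  have [] := dV 0; first by split=> //; rewrite onorm0.
  by rewrite /disc_map /= scaler0 add0r.
pose t := (1 - onorm b) / r.
have t0 : 0 <= t by rewrite divr_ge0 ?ltW// subr_gt0.
have [] := dV (t *: u).
  split; first exact: subrepZ.
  rewrite onormZ nu mulr1 ger0_norm// ltr_pdivrMr// mul1r; lra.
rewrite /disc_map /= [X in _ + X]bu scalerA -scalerDl => _.
rewrite onormZ nu mulr1 mulrC divfK ?gt_eqF// subrK normr1 ltxx //.
Qed.

Lemma little_disc_sub (V W : set U) d : disc_stage V -> subrep W ->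
  V `<=` W -> little_disc V d -> little_disc W d.
Proof.
move=> sV sW VW dV; have := little_disc_bound sV dV; case: (dV) => d0 Vd _ bd.
split; [by []|exact: VW|move=> v [Wv v1]; split].
  by apply: subrepD => //; [exact: subrepZ|exact: VW].
apply: le_lt_trans (ler_onormD _ _) _; rewrite onormZ gtr0_norm//.
apply: lt_le_trans bd; rewrite ltrD2r -[ltRHS]mulr1.
by rewrite ltr_pM2l.
Qed.

(* Thickening: D(V)(n) is contained in D(W)(n). *)
Lemma little_discs_sub (V W : set U) n (c : 'I_n -> R * U) :
  disc_stage V -> subrep W -> V `<=` W -> little_discs V c -> little_discs W c.
Proof.
move=> sV sW VW [lc dc]; split=> [i|i j ij v w [_ v1] [_ w1] E].
  exact: little_disc_sub sV sW VW (lc i).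
have [ri0 Vi _] := lc i; have [rj0 Vj _] := lc j; case: (sV) => rV _ _.
pose s := (c i).1 + (c j).1; have s0 : 0 < s by rewrite addr_gt0.
pose x := (c j).2 - (c i).2.
have Vx : V x by rewrite /x -scaleN1r addrC; case: rV => _ Vl _; exact: Vl.
have Ex : x = (c i).1 *: v - (c j).1 *: w.
  apply/eqP; rewrite subr_eq addrAC -[X in X - _]/(disc_map (c i) v) E.
  by rewrite /disc_map addrAC subrr add0r.
have nx : onorm x < s.
  rewrite Ex -scaleNr; apply: le_lt_trans (ler_onormD _ _) _.
  by rewrite !onormZ normrN !gtr0_norm// ltrD// gtr_pMr.
have Dx a : `|a| = 1 -> unit_disc V ((a / s) *: x).
  move=> a1; split; first exact: subrepZ.
  rewrite onormZ normrM a1 mul1r gtr0_norm ?invr_gt0//.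
  by rewrite mulrC ltr_pdivrMr// mul1r.
apply: (dc i j ij _ _ (Dx 1 (normr1 _)) (Dx (-1) (normrN1 _))).
rewrite /disc_map !scalerA.
have -> : (c j).2 = x + (c i).2 by rewrite subrK.
rewrite addrA -[X in _ + X + _]scale1r -scalerDl; congr (_ *: _ + _).
by rewrite /s; field; rewrite gt_eqF.
Qed.

Lemma disc_stageD (V W : set U) : disc_stage V -> disc_stage W ->
  exists2 Z, disc_stage Z & V `<=` Z /\ W `<=` Z.
Proof.
move=> [sV [m [b bV]] [v Vv v0]] [sW [p [e eW]] _].
have [V0 Vl Vr] := sV; have [W0 Wl Wr] := sW.
pose Z := [set z | exists x y, [/\ V x, W y & z = x + y]].
have VZ : V `<=` Z by move=> x Vx; exists x, 0; rewrite addr0.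
have WZ : W `<=` Z by move=> y Wy; exists 0, y; rewrite add0r.
exists Z => //; split; last by exists v => //; exact: VZ.
- split=> [|a _ _ [x [y [Vx Wy ->]]] [x' [y' [Vx' Wy' ->]]]|].
  + exact: VZ.
  + exists (a *: x + x'), (a *: y + y'); split; [exact: Vl|exact: Wl|].
    by rewrite scalerDr addrACA.
  + move=> g _ [x [y [Vx Wy ->]]]; exists (rho g x), (rho g y).
    by split; [exact: Vr|exact: Wr|rewrite -[x]scale1r rho_linear !scale1r].
- exists (m + p)%N, (fun i => match fintype.split i with inl i => b i | inr j => e j end).
  apply/seteqP; split=> [_ [x [y [Vx Wy ->]]]|_ [a _ <-]].
    move: Vx Wy; rewrite bV eW => -[a _ <-] [a' _ <-].
    exists (fun i => match fintype.split i with inl i => a i | inr j => a' j end) => //.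
    rewrite big_split_ord /=; congr (_ + _); apply: eq_bigr => i _.
      by rewrite (unsplitK (inl i : 'I_m + 'I_p)).
    by rewrite (unsplitK (inr i : 'I_m + 'I_p)).
  rewrite big_split_ord /=.
  exists (\sum_(i < m) a (lshift p i) *: b i), (\sum_(i < p) a (rshift m i) *: e i).
  split.
  + by rewrite bV; exists (fun i => a (lshift p i)).
  + by rewrite eW; exists (fun i => a (rshift m i)).
  congr (_ + _); apply: eq_bigr => i _.
    by rewrite (unsplitK (inl i : 'I_m + 'I_p)).
  by rewrite (unsplitK (inr i : 'I_m + 'I_p)).
Qed.

Lemma disc_stage_family (V : set U) k (W : 'I_k -> set U) : disc_stage V ->
  (forall i, disc_stage (W i)) ->
  exists2 Z, disc_stage Z & V `<=` Z /\ forall i, W i `<=` Z.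
Proof.
move=> sV sW.
suff H (s : seq 'I_k) : exists2 Z, disc_stage Z &
    V `<=` Z /\ forall i, i \in s -> W i `<=` Z.
  have [Z sZ [VZ WZ]] := H (enum 'I_k); exists Z => //; split=> // i.
  by apply: WZ; rewrite mem_enum.
elim: s => [|i s [Z sZ [VZ WZ]]]; first by exists V => //; split.
have [Y sY [ZY WY]] := disc_stageD sZ (sW i).
exists Y => //; split=> [x /VZ/ZY//|j]; rewrite inE => /predU1P[->//|/WZ h].
exact: subset_trans h ZY.
Qed.

Lemma disc_map_inj d : 0 < d.1 -> injective (disc_map d).
Proof. by move=> d0 v w /addIr/scalerI; apply; rewrite gt_eqF. Qed.

Definition disc_comp (d e : R * U) : R * U := (d.1 * e.1, d.1 *: e.2 + d.2).

Lemma disc_compE d e v : disc_map (disc_comp d e) v = disc_map d (disc_map e v).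
Proof. by rewrite /disc_map /= scalerDr scalerA addrA. Qed.

(* D(U)(n): the maps D(V)(n) -> D(W)(n) for V in W are inclusions, so that the
   colimit is the union of the D(V)(n). *)
Record inf_discs n := InfDiscs {
  inf_discs_fun :> 'I_n -> R * U;
  inf_discs_stage :
    exists2 V : set U, disc_stage V & little_discs V inf_discs_fun }.

HB.instance Definition _ n := gen_eqMixin (inf_discs n).
HB.instance Definition _ n := gen_choiceMixin (inf_discs n).

Lemma inf_discsP n (c d : inf_discs n) : (forall i, c i = d i) -> c = d.
Proof.
case: c d => c hc [d hd] /= /funext E; case: _ / E in hd *.
by congr InfDiscs; exact: Prop_irrelevance.
Qed.

Section Topology.
Variable n : nat.

(* The colimit topology; D(V)(n) is a subspace of (R x V)^n. *)
Definition discs_open (A : set (inf_discs n)) : Prop :=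
  forall V : set U, disc_stage V ->
  forall c : inf_discs n, little_discs V c -> A c ->
  exists2 e : R, 0 < e & forall d : inf_discs n, little_discs V d ->
    (forall i, `|(d i).1 - (c i).1| < e /\ onorm ((d i).2 - (c i).2) < e) -> A d.

Lemma discs_openT : discs_open setT.
Proof. by move=> V _ c _ _; exists 1. Qed.

Lemma discs_openI : setI_closed discs_open.
Proof.
move=> A B oA oB V sV c Vc [Ac Bc].
have [e e0 he] := oA V sV c Vc Ac; have [f f0 hf] := oB V sV c Vc Bc.
exists (Num.min e f) => [|d Vd h]; first by rewrite lt_min e0.
by split; [apply: he => // i|apply: hf => // i]; have [] := h i;
  rewrite !lt_min => /andP[? ?] /andP[? ?].
Qed.

Lemma discs_open_bigU (I : Type) (f : I -> set (inf_discs n)) :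
  (forall i, discs_open (f i)) -> discs_open (\bigcup_i f i).
Proof.
move=> of_ V sV c Vc [i _ fic]; have [e e0 he] := of_ i V sV c Vc fic.
by exists e => // d Vd h; exists i => //; exact: he.
Qed.

HB.instance Definition _ :=
  isOpenTopological.Build (inf_discs n) discs_openT discs_openI discs_open_bigU.

End Topology.

Section Action.
Variables (n : nat) (x : gT * 'S_n) (c : inf_discs n).

Definition discs_act_fun (i : 'I_n) : R * U :=
  ((c (x.2 i)).1, rho x.1 (c (x.2 i)).2).

Lemma rhoKV g (v : U) : rho g (rho g^-1%g v) = v.
Proof. by rewrite -rhoM mulgV rho1. Qed.

Lemma discs_act_map i v :
  disc_map (discs_act_fun i) v =
  rho x.1 (disc_map (c (x.2 i)) (rho x.1^-1%g v)).
Proof. by rewrite /disc_map rho_linear rhoKV. Qed.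

Lemma rho_disc (V : set U) g v : subrep V -> unit_disc V v ->
  unit_disc V (rho g v).
Proof. by move=> [_ _ Vr] [Vv v1]; split; [exact: Vr|rewrite onorm_rho]. Qed.

Lemma discs_act_stage :
  exists2 V : set U, disc_stage V & little_discs V discs_act_fun.
Proof.
have [V sV [lc dc]] := inf_discs_stage c; exists V => //.
have [rV _ _] := sV; split=> [i|i j ij v w Dv Dw].
  have [r0 Vr dV] := lc (x.2 i); split=> //; first by case: rV => _ _; exact.
  by move=> v Dv; rewrite discs_act_map; apply/rho_disc/dV/rho_disc.
rewrite !discs_act_map => /(congr1 (rho x.1^-1%g)).
rewrite -!(rhoM x.1^-1%g x.1) mulVg !rho1.
by apply: dc; [rewrite (inj_eq perm_inj)|exact: rho_disc|exact: rho_disc].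
Qed.

Definition discs_act : inf_discs n := InfDiscs discs_act_stage.

End Action.

Section Composition.
Variables (k : nat) (n : 'I_k -> nat).
Variables (c : inf_discs k) (d : forall i, inf_discs (n i)).

Definition discs_comp_fun (x : 'I_(\sum_i n i)) : R * U :=
  disc_comp (c (tagnat.sig1 x)) (d (tagnat.sig1 x) (tagnat.sig2 x)).

Lemma discs_comp_stage :
  exists2 V : set U, disc_stage V & little_discs V discs_comp_fun.
Proof.
have [V0 sV0 lV0] := inf_discs_stage c.
have /choice[W hW] : forall i, exists V, disc_stage V /\ little_discs V (d i).
  by move=> i; have [V sV lV] := inf_discs_stage (d i); exists V.
have [V sV [V0V WV]] := disc_stage_family sV0 (fun i => (hW i).1).
have [rV _ _] := sV; exists V => //.
have [lc dc] := little_discs_sub sV0 rV V0V lV0.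
have ld i := little_discs_sub (hW i).1 rV (WV i) (hW i).2.
have dD i j v : unit_disc V v -> unit_disc V (disc_map (d i j) v).
  by case: ((ld i).1 j) => _ _; exact.
split=> [x|x y xy v w Dv Dw].
  rewrite /discs_comp_fun; set i := tagnat.sig1 x; set j := tagnat.sig2 x.
  have [c0 Vc cD] := lc i; have [d0 Vd _] := (ld i).1 j; split=> /=.
  - exact: mulr_gt0.
  - by apply: subrepD => //; exact: subrepZ.
  - by move=> v Dv; rewrite disc_compE; apply/cD/dD.
rewrite !disc_compE; move: xy; rewrite -(inj_eq (@tagnat.sig_inj k n)).
rewrite /tagnat.sig1 /tagnat.sig2.
case: (tagnat.sig x) (tagnat.sig y) => i j [i' j'] /=.
have [ii'|ii' _] := eqVneq i i'; last first.
  by apply: dc => //; exact: dD.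
case: _ / ii' in j' * => jj' /disc_map_inj E.
have [c0 _ _] := lc i; have := (ld i).2 j j' _ v w Dv Dw (E c0); apply.
by apply: contraNneq jj' => ->.
Qed.

Definition discs_comp : inf_discs (\sum_i n i) := InfDiscs discs_comp_stage.

End Composition.

End Discs.

Variable U : universe R gT.

Lemma univ_stage : exists V : set U, disc_stage V.
Proof.
have [V [rV [v Vv v0] Vfix]] := univ_trivial U.
exists [set a *: v | a in [set: R]]; split; last first.
- by exists v => //; exists 1; rewrite ?scale1r.
- exists 1%N, (fun=> v); apply/seteqP; split=> [_ [a _ <-]|_ [a _ <-]].
    by exists (fun=> a); rewrite ?big_ord1.
  by exists (a ord0); rewrite ?big_ord1.
split.
- by exists 0; rewrite ?scale0r.
- move=> a _ _ [b _ <-] [e _ <-]; exists (a * b + e) => //.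
  by rewrite scalerDl scalerA.
- move=> g _ [a _ <-]; exists a => //; apply/esym/Vfix; exact: subrepZ.
Qed.

Lemma discs_one_stage : exists2 V : set U, disc_stage V &
  little_discs V (fun _ : 'I_1 => (1, 0)).
Proof.
have [V sV] := univ_stage; exists V => //; have [[V0 _ _] _ _] := sV.
split=> [_|i j]; last by rewrite !ord1.
by split=> //= v Dv; rewrite /disc_map /= scale1r addr0.
Qed.

Definition infinite_little_discs_operad : operad_data gT :=
  @OperadData gT (fun n => inf_discs U n : topologicalType)
    (@discs_act U) (InfDiscs discs_one_stage) (@discs_comp U).

End LittleDiscs.

(* Main.v *)
(* For every subgroup Gam of G * Sigma_n, the Gam-fixed points of D(U)(n) and of
   L(U)(n), when U is R[G/N]^oo, are both empty or both contractible; they are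
   nonempty exactly when the elements of Gam lying over N have trivial
   permutation part. Hence both projections of the product operad D * L are weak
   equivalences. For the contractions, take an orthonormal basis e(q, a, b) of U
   permuted by G/N: an infinite product of rotations is a path of equivariant
   isometries from the identity to the shift of a, and the shift makes room, in
   the level a = 0, for a fixed isometry or configuration to contract to.

   Conversely, weak equivalences preserve nonemptiness of fixed points. Let N be
   the kernel of the action on U and Gam the graph of G -> Sym(G/N). A generic
   vector of U gives a Gam-fixed configuration of discs, hence there is a
   Gam-fixed isometry, and its values on an invariant unit vector form a free
   orthonormal G/N-orbit. The universe axiom yields arbitrarily many independent
   free orbits, and an equivariant Gram-Schmidt process, with square roots of
   Gram matrices obtained by polynomial functional calculus, gives an orthonormal
   basis of U freely permuted by G/N. *)
Require Import Defs.
From Stdlib Require Import Relation_Operators.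
From mathcomp Require Import all_boot all_order all_algebra all_fingroup.
From mathcomp Require Import boolp classical_sets functions cardinality.
From mathcomp Require Import reals topology normedtype realfun ring lra.
From mathcomp Require complex.

Set Implicit Arguments.
Unset Strict Implicit.
Unset Printing Implicit Defensive.
Import Order.TTheory GRing.Theory Num.Theory.
Import numFieldNormedType.Exports.

Local Open Scope classical_set_scope.
Local Open Scope ring_scope.

(** Once the fixed sets are empty together or contractible together, every operad map is a weak
    equivalence; the projections of the product operad supply such maps without any geometric
    comparison of discs with isometries. The spaces carry colimit or compactly generated topologies,
    for which joint continuity of a homotopy is awkward. Contractions are therefore tested only
    along maps from compact Hausdorff spaces, which suffices for paths and cubes; there a compact
    set lies in a finite-dimensional subspace, and a family of isometries is continuous as soon as
    it is so at every vector. Straight-line homotopies destroy norms, hence the rotations between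
    orthogonal vectors.

    In the construction of the basis the orbit of a vector may be linearly dependent, and ordinary
    Gram-Schmidt would break the symmetry. Orthonormalisation by the inverse square root of the Gram
    matrix commutes with the group; where that matrix is degenerate, an auxiliary free orthonormal
    orbit, orthogonal to what is already there, fills up the kernel. Thus every orbit added to the
    basis is free. *)

Section CompactlyGeneratedSpaces.

(** * Compactly generated topologies and their test maps *)

Lemma compact_set_type (X : topologicalType) (A : set X) :
  compact A -> compact [set: set_type A].
Proof.
move=> cA F PF _; pose G := set_val @ F.
have GA : G A by apply: nearW => x; exact: (set_mem (svalP x)).
have [x [Ax clx]] := cA G _ GA.
exists (exist _ x (mem_set Ax)); split=> // P Q FP [_ [[W oW <-] Wx WQ]].
have GP : G (set_val @` P) by apply: (@filterS _ F _ P _ _ FP) => y Py; exists y.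
have [_ [[y Py <-] Wy]] := clx _ _ GP (open_nbhs_nbhs (conj oW Wx)).
by exists y; split=> //; exact: WQ.
Qed.

Lemma hausdorff_inj (X Y : topologicalType) (f : X -> Y) :
  injective f -> continuous f -> hausdorff_space Y -> hausdorff_space X.
Proof.
move=> fI cf hY x y cxy; apply/fI/hY => P Q Px Qy.
have [z [Pz Qz]] := cxy _ _ (cf x _ Px) (cf y _ Qy).
by exists (f z).
Qed.

Lemma hausdorff_prod (X Y : topologicalType) :
  hausdorff_space X -> hausdorff_space Y -> hausdorff_space (X * Y)%type.
Proof.
move=> hX hY [x y] [x' y'] cl; congr (_, _).
  apply: hX => P Q Px Qx'; have [[p q] [Pp Qq]] := cl _ _
    (@cvg_fst _ _ (nbhs x) (nbhs y) _ _ Px)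
    (@cvg_fst _ _ (nbhs x') (nbhs y') _ _ Qx').
  by exists p.
apply: hY => P Q Px Qx'; have [[p q] [Pp Qq]] := cl _ _
  (@cvg_snd _ _ (nbhs x) (nbhs y) _ _ Px)
  (@cvg_snd _ _ (nbhs x') (nbhs y') _ _ Qx').
by exists q.
Qed.

Lemma set_val_inj (X : Type) (A : set X) : injective (set_val : set_type A -> X).
Proof. by move=> x y; exact: val_inj. Qed.

Lemma hausdorff_set_type (X : topologicalType) (A : set X) :
  hausdorff_space X -> hausdorff_space (set_type A).
Proof.
apply: hausdorff_inj (@set_val_inj _ A) _; exact: initial_continuous.
Qed.

Lemma open_kopen (X : topologicalType) (A : set (kify X)) : kopen A -> open A.
Proof. by []. Qed.

Lemma kopen_open (X : topologicalType) (A : set (kify X)) : open A -> kopen A.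
Proof. by []. Qed.

(** Open sets are k-open, and k-open sets have open preimages under every test map. So [kify] leaves
    the maps from compact Hausdorff spaces unchanged. *)
Lemma continuous_kifyP (K X : topologicalType) (u : K -> X) :
  compact [set: K] -> hausdorff_space K ->
  continuous (u : K -> kify X) <-> continuous u.
Proof.
move=> cK hK; split=> /continuousP cu; apply/continuousP => A oA.
  by apply: cu; apply: open_kopen => K' v cK' hK' /continuousP; apply.
by apply: (kopen_open oA) => //; exact/continuousP.
Qed.

Lemma continuous_unkify (X : topologicalType) : continuous (id : kify X -> X).
Proof.
by apply/continuousP => A oA; apply: open_kopen => K u _ _ /continuousP; apply.
Qed.

Lemma continuous_kify (X Y : topologicalType) (f : X -> Y) :
  continuous f -> continuous (f : kify X -> kify Y).
Proof.
move=> cf; apply/continuousP => A oA; apply: open_kopen => K u cK hK cu.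
rewrite -comp_preimage; apply: (kopen_open oA) => // x.
exact: continuous_comp (cu x) (cf _).
Qed.

Lemma hausdorff_kify (X : topologicalType) :
  hausdorff_space X -> hausdorff_space (kify X).
Proof. by apply: (@hausdorff_inj (kify X) X id _ (@continuous_unkify X)). Qed.

Lemma kify_compactly_generated (X : topologicalType) :
  compactly_generated (kify X).
Proof.
move=> A oA; apply: open_kopen => K u cK hK cu.
by apply: oA => //; exact/continuous_kifyP.
Qed.

Lemma hausdorff_weak_hausdorff (X : topologicalType) :
  hausdorff_space X -> weak_hausdorff X.
Proof.
move=> hX K u cK _ cu; apply: compact_closed => //.
by apply: continuous_compact => //; exact: continuous_subspaceT.
Qed.

End CompactlyGeneratedSpaces.

(** * Contractibility along compact test spaces, and homotopy groups *)

Section Contractible.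
Context (R : realType).

(* The values of H outside A are irrelevant. *)
Definition kcontractible (X : topologicalType) (A : set X) : Prop :=
  exists (H : R -> X -> X) (x0 : X),
    [/\ A x0, forall x, A x -> H 0 x = x /\ H 1 x = x0,
        forall t x, 0 <= t <= 1 -> A x -> A (H t x)
      & forall (K : topologicalType) (t : K -> R) (u : K -> X),
          compact [set: K] -> hausdorff_space K -> continuous t ->
          continuous u -> (forall k, 0 <= t k <= 1) -> (forall k, A (u k)) ->
          continuous (fun k => H (t k) (u k))].

(** A compact subset [B] of a Hausdorff space is, as a subtype, one of the test spaces [K]. *)
Lemma kcontractible_within (X T : topologicalType) (A : set X) (B : set T)
    (H : R -> X -> X) (t : T -> R) (a : T -> X) :
  (forall (K : topologicalType) (t : K -> R) (u : K -> X),
     compact [set: K] -> hausdorff_space K -> continuous t ->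
     continuous u -> (forall k, 0 <= t k <= 1) -> (forall k, A (u k)) ->
     continuous (fun k => H (t k) (u k))) ->
  hausdorff_space T -> compact B ->
  {within B, continuous t} -> {within B, continuous a} ->
  (forall z, B z -> 0 <= t z <= 1) -> (forall z, B z -> A (a z)) ->
  {within B, continuous (fun z => H (t z) (a z))}.
Proof.
move=> Hc hT cB /subspace_sigL_continuousP ct /subspace_sigL_continuousP ca.
move=> t01 Aa; apply/subspace_sigL_continuousP.
apply: (Hc (set_type B) (sigL B t) (sigL B a)) => //.
- exact: compact_set_type.
- exact: hausdorff_set_type.
- by move=> k; apply: t01; exact: set_valP.
- by move=> k; apply: Aa; exact: set_valP.
Qed.

Lemma within_glue (T X : topologicalType) (D : set T) (t : T -> R) (c : R)
    (f g : T -> X) :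
  continuous t -> closed D ->
  {within D `&` [set z | t z <= c], continuous f} ->
  {within D `&` [set z | c <= t z], continuous g} ->
  (forall z, D z -> t z = c -> f z = g z) ->
  {within D, continuous (fun z => if t z <= c then f z else g z)}.
Proof.
move=> ct cD cf cg fg.
have -> : D = (D `&` [set z | t z <= c]) `|` (D `&` [set z | c <= t z]).
  rewrite -setIUr; apply/esym/setIidPl => z _ /=.
  by case: (lerP (t z) c) => h; [left|right; exact: ltW].
apply: withinU_continuous.
- by apply: closedI => //; apply: preimage_closed (@closed_le _ c) => z _; exact: ct.
- by apply: closedI => //; apply: preimage_closed (@closed_ge _ c) => z _; exact: ct.
- move: cf; apply: subspace_eq_continuous => z; rewrite inE => -[_ /= tz] /=.
  by rewrite /from_subspace tz.
- move: cg; apply: subspace_eq_continuous => z; rewrite inE => -[Dz /= tz]; rewrite /from_subspace.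
  by case: ifP => // tz'; apply/esym/fg => //; apply/eqP; rewrite eq_le tz tz'.
Qed.

(** The path contracts [x] to [x0] and returns along the contraction of [x']. *)
Lemma kcontractible_joined (X : topologicalType) (A : set X) :
  kcontractible A -> forall x x', A x -> A x' -> joined R A x x'.
Proof.
move=> [H [x0 [Ax0 H01 HA Hc]]] x x' Ax Ax'.
pose I := [set t : R | 0 <= t <= 1].
have path y (t : R -> R) (B : set R) : A y -> compact B ->
    continuous t -> (forall z, B z -> 0 <= t z <= 1) ->
    {within B, continuous (fun z => H (t z) y)}.
  move=> Ay cB ct t01.
  apply: (@kcontractible_within _ _ A B H t (fun=> y) Hc) => //.
  - exact: continuous_subspaceT.
  - by apply: continuous_subspaceT => z; exact: cst_continuous.
have cmul : continuous (fun z : R => 2 * z).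
  by move=> z; apply: cvgM; [exact: cvg_cst|exact: cvg_id].
have cI c d : compact [set z : R | c <= z <= d].
  rewrite (_ : [set z : R | _] = `[c, d]%classic); first exact: segment_compact.
  by apply/seteqP; split=> z /=; rewrite in_itv.
pose p z := if z <= 1/2 then H (2 * z) x else H (2 - 2 * z) x'.
exists p; split.
- apply: (@within_glue _ _ _ id (1/2)) => //=.
  + by move=> z; exact: cvg_id.
  + by apply: compact_closed; [exact: (@Rhausdorff R)|exact: cI].
  + apply: path => //; first exact: compact_closedI (cI _ _) (@closed_le _ _).
    by move=> z [/=]; lra.
  + apply: path => //; first exact: compact_closedI (cI _ _) (@closed_ge _ _).
      by move=> z; apply: cvgB; [exact: cvg_cst|exact: cmul].
    by move=> z [/=]; lra.
  + move=> z _ ->; have -> : 2 * (1/2) = 1 :> R by lra.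
    by rewrite (_ : 2 - 1 = 1 :> R); [rewrite (H01 _ Ax).2 (H01 _ Ax').2|lra].
- by move=> t t01; rewrite /p; case: ifP => ?; apply: HA => //; lra.
- by rewrite /p ifT ?mulr0 ?(H01 _ Ax).1//; lra.
- rewrite /p ifF; last by apply/negbTE; rewrite -ltNge; lra.
  by rewrite mulr1 subrr (H01 _ Ax').1.
Qed.

Definition clamp (x : R) : R := Num.max 0 (Num.min 1 x).

Lemma clamp01 x : 0 <= clamp x <= 1.
Proof. by rewrite /clamp le_max lexx ge_max ler01 ge_min lexx. Qed.

Lemma clamp_ge0 x : 0 <= clamp x.
Proof. by case/andP: (clamp01 x). Qed.

Lemma clamp_id x : 0 <= x <= 1 -> clamp x = x.
Proof. by move=> /andP[x0 x1]; rewrite /clamp min_r// max_r. Qed.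

Lemma clamp_le0 x : x <= 0 -> clamp x = 0.
Proof. by move=> x0; rewrite /clamp min_r ?max_l//; lra. Qed.

Lemma clamp_ge1 x : 1 <= x -> clamp x = 1.
Proof. by move=> x1; rewrite /clamp min_l ?max_r. Qed.

Lemma clamp_continuous : continuous clamp.
Proof.
move=> x; apply: (@continuous_max R R (fun=> 0) (fun z => Num.min 1 z)).
  exact: cvg_cst.
by apply: (@continuous_min R R (fun=> 1) id); [exact: cvg_cst|exact: cvg_id].
Qed.

Section Cube.
Variable k : nat.
Implicit Types u : 'rV[R]_k.

(* The cube expanded about its center by the factor 1 + s and truncated. *)
Definition expand (s : R) u : 'rV[R]_k :=
  \row_i clamp ((1 + s) * (u ord0 i - 1/2) + 1/2).

(** A cutoff: the factors 4 make it 1 where all coordinates lie in [1/4, 3/4], while it vanishes on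
    the boundary, which a based homotopy must not move. *)
Definition bump u : R := \prod_i (clamp (4 * u ord0 i) * clamp (4 * (1 - u ord0 i))).

Lemma expand_cube s u : unit_cube (expand s u).
Proof. by move=> i; rewrite mxE clamp01. Qed.

Lemma expand0 u : unit_cube u -> expand 0 u = u.
Proof.
by move=> cu; apply/rowP => i; rewrite mxE clamp_id addr0 mul1r subrK.
Qed.

Lemma expand_boundary s u : 0 <= s -> cube_boundary u -> cube_boundary (expand s u).
Proof.
move=> s0 [_ [i ui]]; split; first exact: expand_cube.
exists i; rewrite mxE; case: ui => ->.
  by left; apply: clamp_le0; lra.
by right; apply: clamp_ge1; lra.
Qed.

Lemma bump01 u : 0 <= bump u <= 1.
Proof.
apply/andP; split.
  by apply: prodr_ge0 => i _; apply: mulr_ge0; apply: clamp_ge0.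
rewrite /bump; apply: prodr_ile1 => i _.
have /andP[a0 a1] := clamp01 (4 * u ord0 i).
have /andP[b0 b1] := clamp01 (4 * (1 - u ord0 i)).
by rewrite mulr_ge0// mulr_ile1.
Qed.

Lemma bump_boundary u : cube_boundary u -> bump u = 0.
Proof.
move=> [_ [i ui]]; rewrite /bump (bigD1 i)//=; case: ui => ->.
  by rewrite clamp_le0 ?mul0r// mulr0.
by rewrite subrr mulr0 [clamp 0]clamp_le0 ?mulr0 ?mul0r.
Qed.

(** Expansion by the factor 2 sends [1/4, 3/4] onto [0, 1], so a point at which the cutoff may be
    less than 1 is pushed to the boundary. *)
Lemma bump1_or u : bump u = 1 \/ cube_boundary (expand 1 u).
Proof.
have [H|/existsNP[i /negP Hi]] := pselect (forall i, 1/4 <= u ord0 i <= 3/4).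
  left; rewrite /bump big1// => i _; have := H i => ?.
  by rewrite !clamp_ge1 ?mulr1//; lra.
right; split; first exact: expand_cube.
exists i; rewrite mxE; case: (lerP (1/4) (u ord0 i)) => h.
  right; apply: clamp_ge1; case: (lerP (u ord0 i) (3/4)) => h'; last by lra.
  by case/negP: Hi; lra.
by left; apply: clamp_le0; lra.
Qed.

Lemma rV_continuous (T : topologicalType) (f : T -> 'rV[R]_k) :
  (forall i, continuous (fun z => f z ord0 i)) -> continuous f.
Proof.
move=> cf z A [P PM PA]; apply: (@filterS _ (nbhs z) _ _ _ (fun x => PA (f x))).
apply: filter_forall => i; apply: filter_forall => j.
by rewrite (ord1 i); exact: (cf j z _ (PM ord0 j)).
Qed.

Lemma rV_hausdorff : hausdorff_space 'rV[R]_k.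
Proof.
move=> u v cl; apply/rowP => i; apply: (@Rhausdorff R) => P Q Pu Qv.
have [w [Pw Qw]] := cl _ _ (@coord_continuous R 1 k ord0 i u P Pu)
  (@coord_continuous R 1 k ord0 i v Q Qv).
by exists (w ord0 i).
Qed.

Lemma unit_cube_compact : compact (@unit_cube R k).
Proof.
apply: (@rV_compact R k (fun=> [set z : R | 0 <= z <= 1])) => i.
rewrite (_ : [set z : R | _] = `[0, 1]%classic); first exact: segment_compact.
by apply/seteqP; split=> z /=; rewrite in_itv.
Qed.

Lemma expand_continuous (T : topologicalType) (s : T -> R) (u : T -> 'rV[R]_k) :
  continuous s -> continuous u -> continuous (fun z => expand (s z) (u z)).
Proof.
move=> cs cu; apply: rV_continuous => i z.
rewrite (_ : (fun _ => _) = fun z =>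
  clamp ((1 + s z) * (u z ord0 i - 1/2) + 1/2)); last first.
  by apply/funext => z'; rewrite mxE.
apply: (@continuous_comp _ _ _
  (fun z => (1 + s z) * (u z ord0 i - 1/2) + 1/2) clamp);
  last exact: clamp_continuous.
apply: cvgD; last exact: cvg_cst.
apply: cvgM; first by apply: cvgD; [exact: cvg_cst|exact: cs].
apply: cvgB; last exact: cvg_cst.
apply: (@continuous_comp _ _ _ u (fun M : 'rV[R]_k => M ord0 i)); first exact: cu.
exact: coord_continuous.
Qed.

Lemma bump_continuous (T : topologicalType) (u : T -> 'rV[R]_k) :
  continuous u -> continuous (fun z => bump (u z)).
Proof.
move=> cu; apply: (@continuous_big _ _ _ _ _ _ _ _
  (fun i z => clamp (4 * u z ord0 i) * clamp (4 * (1 - u z ord0 i)))).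
  by move=> p; apply: cvgM; [exact: cvg_fst|exact: cvg_snd].
move=> i _ z.
have cui : {for z, continuous (fun z => u z ord0 i)}.
  apply: (@continuous_comp _ _ _ u (fun M : 'rV[R]_k => M ord0 i)); first exact: cu.
  exact: coord_continuous.
apply: cvgM.
  apply: (@continuous_comp _ _ _ (fun z => 4 * u z ord0 i) clamp);
    last exact: clamp_continuous.
  by apply: cvgM; [exact: cvg_cst|exact: cui].
apply: (@continuous_comp _ _ _ (fun z => 4 * (1 - u z ord0 i)) clamp);
  last exact: clamp_continuous.
by apply: cvgM; [exact: cvg_cst|apply: cvgB; [exact: cvg_cst|exact: cui]].
Qed.

End Cube.

(* The contraction is applied away from the boundary only, while the cube is
   expanded so that everything outside its middle half goes to the base point. *)
Lemma kcontractible_homotopic (X : topologicalType) (A : set X) k x a a' :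
  kcontractible A -> A x -> based_cube R A x k a -> based_cube R A x k a' ->
  based_homotopic R A x k a a'.
Proof.
move=> [H [x0 [Ax0 H01 HA Hc]]] Ax [ca Aa ba] [ca' Aa' ba'].
pose D : set (R * 'rV[R]_k) := [set q | 0 <= q.1 <= 1 /\ unit_cube q.2].
have DE : D = [set z : R | 0 <= z <= 1] `*` @unit_cube R k by [].
have cD : compact D.
  rewrite DE; apply: compact_setX; last exact: unit_cube_compact.
  rewrite (_ : [set z : R | _] = `[0, 1]%classic); first exact: segment_compact.
  by apply/seteqP; split=> z /=; rewrite in_itv.
have hD : hausdorff_space (R * 'rV[R]_k)%type.
  exact: hausdorff_prod (@Rhausdorff R) (@rV_hausdorff k).
(* A tent: 0 at both ends of the homotopy and 1 at time 1/2, where the two halves are glued. *)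
pose w (q : R * 'rV[R]_k) : R := 1 - `|2 * q.1 - 1|.
have cw : continuous w.
  move=> q; apply: cvgB; first exact: cvg_cst.
  apply: cvg_norm; apply: cvgB; last exact: cvg_cst.
  by apply: cvgM; [exact: cvg_cst|exact: cvg_fst].
have w01 q : D q -> 0 <= w q <= 1.
  move=> [q01 _]; rewrite /w; case: (lerP (1/2) q.1) => h.
    by rewrite ger0_norm; lra.
  by rewrite ltr0_norm; lra.
pose m q := Num.min (w q) (bump q.2).
have cm : continuous m.
  move=> q; apply: (@continuous_min R _ w (fun q => bump q.2)); first exact: cw.
  by apply: bump_continuous => q'; exact: cvg_snd.
have m01 q : D q -> 0 <= m q <= 1.
  move=> /w01/andP[? ?]; have /andP[? ?] := bump01 q.2.
  by rewrite /m le_min ge_min; apply/andP; split; [apply/andP|apply/orP; left].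
pose G a (q : R * 'rV[R]_k) := H (m q) (a (expand (w q) q.2)).
have GA b q : (forall u, unit_cube u -> A (b u)) -> D q -> A (G b q).
  by move=> Ab Dq; apply: HA; [exact: m01|exact/Ab/expand_cube].
have cG b (B : set (R * 'rV[R]_k)) : {within @unit_cube R k, continuous b} ->
    (forall u, unit_cube u -> A (b u)) -> closed B ->
    {within D `&` B, continuous (G b)}.
  move=> cb Ab cB.
  apply: (@kcontractible_within _ _ A _ H m _ Hc) => //.
  - exact: compact_closedI.
  - exact: continuous_subspaceT.
  - apply/subspace_continuousP => q _ P bP.
    have /subspace_continuousP cb' := cb.
    have ce : continuous (fun q : R * 'rV[R]_k => expand (w q) q.2).
      by apply: expand_continuous => // q'; exact: cvg_snd.
    have := ce q _ (cb' _ (@expand_cube k (w q) q.2) _ bP).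
    by apply: (@filterS _ (nbhs q)) => q' /= h _; apply: h; exact: expand_cube.
  - by move=> q [/m01].
  - by move=> q _; exact/Ab/expand_cube.
exists (fun q => if q.1 <= 1/2 then G a q else G a' q); split.
- apply: (@within_glue _ _ _ fst (1/2)) => //.
  + by move=> q; exact: cvg_fst.
  + exact: compact_closed.
  + by apply: cG => //; apply: preimage_closed (@closed_le _ _) => z _; exact: cvg_fst.
  + by apply: cG => //; apply: preimage_closed (@closed_ge _ _) => z _; exact: cvg_fst.
  (* At time 1/2 either [bump] is 1 and both halves are at [x0], or the expanded point lies on the
     boundary, where [a] and [a'] both take the value [x]. *)
  + move=> [q1 q2] [/= _ cq] q12; rewrite /G.
    have w1 : w (q1, q2) = 1 by rewrite /w /= q12 (_ : 2 * (1/2) - 1 = 0) ?normr0 ?subr0//; lra.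
    rewrite w1; have [b1|bd] := bump1_or q2; last by rewrite ba// ba'.
    rewrite /m w1 b1 minxx (H01 _ _).2 ?(H01 _ _).2//; [exact/Aa'/expand_cube|exact/Aa/expand_cube].
- by move=> t u t01 cu; case: ifP => _; exact: GA.
- move=> u cu /=; rewrite ifT; last by lra.
  have w0 : w (0, u) = 0 by rewrite /w /= mulr0 sub0r normrN1 subrr.
  rewrite /G /m w0 expand0// min_l ?(H01 _ _).1//; first exact: Aa.
  by case/andP: (bump01 u).
- move=> u cu /=; rewrite ifF; last by apply/negbTE; rewrite -ltNge; lra.
  have w0 : w (1, u) = 0 by rewrite /w /= mulr1 (_ : 2 - 1 = 1) ?normr1 ?subrr//; lra.
  rewrite /G /m w0 expand0// min_l ?(H01 _ _).1//; first exact: Aa'.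
  by case/andP: (bump01 u).
- move=> t u t01 bu; have Dtu : D (t, u) by split=> //; case: bu.
  have /andP[w0 _] := w01 _ Dtu.
  rewrite /G /m /= bump_boundary// min_r//.
  by case: ifP => _; rewrite ?ba ?ba' ?(H01 _ _).1//; exact: expand_boundary.
Qed.

End Contractible.

(** * The product operad and its projections *)

Section ProductOperad.
Context (R : realType).

(** If [B] is empty then so is [A], and every clause is vacuous. Otherwise any two points are joined
    and any two based cubes are homotopic on both sides, so that constant cubes serve as
    preimages. *)
Lemma kcontractible_weak_equiv (X Y : topologicalType) (A : set X) (B : set Y)
    (f : X -> Y) :
  continuous f -> (forall x, A x -> B (f x)) ->
  (B !=set0 -> kcontractible R A /\ kcontractible R B) ->
  weak_homotopy_equiv R A B f.
Proof.
move=> cf AB h.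
have hA x : A x -> kcontractible R A /\ kcontractible R B.
  by move=> /AB Bfx; apply: h; exists (f x).
split.
- by move=> x x' Ax Ax' _; apply: kcontractible_joined => //; exact: (hA x Ax).1.
- move=> y By; have [[H [x [Ax _ _ _]]] kB] := h (ex_intro _ y By).
  by exists x => //; apply: kcontractible_joined => //; exact: AB.
- move=> k x _ Ax a a' ba ba' _; apply: kcontractible_homotopic => //.
  exact: (hA x Ax).1.
- move=> k x _ Ax b bb; exists (fun=> x).
    by split=> //; apply: continuous_subspaceT => z; exact: cst_continuous.
  apply: kcontractible_homotopic; [exact: (hA x Ax).2|exact: AB| |exact: bb].
  by split=> //; [apply: continuous_subspaceT => z; exact: cst_continuous|move=> u _; exact: AB].
Qed.

Lemma kcontractible_prod (X Y : topologicalType) (A : set X) (B : set Y) :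
  kcontractible R A -> kcontractible R B ->
  kcontractible R [set p : kify (X * Y)%type | A p.1 /\ B p.2].
Proof.
move=> [H [x0 [Ax0 H01 HA Hc]]] [L [y0 [By0 L01 LB Lc]]].
exists (fun t p => (H t p.1, L t p.2)), (x0, y0); split=> //=.
- by move=> [x y] /= [/H01[-> ->] /L01[-> ->]].
- by move=> t [x y] t01 /= [Ax By]; split; [exact: HA|exact: LB].
move=> K t u cK hK ct /(continuous_kifyP _ cK hK) cu t01 ABu.
apply/(continuous_kifyP _ cK hK) => z; apply: cvg_pair.
  apply: (Hc K t (fun z => (u z).1)) => // [z'|k]; last by have [] := ABu k.
  by apply: (@continuous_comp _ _ _ u fst); [exact: cu|exact: cvg_fst].
apply: (Lc K t (fun z => (u z).2)) => // [z'|k]; last by have [] := ABu k.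
by apply: (@continuous_comp _ _ _ u snd); [exact: cu|exact: cvg_snd].
Qed.

Lemma continuous_pair (T X Y : topologicalType) (f : T -> X) (g : T -> Y) :
  continuous f -> continuous g -> continuous (fun z => (f z, g z)).
Proof. by move=> cf cg z; apply: cvg_pair; [exact: cf|exact: cg]. Qed.

Lemma continuous_prod_topology (T : topologicalType) (I : Type)
    (X : I -> topologicalType) (f : T -> prod_topology X) :
  (forall i, continuous (fun z => f z i)) -> continuous f.
Proof.
by move=> cf z; apply/cvg_sup => i; apply: continuous_comp_initial; exact: cf.
Qed.

Variables (gT : finGroupType) (O P : operad_data gT).

(** The plain product need not be compactly generated; [kify] gives the product of that category. *)
Definition prod_operad : operad_data gT :=
  @OperadData gT (fun n => kify (O n * P n)%type : topologicalType)
    (fun n x c => (op_act O x c.1, op_act P x c.2))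
    (op_one O, op_one P)
    (fun k n c d => (op_comp O c.1 (fun i => (d i).1),
                     op_comp P c.2 (fun i => (d i).2))).

Lemma ecast_pair m n (e : m = n) (x : O m) (y : P m) :
  ecast p (O p * P p)%type e (x, y) = (ecast p (O p) e x, ecast p (P p) e y).
Proof. by case: _ / e. Qed.

Hypothesis hO : forall n, hausdorff_space (O n).
Hypothesis hP : forall n, hausdorff_space (P n).
Hypothesis opO : is_operad O.
Hypothesis opP : is_operad P.

Lemma prod_operad_is_operad : is_operad prod_operad.
Proof.
split=> /=.
- move=> n; split; first exact: kify_compactly_generated.
  by apply: hausdorff_weak_hausdorff; apply: hausdorff_kify; exact: hausdorff_prod.
- by move=> n [c d]; rewrite !op_act1.
- by move=> n x y [c d]; rewrite !op_actM.
- move=> n x; apply: (@continuous_kify (O n * P n)%type (O n * P n)%type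
    (fun c => (op_act O x c.1, op_act P x c.2))) => c; apply: cvg_pair.
    apply: (@continuous_comp _ _ _ fst (op_act O x)); first exact: cvg_fst.
    exact: op_act_cont.
  apply: (@continuous_comp _ _ _ snd (op_act P x)); first exact: cvg_snd.
  exact: op_act_cont.
(* On a compact Hausdorff [K], a map into [kify] of a product is a map into the plain product, so
   that continuity splits into coordinates. *)
- move=> k n K u cK hK cu; apply/(continuous_kifyP _ cK hK).
  have cu1 : continuous (fun z => (u z).1 : O k * P k).
    apply: (continuous_kifyP (X := (O k * P k)%type) _ cK hK).1 => z.
    by apply: (@continuous_comp _ _ _ u fst); [exact: cu|exact: cvg_fst].
  have cu2 i : continuous (fun z => (u z).2 i : O (n i) * P (n i)).
    apply: (continuous_kifyP (X := (O (n i) * P (n i))%type) _ cK hK).1 => z.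
    apply: (@continuous_comp _ _ _ u (fun p => p.2 i)); first exact: cu.
    pose Y i : topologicalType := kify (O (n i) * P (n i))%type.
    apply: (@continuous_comp (kify (O k * P k)%type * prod_topology Y)%type
      (prod_topology Y) (Y i) snd (fun g => g i)); first exact: cvg_snd.
    exact: (@proj_continuous _ Y i).
  apply: continuous_pair.
    apply: (@op_comp_cont _ _ opO k n K
      (fun z => ((u z).1.1, fun i => ((u z).2 i).1))) => //.
    apply: continuous_pair.
      move=> z; apply: (@continuous_comp _ _ _ (fun z => (u z).1 : O k * P k) fst); first exact: cu1.
      exact: cvg_fst.
    apply: continuous_prod_topology => i z.
    apply: (@continuous_comp _ _ _ (fun z => (u z).2 i : O (n i) * P (n i)) fst).
      exact: cu2.
    exact: cvg_fst.
  apply: (@op_comp_cont _ _ opP k n K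
    (fun z => ((u z).1.2, fun i => ((u z).2 i).2))) => //.
  apply: continuous_pair.
    move=> z; apply: (@continuous_comp _ _ _ (fun z => (u z).1 : O k * P k) snd); first exact: cu1.
    exact: cvg_snd.
  apply: continuous_prod_topology => i z.
  apply: (@continuous_comp _ _ _ (fun z => (u z).2 i : O (n i) * P (n i)) snd).
    exact: cu2.
  exact: cvg_snd.
- by move=> g; rewrite !op_one_fixed.
- by move=> g k n [c c'] d /=; rewrite !op_comp_equiv.
- by move=> n [c c']; rewrite ecast_pair !op_comp1l.
- by move=> k [c c']; rewrite ecast_pair !op_comp1r.
- move=> k n m [c c'] d e; rewrite ecast_pair; congr (_, _).
    exact: (op_compA opO c (fun i => (d i).1) (fun i j => (e i j).1)).
  exact: (op_compA opP c' (fun i => (d i).2) (fun i j => (e i j).2)).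
- move=> k n s [c c'] d; rewrite ecast_pair; congr (_, _).
    exact: (op_comp_block opO s c (fun i => (d i).1)).
  exact: (op_comp_block opP s c' (fun i => (d i).2)).
- move=> k n t [c c'] d; congr (_, _).
    exact: (op_comp_dsum opO t c (fun i => (d i).1)).
  exact: (op_comp_dsum opP t c' (fun i => (d i).2)).
Qed.

Lemma prod_operad_zigzag :
  (forall n (Gam : {group gT * 'S_n}),
    (@op_fixed gT O n Gam !=set0 \/ @op_fixed gT P n Gam !=set0 ->
     kcontractible R (@op_fixed gT O n Gam) /\ kcontractible R (@op_fixed gT P n Gam))) ->
  operad_zigzag R O P.
Proof.
move=> kc.
have fixE n (Gam : {group gT * 'S_n}) :
    @op_fixed gT prod_operad n Gam =
    [set p : kify (O n * P n)%type | @op_fixed gT O n Gam p.1 /\ @op_fixed gT P n Gam p.2].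
  apply/seteqP; split=> -[c d] /=.
    by move=> h; split=> x xG; have [] := h x xG.
  by move=> [hc hd] x xG /=; rewrite hc// hd.
have proj_equiv (Q : operad_data gT) (f : forall n, prod_operad n -> Q n) :
    is_operad Q -> is_operad_map f ->
    (forall n (Gam : {group gT * 'S_n}), @op_fixed gT Q n Gam !=set0 ->
       kcontractible R (@op_fixed gT O n Gam) /\ kcontractible R (@op_fixed gT P n Gam)) ->
    (forall n (Gam : {group gT * 'S_n}), @op_fixed gT Q n Gam !=set0 ->
       kcontractible R (@op_fixed gT Q n Gam)) ->
    weakly_equiv_to R prod_operad Q.
  move=> opQ mf h hQ; split=> //; first exact: prod_operad_is_operad.
  exists f => // n Gam; apply: kcontractible_weak_equiv.
  - exact: opm_cont mf n.
  - by move=> c hc x xG; rewrite -(opm_act mf) hc.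
  - move=> Q0; have [kO kP] := h n Gam Q0; split; last exact: hQ.
    by rewrite fixE; exact: kcontractible_prod.
apply: (rst_trans _ _ _ prod_operad); first apply: rst_sym.
  apply: rst_step; apply: (proj_equiv O (fun n (c : prod_operad n) => c.1)) => //.
  - split=> // n c.
    apply: (@continuous_comp (kify (O n * P n)%type) (O n * P n)%type _ id fst).
      exact: continuous_unkify.
    exact: cvg_fst.
  - by move=> n Gam O0; apply: kc; left.
  - by move=> n Gam O0; have [] := kc n Gam (or_introl O0).
apply: rst_step; apply: (proj_equiv P (fun n (c : prod_operad n) => c.2)) => //.
- split=> // n c.
  apply: (@continuous_comp (kify (O n * P n)%type) (O n * P n)%type _ id snd).
    exact: continuous_unkify.
  exact: cvg_snd.
- by move=> n Gam P0; apply: kc; right.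
- by move=> n Gam P0; have [] := kc n Gam (or_intror P0).
Qed.

End ProductOperad.

(** * Linear maps and orthogonal representations *)

Section LinearFunctions.
Context (R : realType) (E F : lmodType R) (f : E -> F).
Hypothesis linf : linear f.

Lemma lin0 : f 0 = 0.
Proof.
have := linf (-1) 0 0; rewrite scaler0 addr0 scaleN1r addNr => ->.
by [].
Qed.

Lemma linD v w : f (v + w) = f v + f w.
Proof. by have := linf 1 v w; rewrite !scale1r. Qed.

Lemma linZ a v : f (a *: v) = a *: f v.
Proof. by have := linf a v 0; rewrite !addr0 lin0 addr0. Qed.

Lemma linB v w : f (v - w) = f v - f w.
Proof. by rewrite linD -[- w]scaleN1r linZ scaleN1r. Qed.

Lemma lin_sum (I : Type) (s : seq I) (P : pred I) (G : I -> E) :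
  f (\sum_(i <- s | P i) G i) = \sum_(i <- s | P i) f (G i).
Proof. by apply: big_morph; [exact: linD|exact: lin0]. Qed.

End LinearFunctions.

Section OrthRep.
Context (R : realType) (gT : finGroupType) (E : orthrep R gT).
Implicit Types (v w x : E) (a : R) (g : gT).

Lemma ip0l w : ip (0 : E) w = 0.
Proof. by rewrite -(scale0r (0 : E)) ipZl mul0r. Qed.

Lemma ip0r w : ip w (0 : E) = 0.
Proof. by rewrite ip_sym ip0l. Qed.

Lemma ipDr v w x : ip x (v + w) = ip x v + ip x w.
Proof. by rewrite ip_sym ipDl !(ip_sym x). Qed.

Lemma ipZr a v w : ip w (a *: v) = a * ip w v.
Proof. by rewrite ip_sym ipZl ip_sym. Qed.

Lemma ipNl v w : ip (- v) w = - ip v w.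
Proof. by rewrite -scaleN1r ipZl mulN1r. Qed.

Lemma ipNr v w : ip w (- v) = - ip w v.
Proof. by rewrite ip_sym ipNl ip_sym. Qed.

Lemma ipBl v w x : ip (v - w) x = ip v x - ip w x.
Proof. by rewrite ipDl ipNl. Qed.

Lemma ipBr v w x : ip x (v - w) = ip x v - ip x w.
Proof. by rewrite ipDr ipNr. Qed.

Lemma ip_suml (I : Type) (s : seq I) (P : pred I) (G : I -> E) w :
  ip (\sum_(i <- s | P i) G i) w = \sum_(i <- s | P i) ip (G i) w.
Proof.
apply: (big_morph (fun v => ip v w)) => [v v'|]; [exact: ipDl|exact: ip0l].
Qed.

Lemma ip_sumr (I : Type) (s : seq I) (P : pred I) (G : I -> E) w :
  ip w (\sum_(i <- s | P i) G i) = \sum_(i <- s | P i) ip w (G i).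
Proof. by rewrite ip_sym ip_suml; under eq_bigr do rewrite ip_sym. Qed.

Lemma ip_eq0 v : ip v v = 0 -> v = 0.
Proof.
move=> v0; apply/eqP; apply: contraT => /ip_gt0; by rewrite v0 ltxx.
Qed.

Lemma onorm0_eq0 v : onorm v = 0 -> v = 0.
Proof. by move=> v0; apply: ip_eq0; rewrite -onorm_sqr v0 expr0n. Qed.

Lemma onormN v : onorm (- v) = onorm v.
Proof. by rewrite -scaleN1r onormZ normrN1 mul1r. Qed.

Lemma onormBC v w : onorm (v - w) = onorm (w - v).
Proof. by rewrite -onormN opprB. Qed.

Lemma onorm_triangle v w x : onorm (v - x) <= onorm (v - w) + onorm (w - x).
Proof. by apply: le_trans (ler_onormD _ _); rewrite addrA subrK. Qed.

Lemma rho0 g : rho g (0 : E) = 0.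
Proof. exact: lin0 (rho_linear g). Qed.

Lemma rhoK g v : rho g^-1%g (rho g v) = v.
Proof. by rewrite -rhoM mulVg rho1. Qed.

Lemma ip_rhol g v w : ip (rho g v) w = ip v (rho g^-1%g w).
Proof. by rewrite -(ip_rho g^-1%g (rho g v) w) rhoK. Qed.

End OrthRep.

(** * Finite-dimensional subspaces *)

Section FiniteDimensional.
Context (R : realType) (E : lmodType R).

Lemma fdim_span (I : finType) (b : I -> E) :
  fdim_subspace [set \sum_i a i *: b i | a in [set: I -> R]].
Proof.
exists #|I|, (fun i => b (enum_val i)); apply/seteqP; split=> _ [a _ <-].
  exists (fun i => a (enum_val i)) => //.
  by rewrite [RHS](reindex (@enum_val I predT)) //; apply/onW_bij/enum_val_bij.
exists (fun i => a (enum_rank i)) => //.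
rewrite [LHS](reindex (@enum_val I predT)) /=; last exact/onW_bij/enum_val_bij.
by apply: eq_bigr => i _; rewrite enum_valK.
Qed.

Lemma fdim0 (V : set E) : fdim_subspace V -> V 0.
Proof.
move=> [n [b ->]]; exists (fun=> 0) => //; rewrite big1// => i _; exact: scale0r.
Qed.

Lemma fdim_lin (V : set E) a v w : fdim_subspace V -> V v -> V w -> V (a *: v + w).
Proof.
move=> [n [b ->]] [c _ <-] [d _ <-]; exists (fun i => a * c i + d i) => //.
rewrite scaler_sumr -big_split; apply: eq_bigr => i _ /=.
by rewrite scalerDl scalerA.
Qed.

Lemma fdimD (V : set E) v w : fdim_subspace V -> V v -> V w -> V (v + w).
Proof. by move=> fV Vv Vw; rewrite -[v]scale1r; exact: fdim_lin. Qed.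

Lemma fdimZ (V : set E) a v : fdim_subspace V -> V v -> V (a *: v).
Proof. by move=> fV Vv; rewrite -[_ *: _]addr0; apply: fdim_lin => //; exact: fdim0. Qed.

Lemma fdim_sum_closed (V : set E) (I : Type) (s : seq I) (P : pred I) (G : I -> E) :
  fdim_subspace V -> (forall i, V (G i)) -> V (\sum_(i <- s | P i) G i).
Proof.
move=> fV VG; apply: (big_ind V) => //; first exact: fdim0.
by move=> v w; exact: fdimD.
Qed.

Lemma fdim_family (I : finType) (W : I -> set E) :
  (forall i, fdim_subspace (W i)) ->
  exists2 Z, fdim_subspace Z & forall i, W i `<=` Z.
Proof.
move=> fW; pose n i := projT1 (cid (fW i)).
have [b hb] : exists b : forall i, 'I_(n i) -> E,
    forall i, W i = [set \sum_j a j *: b i j | a in [set: 'I_(n i) -> R]].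
  exists (fun i => projT1 (cid (projT2 (cid (fW i))))) => i.
  exact: (projT2 (cid (projT2 (cid (fW i))))).
exists [set \sum_(p : {i & 'I_(n i)}) a p *: b (tag p) (tagged p) | a in [set: {i & 'I_(n i)} -> R]].
  exact: fdim_span.
move=> i v; rewrite hb => -[a _ <-].
(* The coefficients of [v] in block [i], transported along the equality of tags, and 0 in all other
   blocks. *)
pose a' (p : {i & 'I_(n i)}) : R :=
  if eqVneq (tag p) i is EqNotNeq e then a (ecast i 'I_(n i) e (tagged p)) else 0.
exists a' => //.
transitivity (\sum_i \sum_(j < n i) a' (Tagged _ j) *: b i j).
  by rewrite sig_big_dep; apply: eq_bigr => -[].
rewrite (bigD1 i)//= [X in _ + X](_ : _ = 0) ?addr0.
  apply: eq_bigr => j _; rewrite /a' /=; case: eqVneq => [e|]; last by rewrite eqxx.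
  by rewrite (eq_irrelevance e erefl).
rewrite big1// => i' i'i; rewrite big1// => j _.
by rewrite /a' /=; case: eqVneq i'i => // _ _; rewrite scale0r.
Qed.

Lemma fdim2 (V W : set E) : fdim_subspace V -> fdim_subspace W ->
  exists2 Z, fdim_subspace Z & V `<=` Z /\ W `<=` Z.
Proof.
move=> fV fW; have [|Z fZ VWZ] := @fdim_family bool (fun b => if b then V else W).
  by case.
by exists Z => //; split; [exact: (VWZ true)|exact: (VWZ false)].
Qed.

Lemma fdim_image (F : lmodType R) (f : F -> E) (V : set F) :
  linear f -> fdim_subspace V ->
  exists2 Z, fdim_subspace Z & forall v, V v -> Z (f v).
Proof.
move=> lf [n [b ->]].
exists [set \sum_i a i *: f (b i) | a in [set: 'I_n -> R]]; first exact: fdim_span.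
move=> _ [a _ <-]; exists a => //; rewrite (lin_sum lf).
by apply: eq_bigr => i _; rewrite (linZ lf).
Qed.

Lemma fdim_line (v : E) : exists2 Z, fdim_subspace Z & Z v.
Proof.
exists [set \sum_i a i *: v | a in [set: 'I_1 -> R]]; first exact: fdim_span.
by exists (fun=> 1) => //; rewrite big_ord1 scale1r.
Qed.

End FiniteDimensional.

(** * Continuity into the colimit topology *)

Section FiniteContinuity.
Context (R : realType) (gT : finGroupType).

(* For K compact this is continuity for the colimit topology: a compact subset
   of the colimit lies in a finite-dimensional subspace. *)
Definition fcont (K : topologicalType) (E : orthrep R gT) (u : K -> E) : Prop :=
  (exists2 V, fdim_subspace V & forall k, V (u k)) /\
  forall k e, 0 < e -> \forall k' \near k, onorm (u k' - u k) < e.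

Section Operations.
Variables (K : topologicalType) (E : orthrep R gT).
Implicit Types u v : K -> E.

Lemma fcont_cst (w : E) : fcont (fun _ : K => w).
Proof.
split; first by have [V fV Vw] := fdim_line w; exists V.
by move=> k e e0; apply: nearW => k'; rewrite subrr onorm0.
Qed.

Lemma fcontD u v : fcont u -> fcont v -> fcont (fun k => u k + v k).
Proof.
move=> [[V fV Vu] cu] [[W fW Wv] cv]; split.
  have [Z fZ [VZ WZ]] := fdim2 fV fW; exists Z => // k.
  by apply: fdimD => //; [exact: VZ|exact: WZ].
move=> k e e0; have e20 : 0 < e / 2 by rewrite divr_gt0.
apply: filterS2 (cu k _ e20) (cv k _ e20) => k' h1 h2.
rewrite opprD addrACA; apply: le_lt_trans (ler_onormD _ _) _.
by rewrite [e](splitr e) ltrD.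
Qed.

Lemma fcontZ (t : K -> R) u :
  continuous t -> fcont u -> fcont (fun k => t k *: u k).
Proof.
move=> ct [[V fV Vu] cu]; split; first by exists V => // k; exact: fdimZ.
move=> k e e0; pose a := `|t k| + 1; pose b := onorm (u k) + 1.
have a0 : 0 < a by rewrite /a ltr_wpDl.
have b0 : 0 < b by rewrite /b ltr_wpDl// onorm_ge0.
pose d := Num.min 1 (e / (2 * b)).
have d0 : 0 < d by rewrite lt_min ltr01 divr_gt0// mulr_gt0.
have ea0 : 0 < e / (2 * a) by rewrite divr_gt0// mulr_gt0.
have ctk : \forall k' \near k, `|t k' - t k| < d.
  have /cvgrPdist_lt/(_ d d0) := ct k.
  by apply: filterS => k'; rewrite distrC.
apply: filterS2 ctk (cu k _ ea0) => k'; rewrite lt_min => /andP[t1 td] ud.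
have -> : t k' *: u k' - t k *: u k =
    t k' *: (u k' - u k) + (t k' - t k) *: u k.
  by rewrite scalerBr scalerBl addrA subrK.
apply: le_lt_trans (ler_onormD _ _) _; rewrite !onormZ.
have tk' : `|t k'| <= a.
  rewrite /a; have := ler_normD (t k) (t k' - t k); rewrite addrC subrK => h.
  by apply: le_trans h _; rewrite lerD2l ltW.
have : `|t k'| * onorm (u k' - u k) < e / 2.
  apply: (@le_lt_trans _ _ (a * onorm (u k' - u k))).
    by rewrite ler_wpM2r// onorm_ge0.
  have -> : e / 2 = a * (e / (2 * a)) by field; rewrite gt_eqF.
  by rewrite ltr_pM2l.
have : `|t k' - t k| * onorm (u k) <= e / 2.
  apply: (@le_trans _ _ (e / (2 * b) * b)).
    by apply: ler_pM => //; [exact: onorm_ge0|exact: ltW|rewrite /b; lra].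
  by rewrite le_eqVlt; apply/orP; left; apply/eqP; field; rewrite gt_eqF.
lra.
Qed.

Lemma fcont_sum (I : Type) (s : seq I) (P : pred I) (G : I -> K -> E) :
  (forall i, fcont (G i)) -> fcont (fun k => \sum_(i <- s | P i) G i k).
Proof.
move=> cG; elim: s => [|i s IH].
  rewrite (_ : (fun=> _) = fun=> 0); first exact: fcont_cst.
  by apply/funext => k; rewrite big_nil.
rewrite (_ : (fun=> _) = if P i
    then fun k => G i k + \sum_(i <- s | P i) G i k
    else fun k => \sum_(i <- s | P i) G i k).
  by case: (P i) => //; exact: fcontD.
by case: ifP => Pi; apply/funext => k; rewrite big_cons Pi.
Qed.

(** Isometries are equicontinuous: the distance of [A k' (y k')] from [A k (y k)] is at most that of
    [y k'] from [y k] plus the motion of the fixed vector [y k]. Joint continuity thus reduces to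
    pointwise continuity. *)
Lemma fcont_eval (F : orthrep R gT) (A : K -> E -> F) (y : K -> E) :
  (forall k, linear (A k)) -> (forall k w, onorm (A k w) = onorm w) ->
  (forall w, fcont (A^~ w)) -> fcont y -> @fcont K F (fun k => A k (y k)).
Proof.
move=> lA nA cA [[V [n [b VE]] Vy] cy]; split.
  have cAb i : exists V, fdim_subspace V /\ forall k, V (A k (b i)).
    by have [[W fW Wb] _] := cA (b i); exists W.
  have /choice[W hW] := cAb.
  have [Z fZ WZ] := fdim_family (fun i => (hW i).1).
  exists Z => // k; have := Vy k; rewrite VE => -[a _ <-].
  rewrite (lin_sum (lA k)); apply: fdim_sum_closed => // i.
  by rewrite (linZ (lA k)); apply: fdimZ => //; apply/WZ/(hW i).2.
move=> k e e0; have e20 : 0 < e / 2 by rewrite divr_gt0.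
apply: filterS2 (cy k _ e20) ((cA (y k)).2 k _ e20) => k' h1 h2.
apply: le_lt_trans (onorm_triangle _ (A k' (y k)) _) _.
by rewrite -(linB (lA k')) nA [e](splitr e) ltrD.
Qed.

Lemma fcont_rho g u : fcont u -> fcont (fun k => rho g (u k)).
Proof.
move=> cu; apply: (@fcont_eval E (fun=> rho g)) => // [k|k v|v].
- exact: rho_linear.
- exact: onorm_rho.
- exact: fcont_cst.
Qed.

End Operations.

Lemma fin_open_ball (E : orthrep R gT) (x : E) e :
  open ([set y | onorm (y - x) < e] : set (fintop E)).
Proof.
move=> V fV y Vy /= yx; exists (e - onorm (y - x)); first by rewrite subr_gt0.
by move=> z Vz zy; have := onorm_triangle z y x; lra.
Qed.

Lemma fintop_hausdorff (E : orthrep R gT) : hausdorff_space (fintop E).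
Proof.
move=> x y cl; apply/eqP; rewrite -subr_eq0; apply/eqP; apply: onorm0_eq0.
apply/eqP; rewrite eq_le onorm_ge0 andbT leNgt; apply/negP => xy.
pose e := onorm (x - y) / 2; have e0 : 0 < e by rewrite divr_gt0.
have nb (z : E) : nbhs (z : fintop E) [set w : fintop E | onorm ((w : E) - z) < e].
  by apply: open_nbhs_nbhs; split; [exact: fin_open_ball|rewrite /= subrr onorm0].
have [z [/= zx zy]] := cl _ _ (nb x) (nb y).
have := onorm_triangle x z y; rewrite onormBC in zx; move: zx zy; rewrite /e; lra.
Qed.

(* Choose x_m in C outside F_m; since every F_p contains finitely many of the
   x_m, the tails of (x_m) are closed, which contradicts compactness. *)
Lemma compact_fdim (E : orthrep R gT) (F : nat -> set E) (C : set (fintop E)) :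
  (forall m, fdim_subspace (F m)) -> (forall m p, (m <= p)%N -> F m `<=` F p) ->
  (forall x, exists m, F m x) ->
  compact C -> exists2 V, fdim_subspace V & C `<=` V.
Proof.
move=> fF Fm FT cC.
have [[m Cm]|/forallNP nC] := pselect (exists m, C `<=` F m); first by exists (F m).
have /choice[x hx] : forall m, exists x, C x /\ ~ F m x.
  by move=> m; have /existsNP[x /not_implyP] := nC m; exists x.
(* A finite-dimensional [V] lies in some [F p], so only the finitely many [x j] with j < p can occur
   in it, and a ball about [y] avoids those different from [y]. *)
have oB m : open (~` [set y : fintop E | exists2 j, (m <= j)%N & y = x j]).
  move=> V [d [b Vb]] y Vy ny.
  have [p Vp] : exists p, V `<=` F p.
    have /choice[q hq] : forall i, exists q, F q (b i) by move=> i; exact: FT.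
    exists (\max_i q i)%N => _ /[!Vb] -[a _ <-].
    apply: fdim_sum_closed => [//|i]; apply: fdimZ => //; apply: (Fm (q i)) => //.
    exact: leq_bigmax.
  have [e e0 he] : exists2 e : R, 0 < e &
      forall j, (j < p)%N -> (x j : E) <> y -> e <= onorm ((x j : E) - y).
    elim: p {Vp} => [|p [e e0 he]]; first by exists 1.
    have [xy|xy] := pselect ((x p : E) = y).
      by exists e => // j; rewrite ltnS leq_eqVlt => /predU1P[-> //|]; exact: he.
    exists (Num.min e (onorm ((x p : E) - y))).
      rewrite lt_min e0 /=; apply: onorm_gt0; rewrite subr_eq0; exact/eqP.
    move=> j; rewrite ltnS leq_eqVlt => /predU1P[-> _|jp xjy].
      by rewrite ge_min lexx orbT.
    by rewrite ge_min he.
  exists e => // z Vz zy [j mj zj].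
  have [jp|pj] := ltnP j p; last first.
    by apply: (hx j).2; apply: (Fm p) => //; rewrite -zj; exact: Vp.
  have xjy : (x j : E) <> y by move=> xjy; apply: ny; exists j.
  by have := he j jp xjy; rewrite -zj leNgt zy.
pose P m (y : fintop E) := ~ exists2 j, (m <= j)%N & y = x j.
(* The open sets [P m] grow with m and cover [C], since a [y] in [F m] equals no [x j] with j >= m.
   By compactness one of them contains [C], although it misses [x m]. *)
suff [m _ h] : \forall m \near \oo, C `<=` P m.
  by case: (h m (leqnn m) (x m) (hx m).1); exists m.
apply: ((compact_near_coveringP C).1 cC nat \oo P _).
move=> y Cy; have [m Fy] := FT y.
exists ([set y | P m y], [set p | (m <= p)%N]) => /=; last first.
  by move=> [z p] /= [Pz mp] [j pj zj]; apply: Pz; exists j => //; exact: leq_trans pj.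
split; last by exists m.
apply: open_nbhs_nbhs; split; first exact: oB.
by move=> [j mj yj]; apply: (hx j).2; rewrite -yj; exact: Fm Fy.
Qed.

Section Universe.
Variable U : universe R gT.

Lemma universe_filtration : exists F : nat -> set U,
  [/\ forall m, fdim_subspace (F m), forall m p, (m <= p)%N -> F m `<=` F p
    & forall x, exists m, F m x].
Proof.
have [b [_ bs]] := univ_dim U.
exists (fun m => [set \sum_(i < m) a i *: b i | a in [set: 'I_m -> R]]); split.
- by move=> m; exact: fdim_span.
- move=> m p mp _ [a _ <-]; have fp : fdim_subspace
    [set \sum_(i < p) a i *: b i | a in [set: 'I_p -> R]] by exact: fdim_span.
  apply: (fdim_sum_closed _ _ fp) => i; apply: (fdimZ _ fp).
  pose j := widen_ord mp i; exists (fun k => (k == j)%:R) => //.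
  rewrite (bigD1 j)//= eqxx scale1r big1 ?addr0// => k /negPf ->.
  by rewrite scale0r.
- by move=> x; have [m [a ->]] := bs x; exists m; exists a.
Qed.

Lemma continuous_fcont (K : topologicalType) (u : K -> U) :
  compact [set: K] -> continuous (u : K -> fintop U) -> fcont u.
Proof.
move=> cK cu; have [F [fF Fm FT]] := universe_filtration.
split.
  have [|V fV uV] := compact_fdim fF Fm FT (C := range u).
    by apply: continuous_compact => //; exact: continuous_subspaceT.
  by exists V => // k; apply: uV; exists k.
move=> k e e0; apply: (cu k [set y : fintop U | onorm ((y : U) - u k) < e]).
by apply: open_nbhs_nbhs; split; [exact: fin_open_ball|rewrite /= subrr onorm0].
Qed.

End Universe.

End FiniteContinuity.

(** * Index arithmetic for operad composition *)

Section OperadIndexLemmas.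

(** The first component of [Rank i j] is [i] only propositionally, so [j] and the second component
    have different types. Abstracting [P] over the position and both components avoids
    transports. *)
Lemma sig_rank_ind k (n : 'I_k -> nat)
    (P : forall x : 'I_(\sum_i n i), forall i, 'I_(n i) -> Prop) :
  (forall x, P x (tagnat.sig1 x) (tagnat.sig2 x)) ->
  forall i j, P (tagnat.Rank i j) i j.
Proof.
move=> h i j; have := h (tagnat.Rank i j).
rewrite /tagnat.sig1 /tagnat.sig2 /tagnat.Rank.
by case: (tagnat.sig (tagnat.rank _)) / (esym (tagnat.rankK (Tagged (fun i => 'I_(n i)) j))).
Qed.

Lemma Rank_ord1 n (j : 'I_n) :
  cast_ord (big_ord1 _ (fun=> n)) (tagnat.Rank (p_ := fun=> n) ord0 j) = j.
Proof.
by apply: val_inj; apply: etrans (tagnat.RankEsum _) _; rewrite big_pred0.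
Qed.

Lemma Rank_ones k (i : 'I_k) (j : 'I_1) :
  cast_ord (sum_ones k) (tagnat.Rank (p_ := fun=> 1%N) i j) = i.
Proof.
apply: val_inj; apply: etrans (tagnat.RankEsum _) _; rewrite (ord1 j) addn0.
by rewrite -(big_ord_widen k (fun=> 1%N) (ltnW (ltn_ord i))) sum1_card card_ord.
Qed.

(** Ranks are lexicographic: what precedes a position are the whole earlier blocks and the beginning
    of its own. With the weights [m] this is the offset needed for the associativity of flattening
    in [Rank_Rank]. *)
Lemma sum_ltn_rank k (n : 'I_k -> nat) (m : forall i, 'I_(n i) -> nat)
    (x : 'I_(\sum_i n i)) :
  (\sum_(y < \sum_i n i | (y < x)%N) m (tagnat.sig1 y) (tagnat.sig2 y) =
   \sum_(i < k | (i < tagnat.sig1 x)%N) \sum_(j < n i) m i j +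
   \sum_(j < n (tagnat.sig1 x) | (j < tagnat.sig2 x)%N) m (tagnat.sig1 x) j)%N.
Proof.
have -> : (\sum_(y < \sum_i n i | (y < x)%N) m (tagnat.sig1 y) (tagnat.sig2 y) =
  \sum_(i < k) \sum_(j < n i | (tagnat.Rank i j < x)%N) m i j)%N.
  rewrite sig_big_dep /= (reindex (@tagnat.rank k n)) /=; last first.
    exact/onW_bij/tagnat.rank_bij.
  apply: eq_big => [[i j]//|[i j] _].
  by apply: (@sig_rank_ind k n (fun x i j => m (tagnat.sig1 x) (tagnat.sig2 x) = m i j)).
set i0 := tagnat.sig1 x; set j0 := tagnat.sig2 x.
have ltR (i : 'I_k) (j : 'I_(n i)) : (tagnat.Rank i j < x)%N = (i < i0)%N || [&& (i == i0) & (tagnat.Rank i j < tagnat.Rank i0 j0)%N].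
  rewrite -[x in LHS]tagnat.sig2K -/j0 -/i0.
  have -> : (tagnat.Rank i j < tagnat.Rank i0 j0)%N =
      (Tagged (fun i => 'I_(n i)) j < Tagged (fun i => 'I_(n i)) j0)%O.
    exact: tagnat.lt_rank.
  rewrite ltEsig /= !leEord -/i0; have [ii0|i0i|/val_inj ii0] := ltngtP i i0.
  - by [].
  - by case: eqVneq i0i => // ->; rewrite ltnn.
  - by have /eqP -> := ii0.
rewrite (bigID (fun i : 'I_k => i < i0)%N) /=; congr (_ + _)%N.
  by apply: eq_bigr => i ii0; apply: eq_bigl => j; rewrite ltR ii0.
rewrite (bigD1 i0) ?ltnn//= [X in (_ + X)%N]big1 ?addn0.
  by apply: eq_bigl => j; rewrite ltR ltnn eqxx /=; exact: tagnat.lt_Rank.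
move=> i /andP[ni ii0]; rewrite big_pred0// => j.
by rewrite ltR (negPf ni) (negPf ii0).
Qed.

Lemma Rank_Rank k (n : 'I_k -> nat) (m : forall i, 'I_(n i) -> nat)
    (x : 'I_(\sum_i n i)) (j : 'I_(m (tagnat.sig1 x) (tagnat.sig2 x))) :
  cast_ord (sum_sum m)
    (tagnat.Rank (p_ := fun x => m (tagnat.sig1 x) (tagnat.sig2 x)) x j) =
  tagnat.Rank (p_ := fun i => (\sum_(j < n i) m i j)%N) (tagnat.sig1 x)
    (tagnat.Rank (tagnat.sig2 x) j).
Proof.
apply: val_inj; apply: etrans (tagnat.RankEsum _) _.
rewrite sum_ltn_rank -addnA -[RHS]/(nat_of_ord (tagnat.Rank _ _)).
by rewrite tagnat.RankEsum tagnat.RankEsum.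
Qed.

Lemma block_permE k (s : 'S_k) (n : 'I_k -> nat) (i : 'I_k) (j : 'I_(n (s i))) :
  block_perm s n (cast_ord (sum_perm s n) (tagnat.Rank (p_ := n \o s) i j)) =
  tagnat.Rank (s i) j.
Proof.
rewrite permE /block_perm_fun cast_ordK.
exact: (@sig_rank_ind k (n \o s) (fun x i j =>
  tagnat.Rank (s (tagnat.sig1 x)) (tagnat.sig2 x) = tagnat.Rank (p_ := n) (s i) j)).
Qed.

Lemma dsum_permE k (n : 'I_k -> nat) (t : forall i, 'S_(n i)) i (j : 'I_(n i)) :
  dsum_perm t (tagnat.Rank i j) = tagnat.Rank i (t i j).
Proof.
rewrite permE /dsum_perm_fun.
exact: (@sig_rank_ind k n (fun x i j =>
  tagnat.Rank (tagnat.sig1 x) (t _ (tagnat.sig2 x)) = tagnat.Rank i (t i j))).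
Qed.

End OperadIndexLemmas.

(** * Inclusions and projections of finite direct sums *)

Section DirectSumMaps.
Context (R : realType) (gT : finGroupType) (E : orthrep R gT) (n : nat).

Definition dsum_in (i : 'I_n) (v : E) : dsum E n :=
  [ffun j => if j == i then v else 0].

Lemma dsum_in_linear i : linear (dsum_in i).
Proof.
move=> a v w; apply/ffunP => j; rewrite !ffunE; case: ifP => // _.
by rewrite scaler0 addr0.
Qed.

Lemma ip_dsum_in i v (x : dsum E n) : ip (dsum_in i v) x = ip v (x i).
Proof.
rewrite [LHS](bigD1 i)//= ffunE eqxx big1 ?addr0// => j /negPf ji.
by rewrite ffunE ji ip0l.
Qed.

Lemma onorm_dsum_in i v : onorm (dsum_in i v) = onorm v.
Proof. by rewrite /onorm ip_dsum_in ffunE eqxx. Qed.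

Lemma dsum_decomp (x : dsum E n) : x = \sum_i dsum_in i (x i).
Proof.
apply/ffunP => j; rewrite sum_ffunE (bigD1 j)//= ffunE eqxx big1 ?addr0//.
by move=> i /negPf ij; rewrite ffunE eq_sym ij.
Qed.

Lemma onorm_proj_le (x : dsum E n) i : onorm (x i) <= onorm x.
Proof.
rewrite -(@ler_pXn2r _ 2) ?nnegrE ?onorm_ge0// !onorm_sqr.
rewrite [leRHS](bigD1 i)//= lerDl; apply: sumr_ge0 => j _; exact: ip_ge0.
Qed.

Lemma proj_linear i : linear (fun x : dsum E n => x i).
Proof. by move=> a x y; rewrite !ffunE. Qed.

Lemma proj_fintop_continuous i :
  continuous ((fun x : dsum E n => x i) : fintop (dsum E n) -> fintop E).
Proof.
apply/continuousP => A oA.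
suff: fin_open ((fun x : dsum E n => x i) @^-1` A) by [].
move=> V fV x Vx Ax.
have [Z fZ VZ] := fdim_image (proj_linear i) fV.
have [e e0 he] := (oA : fin_open A) Z fZ (x i) (VZ _ Vx) Ax.
exists e => // y Vy yx; apply: he; first exact: VZ.
apply: le_lt_trans yx; have := onorm_proj_le (y - x) i.
by rewrite /= !ffunE.
Qed.

Lemma fcont_dsum (K : topologicalType) (u : K -> dsum E n) :
  (forall i, fcont (fun k => u k i)) -> fcont u.
Proof.
move=> cu; rewrite (_ : u = fun k => \sum_i dsum_in i (u k i)); last first.
  by apply/funext => k; rewrite -dsum_decomp.
apply: fcont_sum => i; apply: (@fcont_eval _ _ _ _ _ (fun=> dsum_in i)) => //.
- by move=> _; exact: dsum_in_linear.
- by move=> _ v; exact: onorm_dsum_in.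
- by move=> v; exact: fcont_cst.
Qed.

End DirectSumMaps.

Lemma compactly_generated_continuous (X Y : topologicalType) (f : X -> Y) :
  compactly_generated X -> kcontinuous f -> continuous f.
Proof.
move=> cgX kf; apply/continuousP => A oA; apply: cgX => K u cK hK cu.
have /continuousP cfu : continuous (f \o u) by exact: kf.
by rewrite -comp_preimage; exact: cfu.
Qed.

(** * The linear isometries operad satisfies the axioms *)

Section LinearIsometriesOperad.
Context (R : realType) (gT : finGroupType) (U : universe R gT).
Notation L := (linear_isometries_operad U).

Definition compact_open_linisom n : topologicalType :=
  initial_topology (fun f : linisom U n =>
    linisom_fun f : {compact-open, fintop (dsum U n) -> fintop U}).

Lemma linisom_eval_continuous n (x : dsum U n) :
  continuous ((fun f : linisom U n => f x) : compact_open_linisom n -> fintop U).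
Proof.
pose X : topologicalType := {compact-open, fintop (dsum U n) -> fintop U}.
suff cX : continuous ((fun g => g x) : X -> fintop U).
  move=> f; apply: (@continuous_comp _ X (fintop U) _ (fun g : X => g x)).
    exact: initial_continuous.
  exact: cX.
apply/continuousP => A oA.
rewrite (_ : _ @^-1` A =
  [set g : X | g @` [set x : fintop (dsum U n)] `<=` A]).
  by apply: compact_open_open => //; exact: compact_set1.
apply/seteqP; split=> g /=; last by apply; exists x.
by move=> Ag _ [_ -> <-].
Qed.

(** For isometries, convergence in the compact-open topology is pointwise convergence. Evaluation is
    continuous; conversely the images of a compact [C] under all [u k] lie in one finite-dimensional
    [Z], and norm preservation spreads closeness at [y] to the vectors near [y]. *)
Lemma linisom_continuousP n (K : topologicalType) (u : K -> L n) :
  compact [set: K] -> hausdorff_space K ->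
  continuous u <-> forall x, fcont (fun k => (u k : linisom U n) x).
Proof.
move=> cK hK; split=> [/(continuous_kifyP _ cK hK) cu x|cu].
  apply: continuous_fcont => // k.
  apply: (@continuous_comp K (compact_open_linisom n) (fintop U) u
    (fun f : linisom U n => f x)); first exact: cu.
  exact: linisom_eval_continuous.
apply/(continuous_kifyP _ cK hK); apply: continuous_comp_initial => k.
apply/compact_open_cvgP => C O cC oO uCO.
have [F [fF Fm FT]] := universe_filtration U.
(* The filtration required by [compact_fdim] is at hand on [U], so [C] is confined coordinate by
   coordinate. *)
have /choice[V hV] i : exists V, fdim_subspace V /\ forall y : dsum U n, C y -> V (y i).
  have [|V fV CV] := compact_fdim fF Fm FT (C := (fun x : dsum U n => x i) @` C).
    apply: continuous_compact => //; apply: continuous_subspaceT.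
    exact: proj_fintop_continuous.
  by exists V; split=> // y Cy; apply: CV; exists y.
have /choice[W hW] i : exists W, fdim_subspace W /\
    forall k v, V i v -> W ((u k : linisom U n) (dsum_in i v)).
  have [[d [b VE]] _] := hV i.
  have /choice[Z hZ] j : exists Z, fdim_subspace Z /\
      forall k, Z ((u k : linisom U n) (dsum_in i (b j))).
    by have [[Z fZ Zu] _] := cu (dsum_in i (b j)); exists Z.
  have [W fW ZW] := fdim_family (fun j => (hZ j).1).
  exists W; split=> // k' _ /[!VE] -[a _ <-].
  rewrite (lin_sum (dsum_in_linear i)) (lin_sum (linisom_linear _)).
  apply: fdim_sum_closed => // j; rewrite (linZ (dsum_in_linear i)).
  by rewrite (linZ (linisom_linear _)); apply: fdimZ => //; apply/ZW/(hZ j).2.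
have [Z fZ WZ] := fdim_family (fun i => (hW i).1).
have Zu k' y : C y -> Z ((u k' : linisom U n) y).
  move=> Cy; rewrite [y]dsum_decomp (lin_sum (linisom_linear _)).
  by apply: fdim_sum_closed => // i; apply/WZ/(hW i).2/(hV i).2.
pose P k' (y : fintop (dsum U n)) := C y -> O ((u k' : linisom U n) y).
suff: \forall k' \near k, C `<=` P k'.
  apply: (@filterS _ (nbhs k)) => k' CP _ [y Cy <-]; exact: CP.
apply: ((compact_near_coveringP C).1 cC _ (nbhs k) P _) => y Cy.
have Oy : O ((u k : linisom U n) y) by apply: uCO; exists y.
have [e e0 he] := (oO : fin_open O) Z fZ _ (Zu k y Cy) Oy.
have e20 : 0 < e / 2 by rewrite divr_gt0.
exists ([set y' : fintop (dsum U n) | onorm ((y' : dsum U n) - y) < e / 2],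
  [set k' | onorm ((u k' : linisom U n) y - (u k : linisom U n) y) < e / 2]).
  split=> /=; last exact: (cu y).2.
  by apply: open_nbhs_nbhs; split; [exact: fin_open_ball|rewrite /= subrr onorm0].
move=> [y' k'] /= [h1 h2] Cy'; apply: he; first exact: Zu.
apply: le_lt_trans (onorm_triangle _ ((u k' : linisom U n) y) _) _.
by rewrite -(linB (linisom_linear _)) linisom_isom [e](splitr e) ltrD.
Qed.

Lemma linisom_hausdorff n : hausdorff_space (L n).
Proof.
apply: hausdorff_kify => f g cl; apply: linisomP => x.
apply: (@fintop_hausdorff _ _ U) => P Q Pf Qg.
have [h [Ph Qh]] := cl _ _ (linisom_eval_continuous Pf) (linisom_eval_continuous Qg).
by exists (h x).
Qed.

Lemma linisom_act_cont n (x : gT * 'S_n) : continuous (op_act L x).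
Proof.
apply: compactly_generated_continuous; first exact: kify_compactly_generated.
move=> K u cK hK /(linisom_continuousP _ cK hK) cu.
by apply/(linisom_continuousP _ cK hK) => v; apply: fcont_rho; exact: cu.
Qed.

Lemma linisom_ecast m p (e : m = p) (f : L m) (x : dsum U p) :
  (ecast m (L m) e f : linisom U p) x =
  (f : linisom U m) [ffun i => x (cast_ord e i)].
Proof.
case: _ / e x => x; congr (linisom_fun f _).
by apply/ffunP => i; rewrite ffunE cast_ord_id.
Qed.

Lemma linear_isometries_is_operad : is_operad L.
Proof.
split.
- move=> n; split; first exact: kify_compactly_generated.
  exact/hausdorff_weak_hausdorff/linisom_hausdorff.
- move=> n c; apply: linisomP => v; rewrite /= /linisom_act_fun /= rho1.
  by congr (linisom_fun c _); apply/ffunP => i; rewrite ffunE !invg1 perm1 rho1.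
- move=> n x y c; apply: linisomP => v; rewrite /= /linisom_act_fun /= rhoM.
  congr (rho _ (rho _ (linisom_fun c _))); apply/ffunP => i.
  by rewrite !ffunE !invMg rhoM permM.
- exact: linisom_act_cont.
(* The values of the inner isometries form a continuous family of vectors, to which [fcont_eval]
   applies the outer isometry. *)
- move=> k n K u cK hK cu; apply/(linisom_continuousP _ cK hK) => v.
  apply: (@fcont_eval _ _ _ (dsum U k) U (fun z => linisom_fun (u z).1)
    (fun z => [ffun i => linisom_fun ((u z).2 i) [ffun j => v (tagnat.Rank i j)]])).
  + by move=> z; exact: linisom_linear.
  + by move=> z; exact: linisom_isom.
  + apply/(linisom_continuousP _ cK hK) => z.
    by apply: (@continuous_comp _ _ _ u fst); [exact: cu|exact: cvg_fst].
  + apply: fcont_dsum => i.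
    have cui : continuous (fun z => (u z).2 i).
      move=> z; apply: (@continuous_comp _ _ _ u (fun p => p.2 i)); first exact: cu.
      apply: (@continuous_comp (L k * prod_topology (fun i => L (n i)))%type
        (prod_topology (fun i => L (n i))) (L (n i)) snd (fun g => g i)).
        exact: cvg_snd.
      exact: (@proj_continuous _ (fun i => L (n i)) i).
    have := (linisom_continuousP _ cK hK).1 cui [ffun j => v (tagnat.Rank i j)].
    by congr fcont; apply/funext => z; rewrite ffunE.
- by move=> g; apply: linisomP => v; rewrite /= /linisom_act_fun /= ffunE
    invg1 perm1 rhoKV.
- move=> g k n c d; apply: linisomP => v.
  rewrite /= /linisom_comp_fun /= /linisom_act_fun /= /linisom_comp_fun.
  congr (rho _ (linisom_fun c _)); apply/ffunP => i; rewrite !ffunE.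
  have e1 : (1^-1)%g = 1%g :> 'S_k := invg1 _.
  rewrite /= /linisom_act_fun /= rhoK e1 perm1; congr (linisom_fun (d i) _).
  by apply/ffunP => j; rewrite !ffunE !invg1 !perm1.
- move=> n c; apply: linisomP => v; rewrite linisom_ecast /= /linisom_comp_fun /=.
  rewrite ffunE; congr (linisom_fun c _); apply/ffunP => j.
  by rewrite !ffunE Rank_ord1.
- move=> k c; apply: linisomP => v; rewrite linisom_ecast /= /linisom_comp_fun /=.
  congr (linisom_fun c _); apply/ffunP => j.
  by rewrite !ffunE Rank_ones.
- move=> k n m c d e; apply: linisomP => v; rewrite linisom_ecast /=.
  rewrite /linisom_comp_fun /= /linisom_comp_fun.
  congr (linisom_fun c _); apply/ffunP => i; rewrite !ffunE /= /linisom_comp_fun.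
  congr (linisom_fun (d i) _); apply/ffunP => a; rewrite !ffunE.
  transitivity (linisom_fun (e i a)
    [ffun j => v (tagnat.Rank (p_ := fun i => (\sum_(j < n i) m i j)%N) i
                    (tagnat.Rank a j))]); last first.
    by congr (linisom_fun (e i a) _); apply/ffunP => j; rewrite !ffunE.
  move: i a; apply: (@sig_rank_ind k n (fun x i a =>
    linisom_fun (e (tagnat.sig1 x) (tagnat.sig2 x)) [ffun j => [ffun i =>
      v (cast_ord (sum_sum m) i)] (tagnat.Rank (p_ := fun x => m (tagnat.sig1 x)
        (tagnat.sig2 x)) x j)] =
    linisom_fun (e i a)
    [ffun j => v (tagnat.Rank (p_ := fun i => (\sum_(j < n i) m i j)%N) i
                    (tagnat.Rank a j))])) => x.
  by congr (linisom_fun (e _ _) _); apply/ffunP => j; rewrite !ffunE Rank_Rank.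
- move=> k n s c d; apply: linisomP => v; rewrite linisom_ecast /=.
  rewrite /linisom_comp_fun /= /linisom_act_fun /= /linisom_comp_fun !rho1.
  congr (linisom_fun c _); apply/ffunP => i; rewrite !ffunE.
  (* The type of [d i] depends on [i], so [i] is replaced by an image under [s] in the whole
     statement [Q] instead of being rewritten. *)
  rewrite invg1 rho1; pose Q i := linisom_fun (d (s (s^-1%g i)))
      [ffun j => [ffun z => v (cast_ord (sum_perm s n) z)]
        (tagnat.Rank (p_ := n \o s) (s^-1%g i) j)] =
    linisom_fun (d i) [ffun j =>
      [ffun z => rho 1%g (v ((block_perm s n)^-1%g z))] (tagnat.Rank i j)].
  suff H i' : Q (s i').
    suff: Q i by [].
    by rewrite -[i](permKV s); exact: H.
  rewrite /Q permK; congr (linisom_fun (d (s i')) _); apply/ffunP => j.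
  rewrite !ffunE rho1; congr (v _); apply: (@perm_inj _ (block_perm s n)).
  by rewrite permKV block_permE.
- move=> k n t c d; apply: linisomP => v.
  rewrite /= /linisom_comp_fun /= /linisom_act_fun /= /linisom_comp_fun !rho1.
  congr (linisom_fun c _); apply/ffunP => i; rewrite !ffunE /= /linisom_act_fun rho1.
  congr (linisom_fun (d i) _); apply/ffunP => j; rewrite !ffunE /=; congr (rho _ (v _)).
  by apply: (@perm_inj _ (dsum_perm t)); rewrite permKV dsum_permE permKV.
Qed.

End LinearIsometriesOperad.

(** * Metric description and topology of disc configurations *)

Section DiscConfigurations.
Context (R : realType) (gT : finGroupType) (U : orthrep R gT).

Definition disc_config n (c : 'I_n -> R * U) : Prop :=
  (forall i, 0 < (c i).1 /\ (c i).1 + onorm (c i).2 <= 1) /\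
  (forall i j, i != j -> (c i).1 + (c j).1 <= onorm ((c i).2 - (c j).2)).

Lemma subrep_fdimB (V : set U) v w : disc_stage V -> V v -> V w -> V (v - w).
Proof.
move=> [_ fV _] Vv Vw; rewrite addrC -scaleN1r; exact: fdim_lin.
Qed.

(** In a non-zero space, open discs are disjoint exactly when their radii add up to at most the
    distance of their centres. The stage therefore enters only through the centres. *)
Lemma little_discsP (V : set U) n (c : 'I_n -> R * U) : disc_stage V ->
  little_discs V c <-> disc_config c /\ forall i, V (c i).2.
Proof.
move=> sV; have [rV fV _] := sV; split=> [[lc dc]|[[lc dc] Vc]].
  split; last by move=> i; have [] := lc i.
  split=> [i|i j ij]; first by split; [have [] := lc i|exact: little_disc_bound sV (lc i)].
  have [[ri0 Vi _] [rj0 Vj _]] := (lc i, lc j).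
  rewrite leNgt; apply/negP => h; set s := (c i).1 + (c j).1 in h.
  have s0 : 0 < s by rewrite addr_gt0.
  pose x := (c j).2 - (c i).2.
  have Dx a : `|a| = 1 -> unit_disc V ((a / s) *: x).
    move=> a1; split; first by apply: subrepZ => //; exact: subrep_fdimB.
    rewrite onormZ normrM a1 mul1r gtr0_norm ?invr_gt0// mulrC ltr_pdivrMr//.
    by rewrite mul1r onormBC.
  (* When the sum [s] of the radii exceeds the distance, both discs contain the point dividing the
     segment between the centres in the ratio of the radii. *)
  apply: (dc i j ij _ _ (Dx 1 (normr1 _)) (Dx (-1) (normrN1 _))).
  rewrite /disc_map !scalerA; have -> : (c j).2 = x + (c i).2 by rewrite subrK.
  rewrite addrA -[X in _ + X + _]scale1r -scalerDl; congr (_ *: _ + _).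
  by rewrite /s; field; rewrite gt_eqF.
split=> [i|i j ij v w [_ v1] [_ w1] E].
  have [r0 rb] := lc i; split=> // v [Vv v1]; split=> /=.
    by apply: subrepD => //; exact: subrepZ.
  apply: le_lt_trans (ler_onormD _ _) _; rewrite onormZ gtr0_norm//.
  by apply: lt_le_trans rb; rewrite ltrD2r gtr_pMr.
have [[ri0 _] [rj0 _]] := (lc i, lc j).
have := dc i j ij; rewrite leNgt => /negP; apply.
have -> : (c i).2 - (c j).2 = (c j).1 *: w - (c i).1 *: v.
  by apply/eqP; rewrite subr_eq addrAC -/(disc_map (c j) w) -E /disc_map addrAC subrr add0r eqxx.
apply: le_lt_trans (ler_onormD _ _) _.
by rewrite onormN !onormZ !gtr0_norm// addrC ltrD// gtr_pMr.
Qed.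

(** The group is finite, so the translates of a finite spanning set span a finite-dimensional
    subrepresentation; the vector [v] of [V0] ensures that it is non-zero. *)
Lemma fdim_stage (V0 V : set U) : disc_stage V0 -> fdim_subspace V ->
  exists2 Z, disc_stage Z & V `<=` Z.
Proof.
move=> [_ _ [v _ v0]] fV; have [L fL Lv] := fdim_line v.
have [Y [n [b YE]] [VY LY]] := fdim2 fV fL.
pose Z := [set \sum_(p : gT * 'I_n) a p *: rho p.1 (b p.2)
            | a in [set: gT * 'I_n -> R]].
have fZ : fdim_subspace Z by exact: fdim_span.
have YZ : Y `<=` Z.
  move=> _ /[!YE] -[a _ <-].
  apply: fdim_sum_closed => // i; apply: fdimZ => //.
  exists (fun p => (p == (1%g, i))%:R) => //.
  rewrite (bigD1 (1%g, i))//= eqxx scale1r rho1 big1 ?addr0// => p /negPf ->.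
  by rewrite scale0r.
exists Z; last exact: subset_trans VY YZ.
split=> //; last by exists v => //; exact/YZ/LY.
split; [exact: fdim0|by move=> a x y; exact: fdim_lin|].
move=> g _ [a _ <-]; exists (fun p => a (g^-1 * p.1, p.2)%g) => //.
rewrite (lin_sum (rho_linear g)).
rewrite (reindex (fun p : gT * 'I_n => (g * p.1, p.2)%g)) /=.
  apply: eq_bigr => -[h i] _ /=.
  by rewrite mulKg (linZ (rho_linear g)) rhoM.
apply: onW_bij; exists (fun p => (g^-1 * p.1, p.2)%g) => -[h i] /=.
  by rewrite mulKg.
by rewrite mulKVg.
Qed.

(** Configurations constructed later are given by metric inequalities alone; the stage that
    [inf_discs] demands is obtained here from their centres. *)
Lemma disc_config_stage (V0 : set U) n (c : 'I_n -> R * U) : disc_stage V0 ->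
  disc_config c -> exists2 V : set U, disc_stage V & little_discs V c.
Proof.
move=> sV0 cc; have /choice[W hW] i : exists W, fdim_subspace W /\ W (c i).2.
  by have [W fW Wc] := fdim_line (c i).2; exists W.
have [Y fY WY] := fdim_family (fun i => (hW i).1).
have [V sV YV] := fdim_stage sV0 fY; exists V => //.
by apply/little_discsP => //; split=> // i; apply/YV/WY/(hW i).2.
Qed.

Lemma inf_discs_config n (c : inf_discs U n) : disc_config c.
Proof. by have [V sV /(little_discsP _ sV)[]] := inf_discs_stage c. Qed.

Section DiscTopology.
Variable n : nat.

Lemma discs_radius_continuous i :
  continuous ((fun c : inf_discs U n => (c i).1) : inf_discs U n -> R).
Proof.
apply/continuousP => A; rewrite openE => oA.
suff: discs_open ((fun c : inf_discs U n => (c i).1) @^-1` A) by [].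
move=> V sV c Vc Ac; have /nbhs_ballP[e /= e0 he] := oA _ Ac.
by exists e => // d Vd /(_ i)[h _]; by apply: he; rewrite -ball_normE /= distrC.
Qed.

Lemma discs_centre_continuous i :
  continuous ((fun c : inf_discs U n => (c i).2) : inf_discs U n -> fintop U).
Proof.
apply/continuousP => A oA.
suff: discs_open ((fun c : inf_discs U n => (c i).2) @^-1` A) by [].
move=> V sV c Vc Ac; have [_ fV _] := sV.
have Vi (d : inf_discs U n) : little_discs V d -> V (d i).2.
  by move=> /(little_discsP _ sV)[].
have [e e0 he] := (oA : fin_open A) V fV _ (Vi c Vc) Ac.
by exists e => // d Vd /(_ i)[_ h]; apply: he => //; exact: Vi.
Qed.

Lemma discs_hausdorff : hausdorff_space (inf_discs U n).
Proof.
move=> c d cl; apply: inf_discsP => i.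
rewrite [c i]surjective_pairing [d i]surjective_pairing; congr (_, _).
  apply: (@Rhausdorff R) => P Q Pc Qd.
  have [x [Px Qx]] := cl _ _ (discs_radius_continuous Pc) (discs_radius_continuous Qd).
  by exists (x i).1.
apply: (@fintop_hausdorff _ _ U) => P Q Pc Qd.
have [x [Px Qx]] := cl _ _ (discs_centre_continuous Pc) (discs_centre_continuous Qd).
by exists (x i).2.
Qed.

(** All centres lie in one finite-dimensional subspace, so the family stays in a single stage, where
    openness is a metric condition. *)
Lemma discs_continuous (K : topologicalType) (u : K -> inf_discs U n) :
  (forall i, continuous (fun k => (u k i).1)) ->
  (forall i, fcont (fun k => (u k i).2)) -> continuous u.
Proof.
move=> cr cb; apply/continuousP => A oA.
rewrite openE => k Auk.
have /choice[W hW] i : exists W, fdim_subspace W /\ forall k, W (u k i).2.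
  by have [[W fW Wu] _] := cb i; exists W.
have [Y fY WY] := fdim_family (fun i => (hW i).1).
have [V0 sV0 _] := inf_discs_stage (u k).
have [V sV YV] := fdim_stage sV0 fY.
have Vu k' : little_discs V (u k').
  apply/little_discsP => //; split; first exact: inf_discs_config.
  by move=> i; apply/YV/WY/(hW i).2.
have [e e0 he] := (oA : discs_open A) V sV (u k) (Vu k) Auk.
suff: \forall k' \near k, forall i,
    `|(u k' i).1 - (u k i).1| < e /\ onorm ((u k' i).2 - (u k i).2) < e.
  by apply: (@filterS _ (nbhs k)) => k' h; apply: he.
apply: filter_forall => i.
have /cvgrPdist_lt/(_ e e0) h1 := cr i k.
apply: (@filterS2 _ (nbhs k) _ _ _ _ _ h1 ((cb i).2 k e e0)) => k'.
by rewrite distrC.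
Qed.

End DiscTopology.
End DiscConfigurations.

(** * The infinite little discs operad satisfies the axioms *)

Section LittleDiscsOperad.
Context (R : realType) (gT : finGroupType) (U : universe R gT).
Notation D := (infinite_little_discs_operad U).

(** The compact test space of convergent sequences, with the limit at [None]. *)
Notation opc_nat := (one_point_compactification nat).

Lemma opc_nat_hausdorff : hausdorff_space opc_nat.
Proof.
apply: one_point_compactification_hausdorff; last exact: discrete_hausdorff.
move=> n _; exists [set n]; first by rewrite withinET; exact: discrete_set1.
split; first exact: compact_set1.
exact: compact_closed discrete_hausdorff (@compact_set1 _ _).
Qed.

Lemma opc_nat_near (x : opc_nat) (P : opc_nat -> Prop) : P x ->
  (x = None -> exists M, forall m, (M <= m)%N -> P (Some m)) ->
  \forall y \near x, P y.
Proof.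
case: x => [m|] Px h.
  by apply: (@filterS _ (nbhs m) _ [set m]) => [_ ->//|]; exact: discrete_set1.
have [//|M hM] := h; have cI : compact [set m | (m < M)%N].
  exact/finite_compact/finite_II.
exists [set m | (m < M)%N].
  by split=> //; exact: compact_closed discrete_hausdorff cI.
by move=> y [[m /= mM <-]|->//]; apply: hM; rewrite leqNgt; exact/negP.
Qed.

Lemma opc_nat_cvg (X : topologicalType) (u : opc_nat -> X) :
  (forall A, nbhs (u None) A -> exists M, forall m, (M <= m)%N -> A (u (Some m))) ->
  continuous u.
Proof.
move=> h x A Au; apply: (opc_nat_near (P := fun y => A (u y))).
  exact: nbhs_singleton.
by move=> xN; apply: h; rewrite -xN.
Qed.

Lemma opc_nat_near_None (P : opc_nat -> Prop) :
  (\forall y \near (None : opc_nat), P y) -> exists m, P (Some m).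
Proof.
move=> [B [cB _] BP]; pose Q (m x : nat) := (x < m)%N.
have [x Bx|N _ hN] := (compact_near_coveringP B).1 cB nat \oo Q _.
  exists ([set x], [set m | (x < m)%N]) => /=; last by move=> [y m] /= [-> ].
  by split; [exact: discrete_set1|exists x.+1].
exists N; apply: BP; left; exists N => //= BN.
by have := hN N (leqnn N) N BN; rewrite /Q ltnn.
Qed.

(** At each stage openness is a metric condition. If it fails for [A] at [c], a sequence outside [A]
    converges to [c] within the stage; as a map from [opc_nat] it contradicts the hypothesis on
    [A]. *)
Lemma discs_compactly_generated n : compactly_generated (inf_discs U n).
Proof.
move=> A hA; suff: discs_open A by [].
move=> V sV c Vc Ac; apply: contrapT => /forall2NP hn.
have /choice[d hd] m : exists d : inf_discs U n, [/\ little_discs V d,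
    forall i, `|(d i).1 - (c i).1| < m.+1%:R^-1 /\
      onorm ((d i).2 - (c i).2) < m.+1%:R^-1 & ~ A d].
  have [h|/existsNP[d /not_implyP[Vd /not_implyP[dc Ad]]]] := hn m.+1%:R^-1.
    by case: h; rewrite invr_gt0 ltr0n.
  by exists d.
pose u (x : opc_nat) := if x is Some m then d m else c.
have inv_lt (e : R) : 0 < e -> exists M, forall m, (M <= m)%N -> m.+1%:R^-1 < e.
  move=> e0; exists (Num.bound e^-1) => m Mm.
  rewrite invf_plt ?posrE ?ltr0n//; apply: (lt_le_trans (archi_boundP _)).
    by rewrite invr_ge0 ltW.
  by rewrite ler_nat ltnW.
have cu : continuous u.
  apply: discs_continuous => i.
    apply: opc_nat_cvg => B /nbhs_ballP[e /= e0 eB].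
    have [M hM] := inv_lt e e0; exists M => m Mm; apply: eB.
    have [_ /(_ i)[h _] _] := hd m.
    by rewrite -ball_normE /= distrC; apply: lt_trans h (hM m Mm).
  split.
    have [_ fV _] := sV; exists V => // -[m|] /=.
      by have [/(little_discsP _ sV)[_ ]] := hd m.
    by have /(little_discsP _ sV)[] := Vc.
  move=> x e e0; apply: (opc_nat_near (P := fun y =>
    onorm ((u y i).2 - (u x i).2) < e)); first by rewrite subrr onorm0.
  move=> ->; have [M hM] := inv_lt e e0; exists M => m Mm.
  have [_ /(_ i)[_ h] _] := hd m; exact: lt_trans h (hM m Mm).
have := hA opc_nat u (@one_point_compactification_compact _) opc_nat_hausdorff cu.
rewrite openE => /(_ None Ac)/opc_nat_near_None[m /=].
by have [] := hd m.
Qed.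

Lemma discs_ecast m p (e : m = p) (c : inf_discs U m) (i : 'I_p) :
  (ecast m (inf_discs U m) e c : inf_discs U p) i = c (cast_ord (esym e) i).
Proof. by case: _ / e i => i; rewrite cast_ord_id. Qed.

Lemma discs_comp_Rank k (n : 'I_k -> nat) (c : inf_discs U k)
    (d : forall i, inf_discs U (n i)) i (j : 'I_(n i)) :
  discs_comp c d (tagnat.Rank i j) = disc_comp (c i) (d i j).
Proof.
exact: (@sig_rank_ind k n (fun x i j =>
  disc_comp (c (tagnat.sig1 x)) (d _ (tagnat.sig2 x)) = disc_comp (c i) (d i j))).
Qed.

Lemma disc_compA (a b c : R * U) :
  disc_comp (disc_comp a b) c = disc_comp a (disc_comp b c).
Proof. by rewrite /disc_comp /= mulrA scalerDr scalerA addrA. Qed.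

Lemma little_discs_is_operad : is_operad D.
Proof.
split.
- move=> n; split; first exact: discs_compactly_generated.
  exact/hausdorff_weak_hausdorff/discs_hausdorff.
- move=> n c; apply: inf_discsP => i; rewrite /= /discs_act_fun /= perm1 rho1.
  by rewrite -surjective_pairing.
- move=> n x y c; apply: inf_discsP => i; rewrite /= /discs_act_fun /=.
  by rewrite permM rhoM.
- move=> n x; apply: compactly_generated_continuous.
    exact: discs_compactly_generated.
  move=> K u cK hK cu; apply: discs_continuous => i /=.
    move=> k; apply: (@continuous_comp _ _ _ u (fun c : inf_discs U n => (c (x.2 i)).1)).
      exact: cu.
    exact: discs_radius_continuous.
  apply: fcont_rho; apply: continuous_fcont => // k.
  apply: (@continuous_comp _ _ (fintop U) u (fun c : inf_discs U n => (c (x.2 i)).2)).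
    exact: cu.
  exact: discs_centre_continuous.
- move=> k n K u cK hK cu.
  have cu1 : continuous (fun z => (u z).1).
    by move=> z; apply: (@continuous_comp _ _ _ u fst); [exact: cu|exact: cvg_fst].
  have cu2 i : continuous (fun z => (u z).2 i).
    move=> z; apply: (@continuous_comp _ _ _ u (fun p => p.2 i)); first exact: cu.
    apply: (@continuous_comp (D k * prod_topology (fun i => D (n i)))%type
      (prod_topology (fun i => D (n i))) (D (n i)) snd (fun g => g i)).
      exact: cvg_snd.
    exact: (@proj_continuous _ (fun i => D (n i)) i).
  have cr m (v : K -> inf_discs U m) i : continuous v -> continuous (fun z => (v z i).1).
    move=> cv z; apply: (@continuous_comp _ _ _ v (fun c : inf_discs U m => (c i).1)).
      exact: cv.
    exact: discs_radius_continuous.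
  have cb m (v : K -> inf_discs U m) i : continuous v -> fcont (fun z => (v z i).2).
    move=> cv; apply: continuous_fcont => // z.
    apply: (@continuous_comp _ _ (fintop U) v (fun c : inf_discs U m => (c i).2)).
      exact: cv.
    exact: discs_centre_continuous.
  apply: discs_continuous => x /=.
    move=> z; apply: cvgM; [apply: (cr _ _ _ cu1)|apply: (cr _ _ _ (cu2 _))].
  apply: fcontD; last exact: (cb _ _ _ cu1).
  by apply: fcontZ; [exact: (cr _ _ _ cu1)|exact: (cb _ _ _ (cu2 _))].
- move=> g; apply: inf_discsP => i; rewrite /= /discs_act_fun /=.
  by rewrite rho0.
- move=> g k n c d; apply: inf_discsP => x.
  rewrite /= /discs_act_fun /= /discs_comp_fun /= /discs_act_fun /= !perm1.
  by rewrite /disc_comp /= rho_linear.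
- move=> n c; apply: inf_discsP => i; rewrite discs_ecast.
  have -> : cast_ord (esym (big_ord1 _ (fun=> n))) i =
      tagnat.Rank (p_ := fun=> n) ord0 i.
    by apply: (@cast_ord_inj _ _ (big_ord1 _ (fun=> n))); rewrite Rank_ord1 cast_ordKV.
  rewrite (@discs_comp_Rank 1 (fun=> n)) /disc_comp /= mul1r scale1r addr0.
  by rewrite -surjective_pairing.
- move=> k c; apply: inf_discsP => i; rewrite discs_ecast.
  have -> : cast_ord (esym (sum_ones k)) i = tagnat.Rank (p_ := fun=> 1%N) i ord0.
    by apply: (@cast_ord_inj _ _ (sum_ones k)); rewrite Rank_ones cast_ordKV.
  rewrite (@discs_comp_Rank k (fun=> 1%N)) /disc_comp /= mulr1 scaler0 add0r.
  by rewrite -surjective_pairing.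
- move=> k n m c d e; apply: inf_discsP => z; rewrite discs_ecast.
  pose M (x : 'I_(\sum_i n i)) := m (tagnat.sig1 x) (tagnat.sig2 x).
  have [x [j ->]] : exists x (j : 'I_(M x)),
      z = cast_ord (sum_sum m) (tagnat.Rank x j).
    exists (tagnat.sig1 (cast_ord (esym (sum_sum m)) z)).
    exists (tagnat.sig2 (cast_ord (esym (sum_sum m)) z)).
    by rewrite tagnat.sig2K cast_ordKV.
  rewrite cast_ordK discs_comp_Rank Rank_Rank.
  rewrite (discs_comp_Rank _ (fun i => discs_comp (d i) (e i))) discs_comp_Rank.
  by rewrite -disc_compA.
- move=> k n s c d; apply: inf_discsP => z; rewrite discs_ecast /=.
  have [i [j zE]] : exists i (j : 'I_(n (s i))),
      z = cast_ord (sum_perm s n) (tagnat.Rank (p_ := n \o s) i j).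
    exists (tagnat.sig1 (cast_ord (esym (sum_perm s n)) z)).
    exists (tagnat.sig2 (cast_ord (esym (sum_perm s n)) z)).
    by rewrite tagnat.sig2K cast_ordKV.
  rewrite {}zE cast_ordK /discs_act_fun /= block_permE.
  transitivity (disc_comp (c (s i)) (d (s i) j)).
    apply: etrans (@discs_comp_Rank k (n \o s) _ (fun i => d (s i)) i j) _.
    by rewrite /= /discs_act_fun /disc_comp /= rho1.
  by rewrite rho1 -(@discs_comp_Rank k n c d (s i) j).
- move=> k n t c d; apply: inf_discsP => z.
  rewrite -[z]tagnat.sig2K; move: (tagnat.sig1 z) (tagnat.sig2 z) => i j.
  rewrite (discs_comp_Rank _ (fun i => discs_act (1%g, t i) (d i))).
  transitivity (disc_comp (c i) (d i (t i j))).
    by rewrite /= /discs_act_fun /disc_comp /= rho1.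
  rewrite /= /discs_act_fun rho1 dsum_permE.
  by rewrite -(@discs_comp_Rank k n c d i (t i j)).
Qed.

End LittleDiscsOperad.

(** * Polynomial functional calculus for positive semidefinite matrices *)

Section FunctionalCalculus.
Import complex.

Lemma poly_interpolation (F : fieldType) (s : seq F) (f : F -> F) :
  exists p : {poly F}, forall d, d \in s -> p.[d] = f d.
Proof.
elim: s => [|a s [p hp]]; first by exists 0.
have [as_|as_] := boolP (a \in s).
  by exists p => d; rewrite inE => /predU1P[->|]; exact: hp.
pose w := \prod_(b <- s) ('X - b%:P).
have w0 d : d \in s -> w.[d] = 0 by rewrite -root_prod_XsubC => /rootP.
have wa : w.[a] != 0 by rewrite -rootE root_prod_XsubC.
exists (p + ((f a - p.[a]) / w.[a])%:P * w) => d; rewrite inE.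
rewrite hornerD hornerM hornerC => /predU1P[->|].
  by rewrite divfK// addrC subrK.
by move=> ds; rewrite (w0 d)// mulr0 addr0 hp.
Qed.

Context (R : realType).

(** The list [s] is the spectrum. Over the complex numbers [M] is normal, hence diagonalisable, with
    real eigenvalues, so a polynomial vanishing on them kills it. *)
Lemma symmetric_annihilator n (M : 'M[R]_n.+1) :
  M^T = M -> (forall u : 'rV_n.+1, 0 <= (u *m M *m u^T) 0 0) ->
  exists s : seq R, (forall d, d \in s -> 0 <= d) /\
    forall p : {poly R}, (forall d, d \in s -> p.[d] = 0) -> horner_mx M p = 0.
Proof.
move=> symM psdM; pose toC : {rmorphism R -> R[i]} := real_complex R.
pose Mc := map_mx toC M; pose P := spectralmx Mc; pose D := spectral_diag Mc.
have hMc : Mc \is hermsymmx.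
  apply: realsym_hermsym.
    apply/is_hermitianmxP; rewrite expr0 scale1r; apply/matrixP => i j.
    by rewrite !mxE -[in LHS]symM mxE.
  by apply/mxOverP => i j; rewrite mxE; apply/complex_realP; exists (M i j).
have uP : P \in unitmx by exact: spectral_unit.
have ME : Mc = invmx P *m diag_mx D *m P.
  by apply/orthomx_spectralP; exact: hermitian_normalmx.
have DE j : D 0 j = toC (complex.Re (D 0 j)).
  have /mxOverP/(_ 0 j) := hermitian_spectral_diag_real hMc.
  by move=> /RRe_real.
pose d j := complex.Re (D 0 j).
have PM : P *m Mc = diag_mx D *m P by rewrite ME !mulmxA mulmxV// mul1mx.
exists [seq d j | j : 'I_n.+1]; split.
  move=> _ /mapP[j _ ->].
  (* A real eigenvalue of the complexification is a root of the real characteristic polynomial; this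
     yields a real eigenvector, against which positivity is tested. *)
  have : eigenvalue Mc (toC (d j)).
    apply/eigenvalueP; exists (row j P).
      by rewrite -row_mul PM row_mul row_diag_mx -scalemxAl -rowE -DE.
    apply/eqP => rj; have := congr1 (mulmx^~ (invmx P)) rj.
    rewrite mul0mx -row_mul mulmxV// => /rowP/(_ j); rewrite !mxE eqxx => /eqP.
    by rewrite oner_eq0.
  rewrite eigenvalue_root_char -map_char_poly fmorph_root.
  rewrite -eigenvalue_root_char => /eigenvalueP[v vM v0].
  have := psdM v; rewrite vM -scalemxAl mxE.
  suff v1 : 0 < (v *m v^T) 0 0 by rewrite pmulr_lge0.
  rewrite mxE lt_neqAle sumr_ge0 ?andbT; last first.
    by move=> k _; rewrite mxE -expr2 sqr_ge0.
  rewrite eq_sym; apply: contra v0; rewrite psumr_eq0 => [/allP h|k _].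
    apply/eqP/rowP => k; have := h k (mem_index_enum k).
    by rewrite !mxE -expr2 sqrf_eq0 => /eqP.
  by rewrite mxE -expr2 sqr_ge0.
move=> p hp; apply: (@map_mx_inj _ _ toC); rewrite map_mx0 map_horner_mx -/Mc.
have -> : horner_mx Mc (map_poly toC p) =
    invmx P *m horner_mx (diag_mx D) (map_poly toC p) *m P.
  by rewrite {1}ME; exact: horner_mx_uconjC.
rewrite horner_mx_diag (_ : map_mx _ D = 0) ?linear0 ?mulmx0 ?mul0mx//.
apply/rowP => j; rewrite !mxE DE horner_map.
by rewrite hp ?rmorph0//; apply/mapP; exists j; rewrite ?mem_enum.
Qed.

(** The three polynomials interpolate the square root, its inverse and the indicator of 0 on the
    spectrum. The convention that 0 has inverse 0 gives the pseudo-inverse. Each identity is one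
    between polynomials in [M], so it suffices on the spectrum, and whatever commutes with [M]
    commutes with them. *)
Lemma gram_calculus n (M : 'M[R]_n) :
  M^T = M -> (forall u : 'rV_n, 0 <= (u *m M *m u^T) 0 0) ->
  exists B C E : 'M[R]_n,
    [/\ C *m M *m C^T + E *m E^T = 1%:M, B *m E = 0, (1%:M - B *m C) *m M = 0
      & forall X, comm_mx X M -> comm_mx X C /\ comm_mx X E].
Proof.
case: n M => [|n] M symM psdM.
  exists 0, 0, 0; split; try by apply/matrixP => -[].
  by move=> X _; split; exact: comm_mx0.
have [s [s0 hs]] := symmetric_annihilator symM psdM.
have hornerT p : (horner_mx M p)^T = horner_mx M p.
  elim/poly_ind: p => [|p a IH]; first by rewrite rmorph0 trmx0.
  rewrite rmorphD rmorphM /= horner_mx_X horner_mx_C linearD /= tr_scalar_mx.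
  by rewrite trmx_mul IH symM; congr (_ + _); apply/esym/comm_horner_mx.
have [b hb] := poly_interpolation s Num.sqrt.
have [c hc] := poly_interpolation s (fun d => (Num.sqrt d)^-1).
have [e he] := poly_interpolation s (fun d => (d == 0)%:R).
exists (horner_mx M b), (horner_mx M c), (horner_mx M e); rewrite !hornerT; split.
- apply/eqP; rewrite -subr_eq0; apply/eqP.
  rewrite -[_ + _ - _](_ : horner_mx M (c * 'X * c + e * e - 1) = _); last first.
    by rewrite rmorphB rmorphD !rmorphM /= horner_mx_X rmorph1.
  apply: hs => d ds; rewrite !hornerE hc// he//.
  have := s0 d ds; rewrite le_eqVlt => /predU1P[<-|d0].
    by rewrite eqxx sqrtr0 invr0 !mul0r add0r mulr1 subrr.
  rewrite gt_eqF// mulr0 addr0 mulrAC -invfM -expr2 sqr_sqrtr ?ltW//.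
  by rewrite mulVf ?subrr// gt_eqF.
- rewrite -[_ *m _](_ : horner_mx M (b * e) = _); last by rewrite rmorphM.
  apply: hs => d ds; rewrite hornerM hb// he//.
  by case: eqVneq => [->|_]; rewrite ?sqrtr0 ?mul0r ?mulr0.
- rewrite -[_ *m _](_ : horner_mx M ((1 - b * c) * 'X) = _); last first.
    by rewrite rmorphM rmorphB rmorphM /= horner_mx_X rmorph1.
  apply: hs => d ds; rewrite !hornerE hb// hc//.
  have := s0 d ds; rewrite le_eqVlt => /predU1P[<-|d0]; first by rewrite mulr0.
  by rewrite mulfV ?subrr ?mul0r// sqrtr_eq0 -ltNge.
- by move=> X XM; split; exact: comm_mx_horner.
Qed.

End FunctionalCalculus.

(** * Equivariant orthonormalisation by free orbits *)

Section EquivariantBasis.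
Context (R : realType) (gT : finGroupType) (U : orthrep R gT).
Variables (N : {group gT}) (nN : (N <| [set: gT]%G)%g).
Hypothesis rhoN : forall g, g \in N -> forall v : U, rho g v = v.
Notation Q := (coset_of N).

(** As [N] acts trivially, the choice of the representative does not matter ([rho_qact]). *)
Definition qact (q : Q) (v : U) : U := rho (repr q) v.

Lemma in_norm g : g \in ('N(N))%g.
Proof. by apply: (fintype.subsetP (normal_norm nN)); rewrite inE. Qed.

Lemma rho_qact g v : rho g v = qact (coset N g) v.
Proof.
have /rcosetP[n nN' E] : g \in (N :* repr (coset N g))%g.
  apply/rcoset_kercosetP; [exact: in_norm|exact: in_norm|].
  by rewrite coset_reprK.
by rewrite {1}E rhoM rhoN.
Qed.

Lemma qact_linear q : linear (qact q).
Proof. exact: rho_linear. Qed.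

Lemma qact1 v : qact 1%g v = v.
Proof. by rewrite -(morph1 (coset_morphism N)) -rho_qact rho1. Qed.

Lemma qactM p q v : qact (p * q)%g v = qact p (qact q v).
Proof.
transitivity (rho (repr p * repr q)%g v); last by rewrite rhoM.
by rewrite rho_qact morphM ?in_norm//= !coset_reprK.
Qed.

Lemma rho_qactE g q v : rho g (qact q v) = qact (coset N g * q)%g v.
Proof. by rewrite rho_qact qactM. Qed.

Lemma ip_qact q v w : ip (qact q v) (qact q w) = ip v w.
Proof. exact: ip_rho. Qed.

Lemma ip_qactl q v w : ip (qact q v) w = ip v (qact q^-1%g w).
Proof. by rewrite -(ip_qact q^-1%g (qact q v)) -qactM mulVg qact1. Qed.

Lemma ip_qact2 p q v w : ip (qact p v) (qact q w) = ip v (qact (p^-1 * q)%g w).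
Proof. by rewrite ip_qactl -qactM. Qed.

Lemma sum_enum (V : nmodType) (F : Q -> V) :
  \sum_q F q = \sum_(i < #|{: Q}|) F (enum_val i).
Proof.
by rewrite (reindex (@enum_val Q predT)) //; apply/onW_bij/enum_val_bij.
Qed.

Definition orbit_free (v : U) : Prop :=
  forall a : Q -> R, \sum_q a q *: qact q v = 0 -> forall q, a q = 0.

(* With M the Gram matrix of the orbit of v, the matrices B, C and E are
   polynomials in M: its square root, the pseudo-inverse of this square root, and
   the projection onto the kernel of M. *)
Lemma orbit_gram v : exists B C E : Q -> Q -> R,
  [/\ forall p p', \sum_q \sum_q' C p q * C p' q' * ip (qact q v) (qact q' v) +
        \sum_q E p q * E p' q = (p == p')%:R,
      forall p p', \sum_q B p q * E q p' = 0,
      forall p, qact p v = \sum_r B p r *: \sum_q C r q *: qact q v,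
      forall g p q, C (g * p)%g (g * q)%g = C p q /\ E (g * p)%g (g * q)%g = E p q
    & orbit_free v -> forall p q, E p q = 0].
Proof.
pose n := #|{: Q}|; pose M : 'M[R]_n :=
  \matrix_(i, j) ip (qact (enum_val i) v) (qact (enum_val j) v).
pose comb (u : 'rV[R]_n) := \sum_i u 0 i *: qact (enum_val i) v.
have combE (u w : 'rV[R]_n) : (u *m M *m w^T) 0 0 = ip (comb u) (comb w).
  rewrite /comb ip_suml mxE; under [RHS]eq_bigr do rewrite ip_sumr.
  rewrite exchange_big; apply: eq_bigr => j _ /=.
  rewrite !mxE mulr_suml; apply: eq_bigr => i _.
  by rewrite mxE ipZl ipZr mulrA -!mulrA; congr (_ * _); rewrite mulrC.
have symM : M^T = M by apply/matrixP => i j; rewrite !mxE ip_sym.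
have psdM (u : 'rV[R]_n) : 0 <= (u *m M *m u^T) 0 0 by rewrite combE ip_ge0.
have [B [C [E [h1 h2 h3 h4]]]] := gram_calculus symM psdM.
pose rk := @enum_rank Q.
exists (fun p q => B (rk p) (rk q)), (fun p q => C (rk p) (rk q)),
  (fun p q => E (rk p) (rk q)).
(* The rows of 1 - BC annihilate the Gram matrix, so the combinations they define have norm 0. *)
have K0 i : comb (row i (1%:M - B *m C)) = 0.
  by apply: ip_eq0; rewrite -combE -row_mul h3 row0 mul0mx mxE.
split.
- move=> p p'; have /matrixP/(_ (rk p) (rk p')) := h1; rewrite !mxE.
  rewrite (inj_eq enum_rank_inj) => <-; congr (_ + _); last first.
    by rewrite sum_enum; apply: eq_bigr => i _; rewrite mxE /rk !enum_valK.
  rewrite sum_enum /=; under eq_bigr do rewrite sum_enum /=.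
  rewrite exchange_big; apply: eq_bigr => j _ /=.
  rewrite !mxE mulr_suml; apply: eq_bigr => i _.
  by rewrite !mxE /rk !enum_valK mulrAC.
- move=> p p'; have /matrixP/(_ (rk p) (rk p')) := h2; rewrite !mxE; apply: etrans.
  by rewrite sum_enum; apply: eq_bigr => i _; rewrite /rk !enum_valK.
- move=> p; have := K0 (rk p); rewrite /comb.
  have -> : \sum_i (row (rk p) (1%:M - B *m C)) 0 i *: qact (enum_val i) v =
      qact p v - \sum_r B (rk p) (rk r) *: \sum_q C (rk r) (rk q) *: qact q v.
    transitivity (\sum_i ((1%:M : 'M[R]_n) (rk p) i *: qact (enum_val i) v -
        (B *m C) (rk p) i *: qact (enum_val i) v)).
      by apply: eq_bigr => i _; rewrite !mxE scalerBl.
    rewrite sumrB; congr (_ - _).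
      rewrite (bigD1 (rk p))//= mxE eqxx scale1r enum_rankK big1 ?addr0// => i.
      by rewrite eq_sym mxE => /negPf ->; rewrite scale0r.
    rewrite [RHS]sum_enum; under [LHS]eq_bigr do rewrite mxE scaler_suml.
    rewrite exchange_big; apply: eq_bigr => r _ /=.
    rewrite sum_enum scaler_sumr; apply: eq_bigr => i _.
    by rewrite /rk !enum_valK scalerA.
  by move/eqP; rewrite subr_eq0 => /eqP.
- move=> g.
  (* The permutation matrix of left translation by [g]. It commutes with the Gram matrix by
     invariance of the inner product, hence with [C] and [E]. *)
  pose X : 'M[R]_n := \matrix_(i, j) (enum_val j == g * enum_val i)%g%:R.
  have Xl (A : 'M[R]_n) i j : (X *m A) i j = A (rk (g * enum_val i)%g) j.
    rewrite mxE (bigD1 (rk (g * enum_val i)%g))//= mxE enum_rankK eqxx mul1r.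
    rewrite big1 ?addr0// => k kn; rewrite mxE; case: eqP => [e|]; last by rewrite mul0r.
    by case/eqP: kn; rewrite -e /rk enum_valK.
  have Xr (A : 'M[R]_n) i j : (A *m X) i (rk (g * enum_val j)%g) = A i j.
    rewrite mxE (bigD1 j)//= mxE enum_rankK eqxx mulr1.
    rewrite big1 ?addr0// => k kn; rewrite mxE enum_rankK.
    case: eqP => [/mulgI/enum_val_inj e|]; last by rewrite mulr0.
    by case/eqP: kn.
  have XM : comm_mx X M.
    apply/matrixP => i j.
    have -> : j = rk (g * enum_val (rk (g^-1 * enum_val j)%g))%g.
      by rewrite /rk enum_rankK mulKVg enum_valK.
    by rewrite Xl Xr !mxE !enum_rankK !ip_qact2 !invMg !mulgA mulgKV.
  have inv (A : 'M[R]_n) : comm_mx X A -> forall p q,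
      A (rk (g * p)%g) (rk (g * q)%g) = A (rk p) (rk q).
    move=> XA p q; have /matrixP/(_ (rk p) (rk (g * enum_val (rk q))%g)) := XA.
    by rewrite Xl Xr /rk !enum_rankK.
  by have [XC XE] := h4 X XM; move=> p q; split; exact: inv.
- move=> fv.
  (* Freeness turns [K0] into a statement about coefficients. Then [C] is inverse to [B], and BE = 0
     forces E = 0. *)
  have BC : B *m C = 1%:M.
    apply/esym/eqP; rewrite -subr_eq0; apply/eqP/row_matrixP => i.
    apply/rowP => j; rewrite row0 [RHS]mxE.
    have := fv (fun q => row i (1%:M - B *m C) 0 (rk q)) _ (enum_val j).
    rewrite /rk enum_valK; apply; rewrite sum_enum -[RHS](K0 i).
    by apply: eq_bigr => k _; rewrite enum_valK.
  have : E = 0 by rewrite -[E]mul1mx -(mulmx1C BC) -mulmxA h2 mulmx0.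
  by move=> -> p q; rewrite mxE.
Qed.

(** The new vector is a combination, by [C], of the orbit of [v] and, by [E], of the orbit of [x]:
    the first part orthonormalises the orbit of [v] as far as it is independent, the second fills
    the dimensions it lacks. If the orbit of [v] is free, the second part vanishes and [x] may be
    0. *)
Lemma orbit_combine (v x : U) :
  (forall q, ip (qact q v) x = 0) ->
  (forall p q, ip (qact p x) (qact q x) = (p == q)%:R) \/ orbit_free v ->
  exists y, [/\ forall p q, ip (qact p y) (qact q y) = (p == q)%:R,
    exists b : Q -> R, v = \sum_q b q *: qact q y
    & forall w, (forall q, ip (qact q v) w = 0 /\ ip (qact q x) w = 0) ->
        forall p, ip (qact p y) w = 0].
Proof.
move=> vx hx; have [B [C [E [h1 h2 h3 h4 h5]]]] := orbit_gram v.
have vx' p q : ip (qact p v) (qact q x) = 0.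
  by rewrite ip_sym ip_qactl ip_sym -qactM vx.
have xE p q p' q' : E p q * E p' q' * ip (qact q x) (qact q' x) =
    E p q * E p' q' * (q == q')%:R.
  case: hx => [->//|fv]; by rewrite h5// !mul0r.
pose y p := \sum_q C p q *: qact q v + \sum_q E p q *: qact q x.
(* Invariance of [C] and [E] under left translation makes the vectors [y p] a single orbit. *)
have yE p : qact p (y 1%g) = y p.
  rewrite /y (linD (qact_linear p)) !(lin_sum (qact_linear p)).
  congr (_ + _); rewrite [RHS](reindex_inj (mulgI p)); apply: eq_bigr => q _ /=.
    by rewrite (linZ (qact_linear p)) -qactM -(h4 p 1%g q).1 mulg1.
  by rewrite (linZ (qact_linear p)) -qactM -(h4 p 1%g q).2 mulg1.
have ip_sums (F G : Q -> R) w z : ip (\sum_q F q *: qact q w) (\sum_q G q *: qact q z) =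
    \sum_q \sum_q' F q * G q' * ip (qact q w) (qact q' z).
  rewrite ip_suml; apply: eq_bigr => q _; rewrite ip_sumr.
  by apply: eq_bigr => q' _; rewrite ipZl ipZr mulrA.
have cross p p' : ip (\sum_q C p q *: qact q v) (\sum_q E p' q *: qact q x) = 0.
  by rewrite ip_sums big1// => q _; rewrite big1// => q' _; rewrite vx' mulr0.
exists (y 1%g); split.
- move=> p p'; rewrite !yE /y ipDl !ipDr cross addr0.
  rewrite [ip (\sum_q E p q *: _) (\sum_q C p' q *: _)]ip_sym cross add0r -h1 !ip_sums.
  congr (_ + _); apply: eq_bigr => q _.
  under eq_bigr do rewrite xE.
  rewrite (bigD1 q)//= eqxx mulr1 big1 ?addr0// => q' q'q.
  by rewrite eq_sym (negPf q'q) mulr0.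
- exists (B 1%g); rewrite -[LHS]qact1 h3.
  transitivity (\sum_r B 1%g r *: y r); last by apply: eq_bigr => r _; rewrite yE.
  rewrite /y; under [RHS]eq_bigr do rewrite scalerDr.
  (* The contribution of [x] drops out because BE = 0. *)
  rewrite big_split /= [X in _ = _ + X](_ : _ = 0) ?addr0//.
  under eq_bigr do rewrite scaler_sumr.
  rewrite exchange_big big1// => q _ /=.
  by under eq_bigr do rewrite scalerA; rewrite -scaler_suml h2 scale0r.
- move=> w hw p; rewrite yE /y ipDl !ip_suml !big1 ?addr0// => q _.
    by rewrite ipZl (hw q).2 mulr0.
  by rewrite ipZl (hw q).1 mulr0.
Qed.

Definition orthonormal_orbits (s : seq U) : Prop :=
  forall i j, (i < size s)%N -> (j < size s)%N -> forall p q,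
    ip (qact p s`_i) (qact q s`_j) = ((i == j) && (p == q))%:R.

Definition orbit_proj (s : seq U) (v : U) : U :=
  \sum_(i < size s) \sum_q ip v (qact q s`_i) *: qact q s`_i.

Lemma orbit_proj_span s (a : 'I_(size s) -> Q -> R) v : orthonormal_orbits s ->
  v = \sum_i \sum_q a i q *: qact q s`_i -> orbit_proj s v = v.
Proof.
move=> os ->; apply: eq_bigr => i _; apply: eq_bigr => q _; congr (_ *: _).
rewrite ip_suml (bigD1 i)//= ip_suml (bigD1 q)//= ipZl os// !eqxx mulr1.
rewrite !big1 ?addr0// => [j ji|p pq].
  rewrite ip_suml big1// => p _; rewrite ipZl os//.
  by rewrite val_eqE (negPf ji) mulr0.
by rewrite ipZl os// eqxx (negPf pq) mulr0.
Qed.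

Lemma orbit_proj_orth s v i q : orthonormal_orbits s -> (i < size s)%N ->
  ip (qact q (v - orbit_proj s v)) s`_i = 0.
Proof.
move=> os si; rewrite ip_qactl ipBl /orbit_proj ip_suml.
rewrite (bigD1 (Ordinal si))//= ip_suml (bigD1 q^-1%g)//= ipZl os// !eqxx mulr1.
rewrite big1 ?addr0 => [|p pq].
  rewrite big1 ?addr0 ?subrr// => j ji; rewrite ip_suml big1// => p _.
  by rewrite ipZl os// -[i]/(val (Ordinal si)) val_eqE (negPf ji) mulr0.
by rewrite ipZl os// eqxx (negPf pq) mulr0.
Qed.

(** Both directions of the theorem supply this: one from the model R[G/N]^oo, the other from a fixed
    isometry. *)
Hypothesis free_orbits : forall m, exists X : 'I_m -> U, forall a : 'I_m -> Q -> R,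
  \sum_i \sum_q a i q *: qact q (X i) = 0 -> forall i q, a i q = 0.

(** Orthogonality to [s'] imposes [size s'] linear conditions, so among one more independent free
    orbits a non-zero combination satisfies them. Its orbit is still free: each product
    [a q * c 0 i] vanishes, and some [c 0 i] is not 0. *)
Lemma free_orbit_orth (s : seq U) : exists x, orbit_free x /\
  forall w, w \in s -> forall q, ip (qact q w) x = 0.
Proof.
pose s' := [seq qact q w | w <- s, q <- enum {: Q}].
have [X hX] := free_orbits (size s').+1.
pose A : 'M[R]_((size s').+1, size s') := \matrix_(i, j) ip (X i) s'`_j.
have kA : kermx A != 0.
  rewrite -mxrank_eq0 mxrank_ker subn_eq0 -ltnNge ltnS; exact: rank_leq_col.
have /rowV0Pn[c /sub_kermxP cA c0] := kA.
exists (\sum_i c 0 i *: X i); split=> [a ha q|w ws q].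
  have [i ci] : exists i, c 0 i != 0.
    apply/existsP; apply: contraNT c0 => /existsPn h.
    by apply/eqP/rowP => i; rewrite mxE; have := h i; rewrite negbK => /eqP.
  have := hX (fun i q => a q * c 0 i) _ i q.
  move=> /(_ _)/eqP; rewrite mulf_eq0 (negPf ci) orbF => h; apply/eqP/h.
  rewrite exchange_big -[RHS]ha; apply: eq_bigr => p _ /=.
  rewrite (lin_sum (qact_linear p)) scaler_sumr; apply: eq_bigr => j _.
  by rewrite (linZ (qact_linear p)) scalerA.
have ss : qact q w \in s' by apply/allpairsP; exists (w, q); rewrite mem_enum.
have is' : (index (qact q w) s' < size s')%N by rewrite index_mem.
have := congr1 (fun B : 'rV_(size s') => B 0 (Ordinal is')) cA.
rewrite !mxE => <-; rewrite ip_sumr; apply: eq_bigr => i _.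
by rewrite ipZr !mxE /= nth_index// ip_sym.
Qed.

(** The new orbit absorbs the remainder [b] of [v]. Since [b] may be 0 or have a dependent orbit, it
    is combined with an orthonormal orbit orthogonal to [b] and to [s]. *)
Lemma orthonormal_orbits_extend s v : orthonormal_orbits s -> exists y,
  orthonormal_orbits (rcons s y) /\ orbit_proj (rcons s y) v = v.
Proof.
move=> os; pose b := v - orbit_proj s v.
have [x0 [fx0 ox0]] := free_orbit_orth (b :: s).
(* With auxiliary vector 0 this is the symmetric orthonormalisation of a free orbit. *)
have [|x [ox _ hx]] := @orbit_combine x0 0 _ (or_intror fx0).
  by move=> q; rewrite ip0r.
have ortho w : w \in b :: s -> forall q, ip (qact q w) x = 0.
  move=> ws q; rewrite ip_sym -[x]qact1; apply: hx => p.
  by rewrite (lin0 (qact_linear p)) ip0l ip_qactl -qactM ip_sym ox0.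
have [q|y [oy [a ba] hy]] := @orbit_combine b x _ (or_introl ox).
  by apply: ortho; rewrite mem_head.
have ys i p : (i < size s)%N -> ip (qact p y) s`_i = 0.
  move=> si; apply: hy => q; split; first exact: orbit_proj_orth.
  by rewrite ip_qactl ip_sym ortho// inE mem_nth// orbT.
have os' : orthonormal_orbits (rcons s y).
  move=> i j; rewrite size_rcons !ltnS => si sj p q; rewrite !nth_rcons.
  move: si sj; rewrite leq_eqVlt => /predU1P[->|si]; rewrite leq_eqVlt => /predU1P[->|sj].
  - by rewrite ltnn eqxx oy.
  - by rewrite ltnn eqxx sj ip_qact2 ip_sym ip_qactl ip_sym -?qactM ys// gtn_eqF.
  - by rewrite ltnn eqxx si ip_sym ip_qact2 ip_sym ip_qactl ip_sym -?qactM ys// ltn_eqF.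
  - by rewrite si sj os.
exists y; split=> //.
pose c i q := if (i < size s)%N then ip v (qact q s`_i) else a q.
apply: (@orbit_proj_span _ (fun i q => c i q) _ os').
rewrite -[LHS](subrK (orbit_proj s v)) -/b addrC.
transitivity (\sum_(i < (size s).+1) \sum_q c i q *: qact q (rcons s y)`_i).
  rewrite big_ord_recr /=; congr (_ + _).
    apply: eq_bigr => i _; apply: eq_bigr => q _.
    by rewrite /c nth_rcons ltn_ord.
  by rewrite [LHS]ba; apply: eq_bigr => q _; rewrite /c nth_rcons ltnn eqxx.
by rewrite -(size_rcons s y).
Qed.

Definition equivariant_basis (e : Q -> nat -> U) : Prop :=
  [/\ forall p q i j, ip (e p i) (e q j) = ((i == j) && (p == q))%:R,
      forall g q k, rho g (e q k) = e (coset N g * q)%g k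
    & forall v, exists m, v = \sum_(i < m) \sum_q ip v (e q i) *: e q i].

(** Step k adds an orbit such that [b k] lies in the span of the orbits chosen up to then, so that
    the orbits together span [U]. *)
Lemma equivariant_basis_exists (b : nat -> U) :
  is_countable_basis b -> exists e, equivariant_basis e.
Proof.
move=> [_ bs].
have /choice[f hf] : forall sv : seq U * U, exists y, orthonormal_orbits sv.1 ->
    orthonormal_orbits (rcons sv.1 y) /\ orbit_proj (rcons sv.1 y) sv.2 = sv.2.
  move=> [s v]; have [os|nos] := pselect (orthonormal_orbits s); last by exists 0.
  by have [y hy] := orthonormal_orbits_extend v os; exists y.
pose S := fix S k := if k is k.+1 then rcons (S k) (f (S k, b k)) else [::].
have SS k : S k.+1 = rcons (S k) (f (S k, b k)) by [].
have sS k : size (S k) = k by elim: k => // k IH; rewrite SS size_rcons IH.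
have oS k : orthonormal_orbits (S k).
  by elim: k => [|k IH]; [by []|rewrite SS; have [] := hf (S k, b k) IH].
pose y k := (S k.+1)`_k.
have Sy k m : (m < k)%N -> (S k)`_m = y m.
  elim: k => // k IH; rewrite ltnS leq_eqVlt => /predU1P[->//|mk].
  by rewrite SS nth_rcons sS mk IH.
pose e q k := qact q (y k).
have oe p q i j : ip (e p i) (e q j) = ((i == j) && (p == q))%:R.
  have := oS (maxn i j).+1 i j; rewrite sS !ltnS leq_maxl leq_maxr => h.
  by rewrite /e -!(Sy (maxn i j).+1) ?ltnS ?leq_maxl ?leq_maxr//; exact: h.
pose P m v := \sum_(i < m) \sum_q ip v (e q i) *: e q i.
have PE m v : orbit_proj (S m) v = P m v.
  rewrite /orbit_proj /P sS; apply: eq_bigr => i _; apply: eq_bigr => q _.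
  by rewrite Sy.
have Pmono m p v : (m <= p)%N -> P m v = v -> P p v = v.
  move=> mp Pv; elim: p mp => [|p IH]; first by rewrite leqn0 => /eqP <-.
  rewrite leq_eqVlt => /predU1P[<-//|]; rewrite ltnS => mp.
  rewrite /P big_ord_recr /= -/(P p v) IH// [X in _ + X]big1 ?addr0// => q _.
  rewrite -[v in ip v _]Pv ip_suml big1 ?scale0r// => i _.
  rewrite ip_suml big1// => q' _; rewrite ipZl oe.
  by rewrite ltn_eqF ?mulr0// (leq_trans (ltn_ord i)).
have Plin m a v w : P m v = v -> P m w = w -> P m (a *: v + w) = a *: v + w.
  move=> Pv Pw; rewrite -{2}Pv -{2}Pw /P scaler_sumr -big_split /=.
  apply: eq_bigr => i _; rewrite scaler_sumr -big_split /=; apply: eq_bigr => q _.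
  by rewrite ipDl ipZl scalerDl scalerA.
exists e; split=> // [g q k|v]; first by rewrite /e rho_qactE.
have [m [c ->]] := bs v; exists m; apply/esym; rewrite -/(P m _).
apply: (big_ind (fun v => P m v = v)) => [|x z Px Pz|i _].
- by rewrite /P big1// => i _; rewrite big1// => q _; rewrite ip0l scale0r.
- by have := Plin m 1 _ _ Px Pz; rewrite scale1r.
- have Pb : P m (b i) = b i.
    apply: (@Pmono i.+1) => //; rewrite -PE SS.
    by have [_] := hf (S i, b i) (oS i).
  have P0 : P m 0 = 0.
    by rewrite /P big1// => j _; rewrite big1// => q _; rewrite ip0l scale0r.
  by have := Plin m (c i) _ _ Pb P0; rewrite addr0.
Qed.

End EquivariantBasis.

Lemma nat2_bijection : exists code : nat * nat -> nat, bijective code.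
Proof.
have /card_set_bijP[f fb] := card_nat2.
by exists f; rewrite -setTT_bijective.
Qed.

(** * Linear extension from an equivariant basis *)

Section BasisExtension.
Context (R : realType) (gT : finGroupType) (U : orthrep R gT).
Variables (N : {group gT}) (e : coset_of N -> nat -> U).
Notation Q := (coset_of N).
Hypothesis eB : equivariant_basis e.

Lemma basis_ip p q i j : ip (e p i) (e q j) = ((i == j) && (p == q))%:R.
Proof. by case: eB. Qed.

Lemma rho_basis g q k : rho g (e q k) = e (coset N g * q)%g k.
Proof. by case: eB. Qed.

Lemma basis_supp u : exists m, forall i, (m <= i)%N -> forall q, ip u (e q i) = 0.
Proof.
have [_ _ /(_ u)[m ->]] := eB; exists m => i mi q.
rewrite ip_suml big1// => j _; rewrite ip_suml big1// => p _.
by rewrite ipZl basis_ip ltn_eqF ?mulr0// (leq_trans _ mi).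
Qed.

Definition supp_bound u : nat := projT1 (cid (basis_supp u)).

Lemma supp_boundP u i q : (supp_bound u <= i)%N -> ip u (e q i) = 0.
Proof. by move=> h; apply: (projT2 (cid (basis_supp u))). Qed.

Section Extension.
Variable F : lmodType R.

Definition ext (x : Q -> nat -> F) (u : U) : F :=
  \sum_(i < supp_bound u) \sum_q ip u (e q i) *: x q i.

Lemma sum_supp (x : Q -> nat -> F) u m p :
  (forall i, (m <= i)%N -> forall q, ip u (e q i) = 0) -> (m <= p)%N ->
  \sum_(i < p) \sum_q ip u (e q i) *: x q i =
  \sum_(i < m) \sum_q ip u (e q i) *: x q i.
Proof.
move=> hm; elim: p => [|p IH]; first by rewrite leqn0 => /eqP ->.
rewrite leq_eqVlt => /predU1P[->//|]; rewrite ltnS => mp.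
rewrite big_ord_recr /= IH// [X in _ + X]big1 ?addr0// => q _.
by rewrite hm// scale0r.
Qed.

Lemma extE (x : Q -> nat -> F) u m :
  (forall i, (m <= i)%N -> forall q, ip u (e q i) = 0) ->
  ext x u = \sum_(i < m) \sum_q ip u (e q i) *: x q i.
Proof.
move=> hm; have hs i : (supp_bound u <= i)%N -> forall q, ip u (e q i) = 0.
  by move=> h q; exact: supp_boundP.
by rewrite /ext -(sum_supp x hs (leq_maxl _ m)) (sum_supp x hm (leq_maxr _ m)).
Qed.

Lemma ext_linear x : linear (ext x).
Proof.
move=> a u v; pose m := maxn (supp_bound u) (supp_bound v).
have hu i : (m <= i)%N -> forall q, ip u (e q i) = 0.
  by rewrite geq_max => /andP[h _] q; exact: supp_boundP.
have hv i : (m <= i)%N -> forall q, ip v (e q i) = 0.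
  by rewrite geq_max => /andP[_ h] q; exact: supp_boundP.
rewrite (extE x hu) (extE x hv) (@extE _ _ m) => [|i mi q].
  rewrite scaler_sumr -big_split /=; apply: eq_bigr => i _.
  rewrite scaler_sumr -big_split /=; apply: eq_bigr => q _.
  by rewrite ipDl ipZl scalerDl scalerA.
by rewrite ipDl ipZl hu// hv// mulr0 addr0.
Qed.

Lemma ext_basis x q k : ext x (e q k) = x q k.
Proof.
rewrite (@extE _ _ k.+1) => [|i ki p]; last by rewrite basis_ip ltn_eqF.
rewrite big_ord_recr /= big1 ?add0r => [|i _].
  rewrite (bigD1 q)//= basis_ip !eqxx scale1r big1 ?addr0// => p pq.
  by rewrite basis_ip eqxx eq_sym (negPf pq) scale0r.
by rewrite big1// => p _; rewrite basis_ip gtn_eqF ?scale0r.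
Qed.

End Extension.

Lemma basis_decomp u : u = \sum_(i < supp_bound u) \sum_q ip u (e q i) *: e q i.
Proof.
have [_ _ /(_ u)[m um]] := eB.
have hs i : (supp_bound u <= i)%N -> forall q, ip u (e q i) = 0.
  by move=> h q; exact: supp_boundP.
have hm i : (m <= i)%N -> forall q, ip u (e q i) = 0.
  move=> mi q; rewrite um ip_suml big1// => j _; rewrite ip_suml big1// => p _.
  by rewrite ipZl basis_ip ltn_eqF ?mulr0// (leq_trans _ mi).
rewrite {1}um -(sum_supp e hm (leq_maxl m (supp_bound u))).
by rewrite (sum_supp e hs (leq_maxr _ _)).
Qed.

Lemma linear_basis_eq (F : lmodType R) (f g : U -> F) : linear f -> linear g ->
  (forall q k, f (e q k) = g (e q k)) -> f =1 g.
Proof.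
move=> lf lg fg u; rewrite (basis_decomp u) (lin_sum lf) (lin_sum lg).
apply: eq_bigr => i _; rewrite (lin_sum lf) (lin_sum lg).
by apply: eq_bigr => q _; rewrite (linZ lf) (linZ lg) fg.
Qed.

(** The factor [a] is 1 for isometries and 0 for maps with orthogonal images. The coordinate formula
    for the left side also evaluates [ip u v], since [ext e] is the identity. *)
Lemma ext_ip (F : orthrep R gT) (x y : Q -> nat -> F) a u v :
  (forall p q i j, ip (x p i) (y q j) = a * ((i == j) && (p == q))%:R) ->
  ip (ext x u) (ext y v) = a * ip u v.
Proof.
move=> xy; pose m := maxn (supp_bound u) (supp_bound v).
have hu i : (m <= i)%N -> forall q, ip u (e q i) = 0.
  by rewrite geq_max => /andP[h _] q; exact: supp_boundP.
have hv i : (m <= i)%N -> forall q, ip v (e q i) = 0.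
  by rewrite geq_max => /andP[_ h] q; exact: supp_boundP.
have E (G : orthrep R gT) (z w : Q -> nat -> G) b :
    (forall p q i j, ip (z p i) (w q j) = b * ((i == j) && (p == q))%:R) ->
    ip (ext z u) (ext w v) = b * \sum_(i < m) \sum_q ip u (e q i) * ip v (e q i).
  move=> zw; rewrite (extE z hu) (extE w hv) ip_suml mulr_sumr.
  apply: eq_bigr => i _; rewrite ip_suml mulr_sumr; apply: eq_bigr => q _.
  rewrite ipZl ip_sumr (bigD1 i)//= ip_sumr (bigD1 q)//= ipZr zw !eqxx mulr1.
  rewrite !big1 ?addr0 => [|j ji|p pq].
  - by rewrite mulrA mulrC.
  - rewrite ip_sumr big1// => p _; rewrite ipZr zw.
    by rewrite val_eqE eq_sym (negPf ji) !mulr0.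
  - by rewrite ipZr zw eqxx eq_sym (negPf pq) !mulr0.
rewrite (E F x y a xy); congr (_ * _); rewrite -[RHS]mul1r.
have idE w : ext e w = w.
  by apply: (linear_basis_eq (ext_linear e) _) => // q k; rewrite ext_basis.
rewrite -[LHS]mul1r -(E U e e 1) ?idE// ?mul1r//.
by move=> p q i j; rewrite basis_ip mul1r.
Qed.

Lemma ext_rho (F : rep R gT) (x : Q -> nat -> F) g u :
  (forall q k, rho g (x q k) = x (coset N g * q)%g k) ->
  ext x (rho g u) = rho g (ext x u).
Proof.
move=> hx; apply: (@linear_basis_eq F (fun u => ext x (rho g u))
    (fun u => rho g (ext x u))) => [a v w|a v w|q k].
- by rewrite rho_linear ext_linear.
- by rewrite ext_linear rho_linear.
- by rewrite rho_basis !ext_basis hx.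
Qed.

Lemma fcont_ext (F : orthrep R gT) (K : topologicalType)
    (x : K -> Q -> nat -> F) u :
  (forall q i, fcont (fun k => x k q i)) -> fcont (fun k => ext (x k) u).
Proof.
move=> cx; apply: fcont_sum => i; apply: fcont_sum => q.
by apply: fcontZ => //; move=> k; exact: cvg_cst.
Qed.

End BasisExtension.

(** * The path of rotations from the identity to the shift *)

Section Rotation.
Context (R : realType) (gT : finGroupType) (U : orthrep R gT).
Variables (N : {group gT}) (e : coset_of N -> nat -> U).
Notation Q := (coset_of N).
Hypothesis eB : equivariant_basis e.
Variables (code : nat * nat -> nat) (decode : nat -> nat * nat).
Hypotheses (codeK : cancel code decode) (decodeK : cancel decode code).

Definition ebasis (q : Q) (a b : nat) : U := e q (code (a, b)).

Lemma ebasis_ip p q a b a' b' :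
  ip (ebasis p a b) (ebasis q a' b') = [&& a == a', b == b' & p == q]%:R.
Proof.
rewrite /ebasis (basis_ip eB) (inj_eq (can_inj codeK)) xpair_eqE.
by rewrite -andbA.
Qed.

Lemma rho_ebasis g q a b : rho g (ebasis q a b) = ebasis (coset N g * q)%g a b.
Proof. exact: rho_basis eB _ _ _. Qed.

Section Coefficients.
Variables c s : R.

(* The infinite product of the rotations by the angle of (c, s) in the planes
   spanned by the levels a and a + 1 takes level a to [rot q a b]; the auxiliary
   vector [rot_aux q a b] is its component left to be rotated. *)
Fixpoint rot_aux (q : Q) (a b : nat) : U :=
  if a is a'.+1 then (- s) *: rot_aux q a' b + c *: ebasis q a b
  else ebasis q 0 b.

Definition rot (q : Q) (a b : nat) : U :=
  c *: rot_aux q a b + s *: ebasis q a.+1 b.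

Lemma rot_aux_ip_basis p q a b a' b' :
  (a < a')%N || ((b, p) != (b', q)) -> ip (rot_aux p a b) (ebasis q a' b') = 0.
Proof.
rewrite xpair_eqE; elim: a => [|a IH] h /=; rewrite ?ipDl ?ipZl ?[ip (c *: _) _]ipZl ebasis_ip.
  by case: a' h => [|a'] //= /negPf ->.
rewrite IH ?mulr0 ?add0r; last first.
  by case/orP: h => [/ltnW ->//|->]; rewrite orbT.
by case/orP: h => [h|/negPf ->]; rewrite ?(ltn_eqF h) ?andbF mulr0.
Qed.

Lemma rot_aux_ip p q a b a' b' : (b, p) != (b', q) ->
  ip (rot_aux p a b) (rot_aux q a' b') = 0.
Proof.
move=> h; elim: a' => [|a' IH] /=; rewrite ?ipDr ?ipZr ?[ip _ (c *: _)]ipZr rot_aux_ip_basis ?h ?orbT//.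
by rewrite IH !mulr0 addr0.
Qed.

Lemma rho_rot g q a b : rho g (rot q a b) = rot (coset N g * q)%g a b.
Proof.
have aux d : rho g (rot_aux q d b) = rot_aux (coset N g * q)%g d b.
  elim: d => [|d IH] /=; first exact: rho_ebasis.
  by rewrite (linD (rho_linear g)) !(linZ (rho_linear g)) IH rho_ebasis.
by rewrite /rot (linD (rho_linear g)) !(linZ (rho_linear g)) aux rho_ebasis.
Qed.

Hypothesis cs1 : c ^+ 2 + s ^+ 2 = 1.

Lemma rot_aux_norm q a b : ip (rot_aux q a b) (rot_aux q a b) = 1.
Proof.
elim: a => [|a IH] /=; first by rewrite ebasis_ip !eqxx.
have z : ip (rot_aux q a b) (ebasis q a.+1 b) = 0.
  by apply: rot_aux_ip_basis; rewrite ltnSn.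
rewrite !(ipDl, ipDr, ipZl, ipZr) IH z [ip (ebasis _ _ _) (rot_aux _ _ _)]ip_sym z.
by rewrite ebasis_ip !eqxx !mulr0 addr0 add0r !mulr1 mulrNN -!expr2 addrC.
Qed.

(** [rot q a b] and the next auxiliary vector form the rotated frame of the plane of [rot_aux q a b]
    and [ebasis q a.+1 b]. Later auxiliary vectors involve this plane only through the second vector
    of the frame. *)
Lemma rot_rot_aux q a b a' : (a < a')%N -> ip (rot q a b) (rot_aux q a' b) = 0.
Proof.
elim: a' => // a' IH; rewrite ltnS leq_eqVlt => /predU1P[->|aa'] /=.
  have z : ip (rot_aux q a' b) (ebasis q a'.+1 b) = 0.
    by apply: rot_aux_ip_basis; rewrite ltnSn.
  rewrite /rot !(ipDl, ipDr, ipZl, ipZr) rot_aux_norm z.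
  rewrite [ip (ebasis _ _ _) (rot_aux _ _ _)]ip_sym z ebasis_ip !eqxx /=; ring.
rewrite ipDr !ipZr IH// mulr0 add0r /rot ipDl !ipZl ebasis_ip eqSS.
by rewrite (ltn_eqF aa') rot_aux_ip_basis ?ltnS ?(ltnW aa')// !mulr0 addr0 mulr0.
Qed.

Lemma rot_ip p q a b a' b' :
  ip (rot p a b) (rot q a' b') = [&& a == a', b == b' & p == q]%:R.
Proof.
have [h|] := boolP ((b, p) != (b', q)).
  rewrite /rot !(ipDl, ipDr, ipZl, ipZr) rot_aux_ip// rot_aux_ip_basis ?h ?orbT//.
  rewrite [ip (ebasis _ _ _) (rot_aux _ _ _)]ip_sym rot_aux_ip_basis; last first.
    by rewrite eq_sym h orbT.
  rewrite ebasis_ip eqSS; move: h; rewrite xpair_eqE => /negPf ->.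
  by rewrite andbF !(mulr0, addr0).
rewrite negbK xpair_eqE => /andP[/eqP <- /eqP <-]; rewrite !eqxx !andbT.
wlog aa' : a a' / (a <= a')%N => [h|].
  have [/h//|/ltnW/h] := leqP a a'.
  by rewrite ip_sym eq_sym.
have z d d' : (d < d')%N -> ip (rot_aux p d b) (ebasis p d' b) = 0.
  by move=> dd; apply: rot_aux_ip_basis; rewrite dd.
move: aa'; rewrite leq_eqVlt => /predU1P[<-|aa'].
  rewrite eqxx /rot !(ipDl, ipDr, ipZl, ipZr) rot_aux_norm z//.
  rewrite [ip (ebasis _ _ _) (rot_aux _ _ _)]ip_sym z// ebasis_ip !eqxx /=.
  by rewrite !mulr0 addr0 add0r !mulr1 -!expr2.
rewrite ltn_eqF// {2}/rot ipDr !ipZr rot_rot_aux// mulr0 add0r /rot ipDl !ipZl.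
by rewrite z ?ltnS 1?ltnW// ebasis_ip eqSS ltn_eqF//= !mulr0 addr0 mulr0.
Qed.

End Coefficients.

(** The time t is the sine of the angle, so that time 0 is the identity and time 1 the shift. *)
Definition rot_cos (t : R) : R := Num.sqrt (1 - t ^+ 2).

Lemma rot_cos_sqr t : 0 <= t <= 1 -> rot_cos t ^+ 2 + t ^+ 2 = 1.
Proof.
move=> /andP[t0 t1]; rewrite sqr_sqrtr ?subrK// subr_ge0.
by rewrite expr_le1.
Qed.

Lemma rot_cos0 : rot_cos 0 = 1.
Proof. by rewrite /rot_cos expr0n subr0 sqrtr1. Qed.

Lemma rot_cos1 : rot_cos 1 = 0.
Proof. by rewrite /rot_cos expr1n subrr sqrtr0. Qed.

Lemma rot_cos_continuous : continuous rot_cos.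
Proof.
move=> t; apply: (@continuous_comp _ _ _ (fun t : R => 1 - t ^+ 2) Num.sqrt).
  by apply: cvgB; [exact: cvg_cst|apply: cvgM; exact: cvg_id].
exact: sqrt_continuous.
Qed.

Definition rotation (t : R) : U -> U :=
  ext eB (fun q k => rot (rot_cos t) t q (decode k).1 (decode k).2).

Lemma rotation_linear t : linear (rotation t).
Proof. exact: ext_linear. Qed.

Lemma rotation_ip t u v : 0 <= t <= 1 -> ip (rotation t u) (rotation t v) = ip u v.
Proof.
move=> t01; rewrite -[RHS]mul1r; apply: ext_ip => p q i j.
rewrite rot_ip ?rot_cos_sqr// mul1r -[i == j](inj_eq (can_inj decodeK)).
by case: (decode i) (decode j) => [a b] [a' b'] /=; rewrite xpair_eqE andbA.
Qed.

Lemma rotation_onorm t u : 0 <= t <= 1 -> onorm (rotation t u) = onorm u.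
Proof. by move=> t01; rewrite /onorm rotation_ip. Qed.

Lemma rho_rotation t g u : rotation t (rho g u) = rho g (rotation t u).
Proof. by apply: ext_rho => q k; exact: rho_rot. Qed.

Lemma rotation0 u : rotation 0 u = u.
Proof.
apply: (linear_basis_eq eB (@rotation_linear 0) _) => // q k.
rewrite /rotation ext_basis rot_cos0 /rot scale0r addr0 scale1r.
have aux a b : rot_aux 1 0 q a b = ebasis q a b.
  by case: a => //= a; rewrite oppr0 scale0r scale1r add0r.
by rewrite aux /ebasis -surjective_pairing decodeK.
Qed.

Lemma rotation1_orth u q b : ip (rotation 1 u) (ebasis q 0 b) = 0.
Proof.
rewrite /rotation /ext ip_suml big1// => i _; rewrite ip_suml big1// => p _.
rewrite ipZl rot_cos1 /rot scale0r add0r ipZl ebasis_ip /=.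
by rewrite !mulr0.
Qed.

(** Rotations being isometric, only the motion of a fixed vector matters, and at every basis vector
    the infinite product is a finite combination with continuous coefficients. *)
Lemma fcont_rotation (K : topologicalType) (t : K -> R) (u : K -> U) :
  continuous t -> (forall k, 0 <= t k <= 1) -> fcont u ->
  fcont (fun k => rotation (t k) (u k)).
Proof.
move=> ct t01 cu; apply: (@fcont_eval _ _ _ U U (fun k => rotation (t k))) => //.
- by move=> k; exact: rotation_linear.
- by move=> k w; exact: rotation_onorm.
move=> w; apply: fcont_ext => q i; move: (decode i) => [a b] /=.
have cc : continuous (fun k => rot_cos (t k)).
  by move=> k; apply: (@continuous_comp _ _ _ t rot_cos); [exact: ct|exact: rot_cos_continuous].
have caux d : fcont (fun k => rot_aux (rot_cos (t k)) (t k) q d b).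
  elim: d => [|d IH] /=; first exact: fcont_cst.
  apply: fcontD; first by apply: fcontZ => // k; apply: cvgN; exact: ct.
  by apply: fcontZ => //; exact: fcont_cst.
by apply: fcontD; apply: fcontZ => //; exact: fcont_cst.
Qed.

End Rotation.

(** * A fixed isometry with values in level 0 *)

Section EquivariantIsometry.
Context (R : realType) (gT : finGroupType) (U : universe R gT).
Variables (N : {group gT}) (nN : (N <| [set: gT]%G)%g) (e : coset_of N -> nat -> U).
Notation Q := (coset_of N).
Hypothesis eB : equivariant_basis e.
Variables (code : nat * nat -> nat) (decode : nat -> nat * nat).
Hypothesis codeK : cancel code decode.
Variables (n : nat) (Gam : {group gT * 'S_n}).
Hypothesis GamN : forall x, x \in Gam -> x.1 \in N -> x.2 = 1%g.

(* Gam acts freely on the part of Q * 'I_n lying over each of its orbits in Q, so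
   that 'I_n can be untwisted after a choice of a representative of each orbit. *)
Lemma untwisting : exists sq : Q -> 'S_n, forall x, x \in Gam ->
  forall q t, sq (coset N x.1 * q)%g t = sq q (x.2 t).
Proof.
have morphN g h : coset N (g * h)%g = (coset N g * coset N h)%g.
  by rewrite morphM ?in_norm.
(* The orbit of [q] under Gam. Choosing [rep] as a function of this set makes it constant on
   orbits. *)
pose O q := [set q' | [exists x in Gam, coset N x.1 * q' == q]%g]%SET.
have O_x x q : x \in Gam -> O (coset N x.1 * q)%g = O q.
  move=> xG; apply/setP => q'; rewrite !inE; apply/exists_inP/exists_inP.
    move=> [y yG /eqP yq]; exists (x^-1 * y)%g; first by rewrite groupM ?groupV.
    apply/eqP; rewrite /= morphN -mulgA yq mulgA -morphN mulVg morph1.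
    by rewrite mul1g.
  move=> [y yG /eqP <-]; exists (x * y)%g; first by rewrite groupM.
  by rewrite /= morphN mulgA.
have Oq q : q \in O q.
  rewrite inE; apply/exists_inP; exists 1%g; first exact: group1.
  by rewrite /= morph1 mul1g.
pose rep q := odflt 1%g [pick q' in O q].
have repO q : rep q \in O q.
  by rewrite /rep; case: pickP => //= /(_ q); rewrite Oq.
have /choice[ga hga] q : exists x, x \in Gam /\ (coset N x.1 * rep q = q)%g.
  by have := repO q; rewrite inE => /exists_inP[x xG /eqP xq]; exists x.
exists (fun q => (ga q).2) => x xG q t.
have [g1G g1q] := hga q; have [g2G g2q] := hga (coset N x.1 * q)%g.
(* [y] fixes the representative of the orbit, so its group component lies in [N] and [GamN]
   trivialises its permutation. *)
pose y := ((x * ga q)^-1 * ga (coset N x.1 * q))%g.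
have yG : y \in Gam by rewrite groupM ?groupV ?groupM.
have : y.2 = 1%g.
  apply: GamN yG _; apply: coset_idr; first exact: in_norm.
  rewrite /y /= morphN morphV ?in_norm//= morphN.
  have repE : rep (coset N x.1 * q)%g = rep q by rewrite /rep O_x.
  move: g2q; rewrite repE => g2q.
  apply: (mulIg (rep q)); rewrite mul1g -mulgA g2q invMg -mulgA mulKg.
  by rewrite -[X in (_ * X)%g = _]g1q mulKg.
rewrite /y /= => /eqP; rewrite -eq_mulVg1 => /eqP <-.
by rewrite permM.
Qed.

(** Summand t is embedded in level 0, which the rotation at time 1 leaves free. Labelling its
    vectors over [q] by [sq q t] instead of t absorbs the permutations in Gam; [pickle] packs the
    label and the basis index into one number. *)
Lemma fixed_linisom_exists : exists f0 : linisom U n,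
  (forall x, x \in Gam -> linisom_act x f0 = f0) /\
  forall u x, ip (rotation eB code decode 1 u) (f0 x) = 0.
Proof.
have [sq hsq] := untwisting.
pose z (t : 'I_n) (q : Q) (k : nat) : U := ebasis e code q 0 (pickle (sq q t, k)).
have z_ip t t' p q i j : ip (z t p i) (z t' q j) =
    (t == t')%:R * ((i == j) && (p == q))%:R.
  rewrite (ebasis_ip eB codeK) (inj_eq (pcan_inj pickleK)) xpair_eqE /=.
  case: (eqVneq p q) => [<-|]; last by rewrite !andbF mulr0.
  rewrite !andbT (inj_eq perm_inj); by case: eqP; case: eqP; rewrite ?mul1r ?mul0r.
pose f0 (x : dsum U n) : U := \sum_t ext eB (z t) (x t).
have lf0 : linear f0.
  move=> a x y; rewrite /f0 scaler_sumr -big_split; apply: eq_bigr => t _ /=.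
  by rewrite !ffunE ext_linear.
have nf0 x : onorm (f0 x) = onorm x.
  rewrite /onorm /f0 ip_suml; congr Num.sqrt; apply: eq_bigr => t _.
  rewrite ip_sumr (bigD1 t)//= (@ext_ip _ _ _ _ _ eB _ _ _ 1) => [|p q i j].
    rewrite mul1r big1 ?addr0// => t' t't.
    rewrite (@ext_ip _ _ _ _ _ eB _ _ _ 0) ?mul0r// => p q i j.
    by rewrite z_ip eq_sym (negPf t't).
  by rewrite z_ip eqxx.
exists (LinIsom lf0 nf0); split=> [x xG|u x]; last first.
  rewrite /= /f0 ip_sumr big1// => t _; rewrite /ext ip_sumr big1// => i _.
  rewrite ip_sumr big1// => q _; rewrite ipZr.
  by rewrite (rotation1_orth eB codeK) mulr0.
apply: linisomP => v; rewrite /= /linisom_act_fun /= /f0.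
rewrite (lin_sum (rho_linear _)) (reindex_perm x.2); apply: eq_bigr => t _.
rewrite ffunE permK.
apply: (@linear_basis_eq _ _ _ _ _ eB _
  (fun w => rho x.1 (ext eB (z (x.2 t)) (rho x.1^-1%g w))) (ext eB (z t))).
- by move=> a w w'; rewrite rho_linear ext_linear rho_linear.
- exact: ext_linear.
move=> q k; rewrite (rho_basis eB) !ext_basis /z (rho_ebasis eB).
rewrite mulgA -morphM ?in_norm// mulgV morph1 mul1g.
congr (ebasis _ _ _ _ (pickle (_, _))); rewrite -(hsq x xG).
by rewrite mulgA -morphM ?in_norm// mulgV morph1 mul1g.
Qed.

End EquivariantIsometry.

(** * Fixed points: obstruction and contractibility *)

Section FixedSets.
Context (R : realType) (gT : finGroupType) (U : universe R gT).
Variables (N : {group gT}) (nN : (N <| [set: gT]%G)%g) (e : coset_of N -> nat -> U).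
Hypothesis rhoN : forall g, g \in N -> forall v : U, rho g v = v.
Hypothesis eB : equivariant_basis e.
Variables (code : nat * nat -> nat) (decode : nat -> nat * nat).
Hypotheses (codeK : cancel code decode) (decodeK : cancel decode code).
Notation J := (rotation eB code decode).
Notation D := (infinite_little_discs_operad U).
Notation L := (linear_isometries_operad U).

Lemma invariant_unit_vector : exists v : U, ip v v = 1 /\ forall g, rho g v = v.
Proof.
have [V [rV [v Vv v0] Vfix]] := univ_trivial U.
have n0 := onorm_gt0 v0; exists ((onorm v)^-1 *: v); split.
  by rewrite ipZl ipZr -onorm_sqr; field; rewrite gt_eqF.
by move=> g; rewrite (linZ (rho_linear g)) Vfix.
Qed.

Lemma linisom_ip m (f : linisom U m) x y : ip (f x) (f y) = ip x y.
Proof.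
have h a : ip (f a) (f a) = ip a a by exact: ip_linisom.
have := h (x + y); rewrite (linD (linisom_linear _)) !(ipDl, ipDr) !h.
rewrite [ip (f y) (f x)]ip_sym [ip y x]ip_sym; lra.
Qed.

Lemma linisom_fixed_in m (f : linisom U m) (x : gT * 'S_m) v i :
  linisom_act x f = f -> (forall g, rho g v = v) ->
  rho x.1 (f (dsum_in (x.2 i) v)) = f (dsum_in i v).
Proof.
move=> fx vfix; have := congr1 (fun f : linisom U m => f (dsum_in i v)) fx.
rewrite /= /linisom_act_fun => <-; congr (rho _ (linisom_fun f _)).
apply/ffunP => t; rewrite !ffunE -{2}[i](permK x.2) (inj_eq perm_inj).
by case: ifP; rewrite ?vfix ?rho0.
Qed.

Lemma le_onorm (a : R) (x : U) : 0 <= a -> a ^+ 2 <= ip x x -> a <= onorm x.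
Proof.
by move=> a0; rewrite -onorm_sqr ler_pXn2r// nnegrE onorm_ge0.
Qed.

Section Fixed.
Variables (n : nat) (Gam : {group gT * 'S_n}).

(** An element over [N] moves no vector, so discs i and [x.2 i] coincide; discs of positive radius
    with different indices cannot. *)
Lemma discs_fixed_kernel : @op_fixed gT D n Gam !=set0 ->
  forall x, x \in Gam -> x.1 \in N -> x.2 = 1%g.
Proof.
move=> [c hc] x xG xN; apply/permP => i; rewrite perm1; apply/eqP.
apply: contraT => xi; have [r0 dc] := inf_discs_config c.
have /(congr1 (fun c : inf_discs U n => c i)) := hc x xG.
rewrite /= /discs_act_fun rhoN// -surjective_pairing => ci.
have := dc _ _ xi; rewrite ci subrr onorm0.
by have [] := r0 i; lra.
Qed.

(** Here the images of [v] from the summands i and [x.2 i] coincide, while an isometry sends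
    different summands to orthogonal subspaces. *)
Lemma linisom_fixed_kernel : @op_fixed gT L n Gam !=set0 ->
  forall x, x \in Gam -> x.1 \in N -> x.2 = 1%g.
Proof.
move=> [f hf] x xG xN; apply/permP => i; rewrite perm1; apply/eqP.
apply: contraT => xi; have [v [v1 _]] := invariant_unit_vector.
have /(congr1 (fun f : linisom U n => f (dsum_in i v))) := hf x xG.
rewrite /= /linisom_act_fun rhoN//.
have -> : [ffun t => rho x.1^-1%g (dsum_in i v ((x.2)^-1%g t))] =
    dsum_in (x.2 i) v :> dsum U n.
  apply/ffunP => t; rewrite !ffunE rhoN ?groupV//.
  by rewrite -[t in RHS](permKV x.2) (inj_eq perm_inj).
move=> /(congr1 (fun w => ip w (f (dsum_in i v)))).
rewrite !linisom_ip !ip_dsum_in !ffunE eqxx v1 (negPf xi) ip0r.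
by move=> /eqP; rewrite eq_sym oner_eq0.
Qed.

Hypothesis GamN : forall x, x \in Gam -> x.1 \in N -> x.2 = 1%g.

Lemma linisom_fixed_kcontractible : kcontractible R (@op_fixed gT L n Gam).
Proof.
have [f0 [ff0 of0]] := fixed_linisom_exists nN eB codeK GamN.
pose s1 t : R := clamp (2 * t); pose s2 t : R := clamp (2 * t - 1).
(* [f0] is mixed in only after the rotation is complete, when the two images are orthogonal; so the
   cross term in the norm always vanishes. *)
have s12 t : s2 t = 0 \/ s1 t = 1.
  case: (lerP (1/2) t) => h; [right|left]; first by apply: clamp_ge1; lra.
  by apply: clamp_le0; lra.
pose Hf t (f : linisom U n) x := rot_cos (s2 t) *: J (s1 t) (f x) + s2 t *: f0 x.
have lH t f : linear (Hf t f).
  move=> a x y; rewrite /Hf !linisom_linear rotation_linear !scalerDr.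
  by rewrite !scalerA -!addrA; congr (_ + _); rewrite ![_ * a]mulrC // addrCA.
have nH t f x : onorm (Hf t f x) = onorm x.
  have s1t := clamp01 (2 * t); have s2t := clamp01 (2 * t - 1).
  rewrite /onorm; congr Num.sqrt.
  have cr : s2 t * ip (J (s1 t) (f x)) (f0 x) = 0.
    by case: (s12 t) => ->; rewrite ?mul0r// of0 mulr0.
  rewrite /Hf !(ipDl, ipDr, ipZl, ipZr) rotation_ip// !ip_linisom.
  rewrite [ip (f0 x) (J _ _)]ip_sym.
  transitivity ((rot_cos (s2 t) ^+ 2 + s2 t ^+ 2) * ip x x +
    2 * rot_cos (s2 t) * (s2 t * ip (J (s1 t) (f x)) (f0 x))); first by ring.
  by rewrite cr mulr0 addr0 rot_cos_sqr// mul1r.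
pose H t (f : L n) : L n := LinIsom (lH t f) (nH t f).
exists H, f0; split.
- by move=> x xG; exact: ff0.
- move=> f _; split; apply: linisomP => x; rewrite /= /Hf.
    have -> : s1 0 = 0 by apply: clamp_le0; rewrite mulr0.
    have -> : s2 0 = 0 by apply: clamp_le0; lra.
    by rewrite rotation0// rot_cos0 scale1r scale0r addr0.
  have -> : s2 1 = 1 by apply: clamp_ge1; lra.
  by rewrite rot_cos1 scale0r add0r scale1r.
- move=> t f _ hf x xG; apply: linisomP => v; rewrite /= /linisom_act_fun /= /Hf.
  rewrite (linD (rho_linear _)) !(linZ (rho_linear _)) -rho_rotation.
  have := congr1 (fun f : linisom U n => f v) (hf x xG).
  have := congr1 (fun f : linisom U n => f v) (ff0 x xG).
  by rewrite /= /linisom_act_fun => -> ->.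
move=> K t u cK hK ct /(linisom_continuousP _ cK hK) cu t01 _.
have cs1 : continuous (fun k => s1 (t k)).
  move=> k; rewrite /s1; apply: (@continuous_comp _ _ _ (fun k => 2 * t k) (@clamp R)).
    by apply: cvgM; [exact: cvg_cst|exact: ct].
  exact: clamp_continuous.
have cs2 : continuous (fun k => s2 (t k)).
  move=> k; rewrite /s2; apply: (@continuous_comp _ _ _ (fun k => 2 * t k - 1) (@clamp R)).
    apply: cvgB; last exact: cvg_cst.
    by apply: cvgM; [exact: cvg_cst|exact: ct].
  exact: clamp_continuous.
apply/(linisom_continuousP _ cK hK) => x.
apply: (@fcontD _ _ K U (fun k => rot_cos (s2 (t k)) *: J (s1 (t k)) ((u k : linisom U n) x))
  (fun k => s2 (t k) *: f0 x)).
  apply: fcontZ.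
    move=> k; apply: (@continuous_comp _ _ _ (fun k => s2 (t k)) (@rot_cos R)).
      exact: cs2.
    exact: rot_cos_continuous.
  by apply: fcont_rotation => // k; exact: clamp01.
by apply: fcontZ => //; exact: fcont_cst.
Qed.

(* The discs are moved into the image of the rotation, pushed apart in the
   direction of the orthogonal vectors w_i, and then shrunk to the discs of radius
   1/64 around the w_i / 4. *)
Lemma discs_fixed_kcontractible : kcontractible R (@op_fixed gT D n Gam).
Proof.
have [f0 [ff0 of0]] := fixed_linisom_exists nN eB codeK GamN.
have [v [v1 vfix]] := invariant_unit_vector.
(* Orthonormal directions, permuted by Gam and orthogonal to the image of the rotation at time 1. *)
pose w i : U := f0 (dsum_in i v).
have ipw i j : ip (w i) (w j) = (i == j)%:R.
  by rewrite linisom_ip ip_dsum_in ffunE eq_sym; case: eqP; rewrite ?v1 ?ip0r.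
have norm_w i : onorm (w i) = 1 by rewrite /onorm ipw eqxx sqrtr1.
have Jw u i : ip (J 1 u) (w i) = 0 by exact: of0.
have rho_w x i : x \in Gam -> rho x.1 (w (x.2 i)) = w i.
  by move=> xG; exact: linisom_fixed_in (ff0 x xG) vfix.
pose s1 t : R := clamp (3 * t); pose s2 t : R := clamp (3 * t - 1).
pose s3 t : R := clamp (3 * t - 2).
have s12 t : s2 t = 0 \/ s1 t = 1.
  case: (lerP (1/3) t) => h; [right|left]; first by apply: clamp_ge1; lra.
  by apply: clamp_le0; lra.
have s23 t : s3 t = 0 \/ s2 t = 1.
  case: (lerP (2/3) t) => h; [right|left]; first by apply: clamp_ge1; lra.
  by apply: clamp_le0; lra.
have s1b t : 0 <= s1 t <= 1 by exact: clamp01.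
have s2b t : 0 <= s2 t <= 1 by exact: clamp01.
have s3b t : 0 <= s3 t <= 1 by exact: clamp01.
(* The discs are halved during the rotation, which leaves room for the push by a quarter of [w i];
   in the last third they are scaled to 0 while the radius 1/64 comes in. *)
pose lam t := (1 - s3 t) * (1 - s1 t / 2).
pose Hf t (c : inf_discs U n) (i : 'I_n) : R * U :=
  (lam t * (c i).1 + s3 t / 64,
   lam t *: J (s1 t) (c i).2 + (s2 t / 4) *: w i).
have cH t c : disc_config (Hf t c).
  have [rc dc] := inf_discs_config c.
  have [/andP[s1a s1c] /andP[s2a s2c] /andP[s3a s3c]] := And3 (s1b t) (s2b t) (s3b t).
  have lam0 : 0 <= lam t by rewrite /lam mulr_ge0//; lra.
  have lam1 : lam t <= 1 - s1 t / 2 by rewrite /lam ler_piMl//; lra.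
  split=> [i|i j ij] /=.
    have [r0 rb] := rc i; split.
      have [->|s3n] := eqVneq (s3 t) 1.
        by rewrite ltr_wpDl ?divr_gt0// mulr_ge0// ltW.
      rewrite ltr_pwDl ?divr_ge0// mulr_gt0// /lam mulr_gt0//; last lra.
      by rewrite subr_gt0 lt_neqAle s3n.
    apply: (@le_trans _ _ (lam t * ((c i).1 + onorm (c i).2) + s3 t / 64 + s2 t / 4)).
      have : onorm (lam t *: J (s1 t) (c i).2 + (s2 t / 4) *: w i) <=
          lam t * onorm (c i).2 + s2 t / 4.
        apply: le_trans (ler_onormD _ _) _.
        by rewrite !onormZ rotation_onorm// norm_w mulr1 !ger0_norm ?divr_ge0.
      by rewrite mulrDr; lra.
    have : lam t * ((c i).1 + onorm (c i).2) <= lam t by rewrite ler_piMr.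
    case: (s12 t) => s0.
      have s30 : s3 t = 0 by case: (s23 t) => // s21; move: s0; rewrite s21; lra.
      by rewrite s0 s30; lra.
    by move: lam1; rewrite s0; lra.
  apply: le_onorm.
    have [ri0 _] := rc i; have [rj0 _] := rc j.
    by rewrite !addr_ge0 ?divr_ge0 ?(mulr_ge0 lam0 (ltW _)).
  set S := (c i).1 + (c j).1; set b := (c i).2 - (c j).2.
  have -> : lam t *: J (s1 t) (c i).2 + (s2 t / 4) *: w i -
      (lam t *: J (s1 t) (c j).2 + (s2 t / 4) *: w j) =
      lam t *: J (s1 t) b + (s2 t / 4) *: (w i - w j).
    by rewrite (linB (rotation_linear _ _ _ _)) !scalerBr opprD addrACA.
  have cr : s2 t * ip (J (s1 t) b) (w i - w j) = 0.
    by case: (s12 t) => ->; rewrite ?mul0r// ipBr !Jw subrr mulr0.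
  have ww : ip (w i - w j) (w i - w j) = 2.
    by rewrite !(ipBl, ipBr) !ipw !eqxx [j == i]eq_sym (negPf ij) /=; ring.
  move: (w i - w j) cr ww => W cr ww.
  rewrite !(ipDl, ipDr, ipZl, ipZr) rotation_ip// ww.
  rewrite [ip W _]ip_sym.
  (* Pythagoras: [W] has squared length 2, so the push contributes [s2 t ^+ 2 / 8], and the cross
     term is 0. *)
  rewrite [X in _ <= X](_ : _ = lam t ^+ 2 * ip b b + s2 t ^+ 2 / 8 +
      lam t / 2 * (s2 t * ip (J (s1 t) b) W)); last by field.
  rewrite cr mulr0 addr0 -onorm_sqr.
  have S0 : 0 <= S by rewrite addr_ge0// ltW//; [case: (rc i)|case: (rc j)].
  have SB : lam t ^+ 2 * S ^+ 2 <= lam t ^+ 2 * onorm b ^+ 2.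
    rewrite ler_wpM2l ?sqr_ge0// ler_pXn2r ?nnegrE ?onorm_ge0//; exact: dc.
  have S2 : S <= 2.
    have [_ h1] := rc i; have [_ h2] := rc j; rewrite /S.
    by have := onorm_ge0 (c i).2; have := onorm_ge0 (c j).2; lra.
  have -> : lam t * (c i).1 + s3 t / 64 + (lam t * (c j).1 + s3 t / 64) =
      lam t * S + s3 t / 32 by rewrite /S; field.
  case: (s23 t) => s0.
    by rewrite s0 mul0r addr0 exprMn; have := sqr_ge0 (s2 t); lra.
  have s11 : s1 t = 1 by case: (s12 t) => //; rewrite s0; lra.
  have lamS : lam t * S <= 1.
    rewrite [leRHS](_ : 1 = 1 / 2 * 2); last by field.
    by apply: ler_pM => //; move: lam1; rewrite s11; lra.
  have lamS0 : 0 <= lam t * S by rewrite mulr_ge0.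
  rewrite s0 expr1n -exprMn in SB *.
  (* As [lam t * S] and [s3 t] are at most 1, the excess is at most 2/32 + 1/32^2, which is below
     1/8. *)
  have : (lam t * S + s3 t / 32) ^+ 2 <= (lam t * S) ^+ 2 + 1 / 8 by nra.
  lra.
have [V0 sV0] := univ_stage U.
pose H t (c : D n) : D n := InfDiscs (disc_config_stage sV0 (cH t c)).
(* At time 1 the factor [lam] is 0, so nothing is left of the given configuration. *)
have Hc1 c d : H 1 c = H 1 d.
  have s31 : s3 1 = 1 by apply: clamp_ge1; lra.
  by apply: inf_discsP => i; rewrite /= /Hf /lam s31 subrr !mul0r !scale0r.
have HA t c : @op_fixed gT D n Gam c -> @op_fixed gT D n Gam (H t c).
  move=> hc x xG; apply: inf_discsP => i.
  have := congr1 (fun c : inf_discs U n => c i) (hc x xG).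
  rewrite /= /discs_act_fun /= /Hf (linD (rho_linear _)) !(linZ (rho_linear _)).
  by rewrite -rho_rotation rho_w// => <-.
have w_config : disc_config (fun i => (1/64, (1/4) *: w i) : R * U).
  split=> [i|i j ij] /=.
    by rewrite onormZ norm_w ger0_norm; [split; lra|lra].
  apply: le_onorm; first lra.
  rewrite -scalerBr ipZl ipZr !(ipBl, ipBr) !ipw !eqxx [j == i]eq_sym (negPf ij).
  by rewrite /=; lra.
pose c0 : D n := InfDiscs (disc_config_stage sV0 w_config).
have Ac0 : @op_fixed gT D n Gam c0.
  move=> x xG; apply: inf_discsP => i; rewrite /= /discs_act_fun /=.
  by rewrite (linZ (rho_linear _)) rho_w.
exists H, (H 1 c0); split=> //; first exact: HA.
- move=> c Ac; split; last exact: Hc1.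
  apply: inf_discsP => i; rewrite /= /Hf /lam.
  have -> : s1 0 = 0 by apply: clamp_le0; rewrite mulr0.
  have -> : s2 0 = 0 by apply: clamp_le0; lra.
  have -> : s3 0 = 0 by apply: clamp_le0; lra.
  rewrite rotation0// !mul0r !subr0 mulr1 mul1r scale1r scale0r !addr0.
  by rewrite -surjective_pairing.
- by move=> t c _; exact: HA.
move=> K t u cK hK ct cu t01 _.
have cs (b : R) : continuous (fun k => clamp (3 * t k - b)).
  move=> k; apply: (@continuous_comp _ _ _ (fun k => 3 * t k - b) (@clamp R)).
    apply: cvgB; last exact: cvg_cst.
    by apply: cvgM; [exact: cvg_cst|exact: ct].
  exact: clamp_continuous.
have cs1 : continuous (fun k => s1 (t k)).
  rewrite (_ : (fun k => _) = fun k => clamp (3 * t k - 0)); first exact: cs.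
  by apply/funext => k; rewrite subr0.
have cs2 : continuous (fun k => s2 (t k)) by exact: cs.
have cs3 : continuous (fun k => s3 (t k)) by exact: cs.
have clam : continuous (fun k => lam (t k)).
  move=> k; apply: cvgM; first by apply: cvgB; [exact: cvg_cst|exact: cs3].
  apply: cvgB; first exact: cvg_cst.
  by apply: cvgM; [exact: cs1|exact: cvg_cst].
apply: discs_continuous => i /=.
  move=> k; apply: cvgD; last by apply: cvgM; [exact: cs3|exact: cvg_cst].
  apply: cvgM; first exact: clam.
  apply: (@continuous_comp _ _ _ u (fun c : inf_discs U n => (c i).1)); first exact: cu.
  exact: discs_radius_continuous.
apply: fcontD; last first.
  apply: fcontZ; last exact: fcont_cst.
  by move=> k; apply: cvgM; [exact: cs2|exact: cvg_cst].
apply: fcontZ => //; apply: fcont_rotation => //.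
apply: continuous_fcont => // k.
apply: (@continuous_comp _ _ (fintop U) u (fun c : inf_discs U n => (c i).2)).
  exact: cu.
exact: discs_centre_continuous.
Qed.

End Fixed.
End FixedSets.

(** * Comparison with the model R[G/N]^oo *)

Section PermutationModel.
Context (R : realType) (gT : finGroupType).
Variables (N : {group gT}) (nN : (N <| [set: gT]%G)%g).
Notation Q := (coset_of N).
Notation M := (infsum_rep (perm_rep R nN)).

Lemma infsum_linear_coord (k : nat) (q : Q) :
  linear (fun x : M => (infsum_fun x k : perm_rep R nN) q : R^o).
Proof.
move=> a x y.
have -> : infsum_fun (a *: x + y) k = a *: infsum_fun x k + infsum_fun y k.
  by rewrite -[LHS]/(val (a *: x + y : infsum (perm_rep R nN)) k) linearP.
by rewrite !ffunE.
Qed.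

Lemma rep_iso_kernel (U : rep R gT) : rep_iso U M ->
  forall g, g \in N -> forall v : U, rho g v = v.
Proof.
move=> [f [_ /bij_inj fI fr]] g gN v; apply: fI; rewrite fr.
apply: val_inj; apply/funext => k; apply/ffunP => q.
by rewrite ffunE coset_id// invg1 mul1g.
Qed.

Lemma delta_finsupp (i : nat) : (fun k => if k == i then [ffun q : Q => (q == 1%g)%:R]
  else 0 : perm_rep R nN) \in @finsupp R gT (perm_rep R nN).
Proof. by apply/finsuppP; exists i.+1 => k ik; rewrite gtn_eqF. Qed.

(** The generators of m different summands R[G/N] are used; the coordinate at (i, q) reads off
    [a i q]. *)
Lemma rep_iso_free_orbits (U : orthrep R gT) : rep_iso U M ->
  forall m, exists X : 'I_m -> U, forall a : 'I_m -> Q -> R,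
  \sum_i \sum_q a i q *: qact q (X i) = 0 -> forall i q, a i q = 0.
Proof.
move=> [f [lf [f' _ f'K] fr]] m.
exists (fun i => f' (InfSum (delta_finsupp i))) => a a0 i q.
pose h u : R^o := (infsum_fun (f u) i : perm_rep R nN) q.
have lh : linear h by move=> b x y; rewrite /h lf (infsum_linear_coord i q b).
have := congr1 h a0; rewrite (lin0 lh) (lin_sum lh).
have hE (j : 'I_m) (p : Q) : h (qact p (f' (InfSum (delta_finsupp j)))) = ((i == j) && (p == q))%:R.
  rewrite /h /qact fr f'K /= /infsum_rho /= /perm_rho.
  rewrite ffunE coset_reprK -val_eqE /=.
  by case: eqVneq => _; rewrite ffunE// -eq_mulVg1.
rewrite (bigD1 i)//= (lin_sum lh) (bigD1 q)//= (linZ lh) hE !eqxx.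
rewrite !big1 ?addr0 => [|j ji|p pq].
- by rewrite /GRing.scale /= mulr1.
- rewrite (lin_sum lh) big1// => p _; rewrite (linZ lh) hE eq_sym (negPf ji).
  exact: scaler0.
- by rewrite (linZ lh) hE (negPf pq) andbF; exact: scaler0.
Qed.

Lemma equivariant_basis_rep_iso (U : orthrep R gT) (e : Q -> nat -> U) :
  equivariant_basis e -> rep_iso U M.
Proof.
move=> eB.
have fs u : (fun k => [ffun q : Q => ip u (e q k)] : perm_rep R nN) \in
    @finsupp R gT (perm_rep R nN).
  apply/finsuppP; exists (supp_bound eB u) => k uk; apply/ffunP => q.
  by rewrite !ffunE; exact: supp_boundP uk.
pose f (u : U) : M := InfSum (fs u).
have lf : linear f.
  move=> a u v; apply: val_inj; apply/funext => k; apply/ffunP => q.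
  by rewrite (infsum_linear_coord k q a) /= !ffunE ipDl ipZl.
exists f; split=> //.
  have fE u k q : (infsum_fun (f u) k : perm_rep R nN) q = ip u (e q k).
    by rewrite /= ffunE.
  have fI : injective f.
    move=> u v fuv; apply/eqP; rewrite -subr_eq0; apply/eqP.
    rewrite (basis_decomp eB (u - v)) big1// => i _; rewrite big1// => q _.
    by rewrite ipBl -!fE fuv subrr scale0r.
  have mx (x : M) : exists m, forall k, (m <= k)%N -> infsum_fun x k = 0.
    by case: x => x xs; exact: (elimT (finsuppP x) xs).
  pose m (x : M) := projT1 (cid (mx x)).
  pose f' (x : M) : U := \sum_(i < m x) \sum_q (infsum_fun x i : perm_rep R nN) q *: e q i.
  have f'K : cancel f' f.
    move=> x; apply: val_inj; apply/funext => k; apply/ffunP => q.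
    rewrite [LHS]fE ip_suml; have [km|mk] := ltnP k (m x).
      rewrite (bigD1 (Ordinal km))//= ip_suml (bigD1 q)//= ipZl (basis_ip eB) !eqxx mulr1.
      rewrite !big1 ?addr0// => [j jk|p pq].
        rewrite ip_suml big1// => p _; rewrite ipZl (basis_ip eB).
        by rewrite -[k]/(val (Ordinal km)) val_eqE (negPf jk) mulr0.
      by rewrite ipZl (basis_ip eB) eqxx (negPf pq) mulr0.
    rewrite big1 => [|j _]; first by
      rewrite -[RHS]/((infsum_fun x k : perm_rep R nN) q) (projT2 (cid (mx x)) k mk) ffunE.
    rewrite ip_suml big1// => p _; rewrite ipZl (basis_ip eB) ltn_eqF ?mulr0//.
    exact: leq_trans mk.
  by exists f' => // u; apply: fI; rewrite f'K.
move=> g v; apply: val_inj; apply/funext => k; apply/ffunP => q.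
rewrite /= !ffunE ip_rhol (rho_basis eB) morphV// in_norm//.
Qed.

End PermutationModel.

Lemma finite_lower_bound (R : realType) (I : finType) (F : I -> R) :
  (forall i, 0 < F i) -> exists2 r, 0 < r & forall i, r <= F i.
Proof.
move=> F0; suff [r r0 hr] : exists2 r, 0 < r & forall i, i \in enum I -> r <= F i.
  by exists r => // i; apply: hr; rewrite mem_enum.
elim: (enum I) => [|i s [r r0 hr]]; first by exists 1.
exists (Num.min r (F i)); first by rewrite lt_min r0 F0.
by move=> j; rewrite inE ge_min => /predU1P[->|/hr ->//]; rewrite lexx orbT.
Qed.

(** * Necessity: free orbits from a zig-zag *)

Section Necessity.
Context (R : realType) (gT : finGroupType) (U : universe R gT).
Notation D := (infinite_little_discs_operad U).
Notation L := (linear_isometries_operad U).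

(** Operad maps carry fixed points forward; surjectivity on path components brings them back. *)
Lemma zigzag_fixed (O P : operad_data gT) : operad_zigzag R O P ->
  forall n (Gam : {group gT * 'S_n}),
    @op_fixed gT O n Gam !=set0 <-> @op_fixed gT P n Gam !=set0.
Proof.
elim=> {O P} [O P [_ _ [f mf wf]] n Gam|O n Gam|O P _ IH n Gam|O P S _ IH1 _ IH2 n Gam].
- split=> [[c hc]|[d hd]].
    by exists (f n c) => x xG; rewrite -(opm_act mf) hc.
  by have [c hc _] := whe_pi0_surj (wf n Gam) hd; exists c.
- by [].
- exact: iff_sym (IH n Gam).
- exact: iff_trans (IH1 n Gam) (IH2 n Gam).
Qed.

Definition kernel_set : {set gT} := [set g | `[< forall v : U, rho g v = v >]]%SET.

Lemma kernelP g : reflect (forall v : U, rho g v = v) (g \in kernel_set).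
Proof. by rewrite inE; exact: asboolP. Qed.

Lemma kernel_group_set : group_set kernel_set.
Proof.
apply/group_setP; split; first by apply/kernelP => v; rewrite rho1.
by move=> g h /kernelP hg /kernelP hh; apply/kernelP => v; rewrite rhoM hh hg.
Qed.

Definition kernel_group := Group kernel_group_set.

Lemma kernel_normal : (kernel_group <| [set: gT]%G)%g.
Proof.
apply/andP; split; first by apply/fintype.subsetP => g _; rewrite inE.
apply/normsP => g _; apply/setP => h; rewrite mem_conjg.
apply/kernelP/kernelP => hh v.
  by have := hh (rho g v); rewrite conjgE invgK !rhoM rhoK => /(congr1 (rho g^-1%g)); rewrite !rhoK.
by rewrite conjgE invgK !rhoM hh rhoKV.
Qed.

(** The elements g are treated one at a time: if [x] is fixed by g, a multiple of a vector moved by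
    g is added, so small that the earlier elements still move the sum. *)
Lemma generic_vector : exists x : U, forall g, g \notin kernel_set -> rho g x != x.
Proof.
suff [x hx] : exists x : U, forall g, g \in enum gT -> g \notin kernel_set -> rho g x != x.
  by exists x => g; apply: hx; rewrite mem_enum.
elim: (enum gT) => [|g s [x hx]]; first by exists 0.
have [[gN|gx]|] := pselect (g \in kernel_set \/ rho g x != x).
- by exists x => h; rewrite inE => /predU1P[->|]; [rewrite gN|exact: hx].
- by exists x => h; rewrite inE => /predU1P[->|]; [|exact: hx].
move=> /not_orP[/negP gN /negP]; rewrite negbK => /eqP gx.
have [y gy] : exists y : U, rho g y <> y.
  by apply/existsNP => h; case/kernelP: gN.
(* A bound on t below which [x + t *: y] is still moved by [h]; the summand 1 guards against [h]
   fixing [y]. *)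
pose F (h : gT) : R := if (rho h x != x) then
  onorm (rho h x - x) / (onorm (rho h y - y) + 1) else 1.
have [|t t0 ht] := @finite_lower_bound R gT F.
  move=> h; rewrite /F; case: ifP => // hx0.
  by rewrite divr_gt0 ?onorm_gt0 ?subr_eq0// ltr_wpDl// onorm_ge0.
exists (x + t *: y) => h; rewrite (linD (rho_linear h)) (linZ (rho_linear h)).
rewrite inE => /predU1P[->|hs] hN.
  rewrite gx; apply/negP => /eqP/addrI/scalerI E; apply: gy; apply: E.
  by rewrite gt_eqF.
have hx0 := hx h hs hN; rewrite -subr_eq0; apply/negP => /eqP E.
have : onorm (rho h x - x) = t * onorm (rho h y - y).
  have -> : rho h x - x = - (t *: (rho h y - y)).
    apply/eqP; rewrite -subr_eq0 opprK -E scalerBr opprD.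
    by rewrite addrACA.
  by rewrite onormN onormZ gtr0_norm.
have := ht h; rewrite /F hx0 ler_pdivlMr; last by rewrite ltr_wpDl// onorm_ge0.
by rewrite mulrDr mulr1; lra.
Qed.

Let N := kernel_group.
Let nN := kernel_normal.
Notation Q := (coset_of N).

Lemma rho_kernel g : g \in N -> forall v : U, rho g v = v.
Proof. by move/kernelP. Qed.

(** The inverse makes [coset_perm] a homomorphism, as products in ['S_n] compose from left to
    right. *)
Definition coset_perm_fun (g : gT) (i : 'I_#|{: Q}|) : 'I_#|{: Q}| :=
  enum_rank ((coset N g)^-1 * enum_val i)%g.

Lemma coset_perm_inj g : injective (coset_perm_fun g).
Proof. by move=> i j /enum_rank_inj/mulgI/enum_val_inj. Qed.

Definition coset_perm g : 'S_#|{: Q}| := perm (@coset_perm_inj g).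

Definition coset_graph : {set gT * 'S_#|{: Q}|} :=
  [set (g, coset_perm g) | g : gT]%SET.

Lemma coset_graph_group_set : group_set coset_graph.
Proof.
apply/group_setP; split.
  apply/imsetP; exists 1%g => //; congr (_, _); apply/permP => i.
  by rewrite perm1 permE /coset_perm_fun morph1 invg1 mul1g enum_valK.
move=> _ _ /imsetP[g _ ->] /imsetP[h _ ->]; apply/imsetP; exists (g * h)%g => //.
congr (_, _); apply/permP => i; rewrite permM !permE /coset_perm_fun enum_rankK.
by rewrite morphM ?(in_norm nN)// invMg mulgA.
Qed.

Definition coset_graph_group := Group coset_graph_group_set.

Lemma discs_coset_graph : @op_fixed gT D _ coset_graph_group !=set0.
Proof.
have [x hx] := generic_vector; have [V0 sV0] := univ_stage U.
pose a : R := (2 * (onorm x + 1))^-1.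
have n1 : 0 < onorm x + 1 by rewrite ltr_wpDl// onorm_ge0.
have a0 : 0 < a by rewrite invr_gt0 mulr_gt0.
have ax : a * onorm x <= 1 / 2.
  rewrite /a ler_pdivrMl ?mulr_gt0//.
  by have := onorm_ge0 x; lra.
have qx (p q : Q) : p != q -> 0 < onorm (qact p x - qact q x).
  move=> pq; apply: onorm_gt0; rewrite subr_eq0; apply: contra pq => /eqP E.
  have : ((repr q)^-1 * repr p)%g \in N.
    apply: contraT => /hx; rewrite rhoM -[rho (repr p) x]/(qact p x) E.
    by rewrite rhoK eqxx.
  move/coset_id; rewrite morphM ?(in_norm nN)// morphV ?(in_norm nN)//= !coset_reprK.
  by move/eqP; rewrite -eq_mulVg1 eq_sym.
(* The radius is at most half of every distance between centres; the diagonal pairs contribute the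
   bound 1/2, which keeps the discs inside the unit disc, as the centres have norm at most 1/2. *)
have [|r r0 hr] := @finite_lower_bound R (Q * Q)%type (fun pq =>
    if pq.1 != pq.2 then a * onorm (qact pq.1 x - qact pq.2 x) / 2 else 1/2).
  by move=> [p q] /=; case: ifP => [/qx h|_]; rewrite ?divr_gt0// mulr_gt0.
pose c (i : 'I_#|{: Q}|) : R * U := (r, a *: qact (enum_val i) x).
have cc : disc_config c.
  split=> [i|i j ij] /=.
    have := hr (1%g, 1%g); rewrite /= eqxx /= => r2; split=> //.
    rewrite onormZ onorm_rho gtr0_norm//; lra.
  have := hr (enum_val i, enum_val j).
  rewrite /= (inj_eq enum_val_inj) ij -scalerBr onormZ gtr0_norm//; lra.
exists (InfDiscs (disc_config_stage sV0 cc)) => _ /imsetP[g _ ->].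
apply: inf_discsP => i; rewrite /= /discs_act_fun /= /c /= permE enum_rankK.
by rewrite (linZ (rho_linear g)) (rho_qactE nN rho_kernel) mulKVg.
Qed.

Lemma linisom_free_orbits : @op_fixed gT L _ coset_graph_group !=set0 ->
  forall m, exists X : 'I_m -> U, forall a : 'I_m -> Q -> R,
  \sum_i \sum_q a i q *: qact q (X i) = 0 -> forall i q, a i q = 0.
Proof.
move=> [f hf] m; have [v [v1 vfix]] := invariant_unit_vector U.
pose Z := f (dsum_in (enum_rank (1%g : Q)) v).
have ZE (q : Q) : qact q Z = f (dsum_in (enum_rank q) v).
  have xG : (repr q, coset_perm (repr q)) \in coset_graph_group.
    by apply/imsetP; exists (repr q).
  have := linisom_fixed_in (enum_rank q) (hf _ xG) vfix.
  by rewrite /= permE /coset_perm_fun enum_rankK coset_reprK mulVg.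
have Zip (p q : Q) : ip (qact p Z) (qact q Z) = (p == q)%:R.
  rewrite !ZE linisom_ip ip_dsum_in ffunE (inj_eq enum_rank_inj).
  by case: eqP; rewrite ?v1 ?ip0r.
pose V := [set \sum_q a q *: qact q Z | a in [set: Q -> R]].
have fV : fdim_subspace V by exact: fdim_span.
have VZ (q : Q) : V (qact q Z).
  exists (fun p => (p == q)%:R) => //; rewrite (bigD1 q)//= eqxx scale1r.
  by rewrite big1 ?addr0// => p /negPf ->; rewrite scale0r.
have rV : subrep V.
  split; [exact: fdim0|by move=> a x y; exact: fdim_lin|].
  move=> g _ [a _ <-]; rewrite (lin_sum (rho_linear g)).
  apply: fdim_sum_closed => // q; rewrite (linZ (rho_linear g)).
  by apply: fdimZ => //; rewrite (rho_qactE nN rho_kernel).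
have [F [lF iF rF]] := univ_dsum m rV fV.
pose Vn (y : dsum U m) := forall i, V (y i).
have Vn0 : Vn 0 by move=> i; rewrite ffunE; exact: fdim0.
have F0 : F 0 = 0.
  by have := lF (-1) 0 0 Vn0 Vn0; rewrite scaler0 addr0 scaleN1r addNr.
exists (fun i => F (dsum_in i Z)) => a a0.
have Vin i (q : Q) : Vn (dsum_in i (qact q Z)).
  by move=> j; rewrite ffunE; case: ifP => _; [exact: VZ|exact: fdim0].
have Fin i (q : Q) : qact q (F (dsum_in i Z)) = F (dsum_in i (qact q Z)).
  rewrite /qact -rF; last first.
    by have := Vin i 1%g; rewrite (qact1 nN rho_kernel).
  congr F; apply/ffunP => j; rewrite !ffunE; case: ifP => // _.
  exact: rho0.
pose y : dsum U m := \sum_(p : 'I_m * Q) a p.1 p.2 *: dsum_in p.1 (qact p.2 Z).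
(* [F] is linear only on [Vn], so membership is carried along with additivity. *)
have [Vy Fy] : Vn y /\ F y = \sum_(p : 'I_m * Q) a p.1 p.2 *: F (dsum_in p.1 (qact p.2 Z)).
  apply: (big_ind2 (fun x z => Vn x /\ F x = z)) => [//|x z x' z' [Vx <-] [Vx' <-]|p _].
    split; first by move=> i; rewrite ffunE; exact: fdimD.
    by have := lF 1 x x' Vx Vx'; rewrite !scale1r.
  split; first by move=> i; rewrite ffunE; apply: fdimZ => //; exact: Vin.
  by have := lF (a p.1 p.2) _ 0 (Vin p.1 p.2) Vn0; rewrite F0 !addr0.
have y0 : y = 0.
  apply: iF => //; rewrite F0 Fy -[RHS]a0 pair_big; apply: eq_bigr => -[i q] _.
  by rewrite Fin.
move=> i q; have : (y : dsum U m) i = 0 by rewrite y0 ffunE.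
have -> : (y : dsum U m) i = \sum_p a i p *: qact p Z.
  rewrite /y -(pair_big xpredT xpredT (fun i q => a i q *: dsum_in i (qact q Z))) /=.
  rewrite sum_ffunE (bigD1 i)//= sum_ffunE [X in _ + X](_ : _ = 0) ?addr0.
    by apply: eq_bigr => p _; rewrite !ffunE eqxx.
  rewrite big1// => j ji; rewrite sum_ffunE big1// => p _.
  by rewrite !ffunE eq_sym (negPf ji) scaler0.
move=> /(congr1 (fun u => ip u (qact q Z))).
rewrite ip0l ip_suml (bigD1 q)//= ipZl Zip eqxx mulr1 big1 ?addr0// => p pq.
by rewrite ipZl Zip (negPf pq) mulr0.
Qed.

End Necessity.

Theorem theorem1 (R : realType) (gT : finGroupType) (U : universe R gT) :
  operad_zigzag R (infinite_little_discs_operad U) (linear_isometries_operad U)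
  <-> exists (N : {group gT}) (nN : (N <| [set: gT]%G)%g),
        rep_iso U (infsum_rep (perm_rep R nN)).
Proof.
have [b hb] := univ_dim U; split=> [zz|[N [nN iso]]].
  have L0 := (zigzag_fixed zz _).1 (discs_coset_graph U).
  have [e eB] := equivariant_basis_exists (kernel_normal U) (@rho_kernel _ _ U)
    (linisom_free_orbits L0) hb.
  exists (kernel_group U), (kernel_normal U).
  exact: equivariant_basis_rep_iso eB.
have rhoN := rep_iso_kernel iso.
have [e eB] := equivariant_basis_exists nN rhoN (rep_iso_free_orbits iso) hb.
have [code [decode codeK decodeK]] := nat2_bijection.
apply: prod_operad_zigzag.
- exact: discs_hausdorff.
- exact: linisom_hausdorff.
- exact: little_discs_is_operad.
- exact: linear_isometries_is_operad.
move=> n Gam h.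
have GamN : forall x, x \in Gam -> x.1 \in N -> x.2 = 1%g.
  case: h; first exact: discs_fixed_kernel.
  exact: linisom_fixed_kernel.
split; first exact: (discs_fixed_kcontractible nN eB codeK decodeK GamN).
exact: (linisom_fixed_kcontractible nN eB codeK decodeK GamN).
Qed.
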